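(* For every $0<\beta<\alpha<1$ one has $$\mathbf{S}\;\prec_{st}\;(1-\alpha)\,\alpha^{\frac{\alpha}{1-\alpha}}\,\mathbf{Z}_\alpha^{-\frac{\alpha}{1-\alpha}}\;\prec_{st}\;(1-\beta)\,\beta^{\frac{\beta}{1-\beta}}\,\mathbf{Z}_\beta^{-\frac{\beta}{1-\beta}}\;\prec_{st}\;\mathbf{L}$$ and $$\mathbf{L}\;\prec_{cx}\;(1-\beta)\,\mathbf{Z}_\beta^{-\frac{\beta}{1-\beta}}\;\prec_{cx}\;(1-\alpha)\,\mathbf{Z}_\alpha^{-\frac{\alpha}{1-\alpha}}\;\prec_{cx}\;e\,\mathbf{S}.$$
   Context: For $\alpha\in(0,1)$, $\mathbf{Z}_\alpha$ is the standard positive $\alpha$-stable random variable, i.e. the positive random variable with $\mathbb{E}[e^{-\lambda \mathbf{Z}_\alpha}]=e^{-\lambda^\alpha}$ for all $\lambda\ge 0$. $\mathbf{L}$ is the unit exponential random variable. $\mathbf{S}=e^{\mathbf{X}}$, where $\mathbf{X}$ is the real random variable with characteristic function $\mathbb{E}[e^{\mathrm{i}\lambda\mathbf{X}}]=e^{\mathrm{i}\lambda(\log|\lambda|-1)-\pi|\lambda|/2}$, $\lambda\in\mathbb{R}$ (a spectrally negative $1$-stable variable). For real random variables $X,Y$, write $X\le_{st}Y$ if $\mathbb{P}[X\ge x]\le\mathbb{P}[Y\ge x]$ for all $x\in\mathbb{R}$. For positive random variables $X,Y$, the optimal stochastic order $X\prec_{st}Y$ means that $X\le_{st}Y$ and there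 is no $c>1$ such that $cX\le_{st}Y$. The convex order $X\prec_{cx}Y$ means that $\mathbb{E}[\varphi(X)]\le\mathbb{E}[\varphi(Y)]$ for all convex functions $\varphi$ such that the expectations exist. These relations depend only on the laws of the variables. *)

(* Defs.v *)
From HB Require Import structures.
From mathcomp Require Import all_boot all_order all_algebra.
From mathcomp Require Import all_classical all_reals all_analysis.
From mathcomp Require Import complex.

Set Implicit Arguments.
Unset Strict Implicit.
Unset Printing Implicit Defensive.

Import Order.TTheory GRing.Theory Num.Theory.
Import numFieldNormedType.Exports.

Local Open Scope classical_set_scope.
Local Open Scope complex_scope.
Local Open Scope ring_scope.

Definition positive_stable (R : realType) (alpha : R) (d : measure_display)
    (T : measurableType d) (P : probability T R) (Z : {RV P >-> R}) : Prop :=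
  {ae P, forall w, 0 < Z w} /\
  forall lambda : R, 0 <= lambda ->
    'E_P[fun w => expR (- (lambda * Z w))]%E = (expR (- (lambda `^ alpha)))%:E.

(* The equality is restricted to Borel sets: off the sigma-algebra the two
   sides are unrelated extensions. *)
Definition unit_exponential (R : realType) (d : measure_display)
    (T : measurableType d) (P : probability T R) (L : {RV P >-> R}) : Prop :=
  forall A : set R, measurable A ->
    distribution P L A = exponential_prob (1 : R) A.

Definition complex_exp (R : realType) (z : R[i]) : R[i] :=
  let: a +i* b := z in (expR a * cos b) +i* (expR a * sin b).

(* E[e^{i lambda X}], by real and imaginary parts; [fine] loses nothing since
   the integrands are bounded by 1. *)
Definition char_fun (R : realType) (d : measure_display)
    (T : measurableType d) (P : probability T R) (X : {RV P >-> R})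
    (lambda : R) : R[i] :=
  fine 'E_P[fun w => cos (lambda * X w)]%E +i*
  fine 'E_P[fun w => sin (lambda * X w)]%E.

(* At lambda = 0 the exponent is 0, whatever the value of [ln 0]. *)
Definition one_stable (R : realType) (d : measure_display)
    (T : measurableType d) (P : probability T R) (X : {RV P >-> R}) : Prop :=
  forall lambda : R,
    char_fun X lambda =
    complex_exp ((- (pi * `|lambda| / 2)) +i* (lambda * (ln `|lambda| - 1))).

(* The variables compared below may live on different probability spaces. *)
Section Orders.
Context (R : realType) (d d' : measure_display).
Context (T : measurableType d) (T' : measurableType d').
Context (P : probability T R) (Q : probability T' R).

Definition st_le (X : T -> R) (Y : T' -> R) : Prop :=
  forall x : R, (P [set w | x <= X w]%R <= Q [set w | x <= Y w]%R)%E.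

Definition st_prec (X : T -> R) (Y : T' -> R) : Prop :=
  st_le X Y /\ ~ (exists c : R, 1 < c /\ st_le (fun w => c * X w) Y).

End Orders.

(* Existence in the extended sense: the expectation may be infinite, but is
   not of the form [+oo - oo]. *)
Definition expectation_exists (R : realType) (d : measure_display)
    (T : measurableType d) (P : probability T R) (Y : T -> R) : Prop :=
  ('E_P[Y^\+%R] < +oo \/ 'E_P[Y^\-%R] < +oo)%E.

Definition cx_prec (R : realType) (d d' : measure_display)
    (T : measurableType d) (T' : measurableType d')
    (P : probability T R) (Q : probability T' R)
    (X : T -> R) (Y : T' -> R) : Prop :=
  forall phi : R -> R, @convex_function R R^o setT phi ->
    expectation_exists P (phi \o X) -> expectation_exists Q (phi \o Y) ->
    ('E_P[phi \o X] <= 'E_Q[phi \o Y])%E.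

(* Main.v *)
(** By Kanter's representation, (1 - alpha) alpha^(alpha / (1 - alpha)) Z_alpha^(- alpha / (1 - alpha))
    has the law of k_alpha(U) L, where U is uniform on [0, pi], L is an independent unit
    exponential and k_alpha is an explicit function with values in [0, 1].  The law of S is
    obtained in the same way from the limit k_1 of k_alpha as alpha tends to 1, and that of
    L from k_0 = 1.  Since E[L^n] = n!, such laws are determined by their moments, so that
    these representations amount to the moments n^n e^(-n) of S, obtained from the
    characteristic function by a contour shift, and to the trigonometric integrals of
    k_alpha^n, which are contour integrals for binomial coefficients.

    The stochastic inequalities hold because k_alpha decreases with alpha.  The constants
    are optimal because c S <=_st L would give c^n n^n e^(-n) <= n! for all n.  For the
    convex order all means are normalised to 1; for beta < alpha the ratio k_alpha / k_beta
    and k_beta are nonincreasing on ]0, pi[, so that the rescaled kernels cross only once,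
    and a supporting line of the convex function at the crossing level gives the
    inequality. *)

Require Import Defs.
From HB Require Import structures.
From mathcomp Require Import all_boot all_order all_algebra.
From mathcomp Require Import all_classical all_reals all_analysis.
From mathcomp Require Import measurable_realfun ring lra.

Set Implicit Arguments.
Unset Strict Implicit.
Unset Printing Implicit Defensive.

Import Order.TTheory GRing.Theory Num.Theory.
Import numFieldNormedType.Exports.

Local Open Scope classical_set_scope.
Local Open Scope ring_scope.

(** * Calculus on intervals *)

(** The contour arguments are carried out on real functions. The position of the contour is a real
    parameter; the integral is differentiated in it under the integral sign, the Cauchy-Riemann
    equations turn the new integrand into a total derivative along the contour, and its boundary
    terms vanish. The price is explicit domination near 0, near pi and at infinity, locally uniform
    in the parameter: most of the estimates serve this end.

    A mixture is expressed by iterated integrals of nonnegative test functions against the given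
    exponential variable, so that variables on different spaces are compared and infinite
    expectations cause no trouble. For the convex order, a supporting line at the common mean 1 is
    subtracted first, which leaves a nonnegative function and allows the order of integration to be
    exchanged.

    Optimality of the three constants rests on one obstruction. As S lies at the bottom of the chain
    and L at the top, improving any link by a factor c > 1 yields c S <=_st L. *)

Section derivation.
Context {R : realType}.
Implicit Types (f g : R -> R) (x a b : R).

Lemma is_derive_fD f g x a b : is_derive x 1 f a -> is_derive x 1 g b ->
  is_derive x 1 (fun y => f y + g y) (a + b).
Proof. exact: is_deriveD. Qed.

Lemma is_derive_fN f x a : is_derive x 1 f a ->
  is_derive x 1 (fun y => - f y) (- a).
Proof. exact: is_deriveN. Qed.

Lemma is_derive_fM f g x a b : is_derive x 1 f a -> is_derive x 1 g b ->
  is_derive x 1 (fun y => f y * g y) (a * g x + f x * b).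
Proof.
move=> fa gb; apply: is_derive_eq (is_deriveM fa gb) _.
by rewrite addrC [_ *: a]mulrC.
Qed.

Lemma is_derive_fcst c x : is_derive x 1 (fun _ : R => c : R) (0 : R).
Proof. exact: is_derive_cst. Qed.

Lemma is_derive_fid x : is_derive x 1 (fun y : R => y) (1 : R).
Proof. exact: is_derive_id. Qed.

Lemma is_derive_fV f x a : f x != 0 -> is_derive x 1 f a ->
  is_derive x 1 (fun y => (f y)^-1) (- a / f x ^+ 2).
Proof.
move=> fx fa; apply: is_derive_eq (is_deriveV fx fa) _.
by rewrite /GRing.scale/= mulNr mulrC mulNr.
Qed.

Lemma is_derive_fcomp f g x a b : is_derive (g x) 1 f a -> is_derive x 1 g b ->
  is_derive x 1 (fun y => f (g y)) (b * a).
Proof.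
by move=> fa gb; apply: is_derive_eq (is_derive1_comp fa gb) _; rewrite mulrC.
Qed.

Lemma is_derive_fX f n x a : is_derive x 1 f a ->
  is_derive x 1 (fun y => f y ^+ n) (n%:R * f x ^+ n.-1 * a).
Proof.
move=> fa; elim: n => [|n IHn].
  by rewrite !mul0r; apply: is_derive_fcst.
have -> : (fun y => f y ^+ n.+1) = (fun y => f y * f y ^+ n).
  by apply/funext => y; rewrite exprS.
apply: is_derive_eq (is_derive_fM fa IHn) _ => /=.
case: n {IHn} => [|n] /=; first by rewrite expr0; ring.
by rewrite [f x ^+ n.+1]exprS -[n.+2%:R]natr1; ring.
Qed.

Lemma is_derive_fexpR f x a : is_derive x 1 f a ->
  is_derive x 1 (fun y => expR (f y)) (a * expR (f x)).
Proof. by move=> fa; apply: is_derive_fcomp => //; exact: is_derive_expR. Qed.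

Lemma is_derive_fln f x a : 0 < f x -> is_derive x 1 f a ->
  is_derive x 1 (fun y => ln (f y)) (a / f x).
Proof. by move=> f0 fa; apply: is_derive_fcomp => //; exact: is_derive1_ln. Qed.

Lemma is_derive_fsin f x a : is_derive x 1 f a ->
  is_derive x 1 (fun y => sin (f y)) (a * cos (f x)).
Proof. by move=> fa; apply: is_derive_fcomp => //; exact: is_derive_sin. Qed.

Lemma is_derive_fcos f x a : is_derive x 1 f a ->
  is_derive x 1 (fun y => cos (f y)) (- (a * sin (f x))).
Proof.
move=> fa; apply: is_derive_eq (is_derive_fcomp (is_derive_cos _) fa) _.
by rewrite mulrN.
Qed.

Lemma is_derive_fatan f x a : is_derive x 1 f a ->
  is_derive x 1 (fun y => atan (f y)) (a / (1 + f x ^+ 2)).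
Proof. by move=> fa; apply: is_derive_fcomp => //; exact: is_derive1_atan. Qed.

End derivation.

(** The derivative is synthesised by unification from the pointwise rules above; what remains are
    the side conditions on denominators and logarithms, and for [derive_to] one algebraic
    identity. *)
Ltac der := match goal with
  | |- is_derive _ _ (fun _ => ?c) _ => apply: is_derive_fcst
  | |- is_derive _ _ (fun y => y) _ => apply: is_derive_fid
  | |- is_derive _ _ (fun y => @?f y + @?g y) _ =>
      eapply (@is_derive_fD _ f g); der
  | |- is_derive _ _ (fun y => - @?f y) _ => eapply (@is_derive_fN _ f); der
  | |- is_derive _ _ (fun y => @?f y * @?g y) _ =>
      eapply (@is_derive_fM _ f g); der
  | |- is_derive _ _ (fun y => (@?f y)^-1) _ =>
      eapply (@is_derive_fV _ f); [|der]
  | |- is_derive _ _ (fun y => @?f y ^+ ?n) _ => eapply (@is_derive_fX _ f); der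
  | |- is_derive _ _ (fun y => expR (@?f y)) _ =>
      eapply (@is_derive_fexpR _ f); der
  | |- is_derive _ _ (fun y => ln (@?f y)) _ =>
      eapply (@is_derive_fln _ f); [|der]
  | |- is_derive _ _ (fun y => sin (@?f y)) _ =>
      eapply (@is_derive_fsin _ f); der
  | |- is_derive _ _ (fun y => cos (@?f y)) _ =>
      eapply (@is_derive_fcos _ f); der
  | |- is_derive _ _ (fun y => atan (@?f y)) _ =>
      eapply (@is_derive_fatan _ f); der
  | H : is_derive _ _ ?f _ |- is_derive _ _ ?f _ => eapply H
  | H : is_derive _ _ ?f _ |- is_derive _ _ (fun y => ?f y) _ => eapply H
  | _ => idtac
  end.

Ltac derive_to := eapply is_derive_eq; [der|].

Section derivation_theory.
Context {R : realType}.
Implicit Types (f g : R -> R) (x a b : R).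

Lemma is_derive_continuous f x a : is_derive x 1 f a -> {for x, continuous f}.
Proof.
by move=> fa; apply: differentiable_continuous; apply/derivable1_diffP.
Qed.

Lemma ge0_derive_le f f' (I : interval R) :
  {in I, forall x, is_derive x 1 f (f' x)} -> {in I, forall x, 0 <= f' x} ->
  {in I &, forall x y, x <= y -> f x <= f y}.
Proof.
move=> df f'0 x y xI yI xy.
have sub z : z \in `[x, y] -> z \in I.
  rewrite in_itv/= => /andP[xz zy].
  have /= := @interval_is_interval _ I x y xI yI z; apply.
  by rewrite xz zy.
have [||c cxy e] := @MVT_segment R f f' x y xy.
- by move=> z zxy; apply/df/sub; apply: subset_itv_oo_cc.
- apply: derivable_within_continuous => z zxy; have [] := df z (sub _ zxy) => //.
- by rewrite -subr_ge0 e mulr_ge0 ?subr_ge0// f'0// sub.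
Qed.

Lemma mvt_derive f f' x y : x < y ->
  (forall t, x <= t <= y -> is_derive t (1:R) f (f' t)) ->
  exists2 c, x <= c <= y & f y - f x = f' c * (y - x).
Proof.
move=> xy df.
have [|| c cxy e] := @MVT R f f' x y xy.
- by move=> t; rewrite in_itv/= => txy; apply: df; lra.
- apply: derivable_within_continuous => t; rewrite in_itv/= => txy.
  by have [] := df t txy.
by exists c => //; move: cxy; rewrite in_itv/=; lra.
Qed.

Lemma FTC_segment f F a b : a < b ->
  {in `[a, b], continuous f} -> {in `[a, b], forall x, is_derive x (1:R) F (f x)} ->
  \int[lebesgue_measure]_(x in `[a, b]) f x = F b - F a.
Proof.
move=> ab cf dF; rewrite /Rintegral (@continuous_FTC2 _ f F)//=.
- by apply: continuous_in_subspaceT => x /set_mem; exact: cf.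
- split.
  + by move=> x xab; have [] := dF x (subset_itv_oo_cc xab).
  + apply: cvg_at_right_filter; apply: is_derive_continuous (dF a _).
    by rewrite in_itv/= lexx ltW.
  + apply: cvg_at_left_filter; apply: is_derive_continuous (dF b _).
    by rewrite in_itv/= lexx ltW.
- move=> x xab; rewrite derive1E; exact: (@derive_val _ _ _ _ _ _ _ (dF x (subset_itv_oo_cc xab))).
Qed.

End derivation_theory.

(** * Improper integrals and differentiation under the integral sign *)

Section integration.
Context {R : realType}.
Let mu := @lebesgue_measure R.

Lemma cvg_dominated_Rintegral d (T : measurableType d)
    (m : {measure set T -> \bar R}) (D : set T) (f_ : nat -> T -> R)
    (f g : T -> R) : measurable D -> (forall n, measurable_fun D (f_ n)) ->
  (forall x, D x -> f_ ^~ x @ \oo --> f x) -> m.-integrable D (EFin \o g) ->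
  (forall n x, D x -> `|f_ n x| <= g x) ->
  m.-integrable D (EFin \o f) /\
  \int[m]_(x in D) f_ n x @[n --> \oo] --> \int[m]_(x in D) f x.
Proof.
move=> mD mf_ ff ig fg.
have mf : measurable_fun D f by exact: (measurable_fun_cvg mf_ ff).
have [||||iF _ cF] := @dominated_convergence _ T R m D mD (fun n x => (f_ n x)%:E)
  (EFin \o f) (EFin \o g) _ _ _ ig.
- by move=> n; apply/measurable_EFinP; exact: mf_.
- exact/measurable_EFinP.
- by apply: aeW => x Dx; apply: cvg_EFin; [exact: nearW|exact: ff].
- by apply: aeW => x n Dx; rewrite lee_fin; exact: fg.
split=> //; apply: fine_cvg => /=; rewrite fineK//; exact: integrable_fin_num.
Qed.

(** Dominated convergence with bound [|f|] along the growing segments. The primitive is only used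
    inside [D], so it may be undefined or singular at the ends; bounded and unbounded intervals are
    both covered. *)
Lemma FTC_exhaustion (D : set R) (f F : R -> R) (a_ b_ : nat -> R) (l : R) :
  measurable D -> mu.-integrable D (EFin \o f) ->
  (forall n, a_ n < b_ n) -> (forall n, `[a_ n, b_ n]%classic `<=` D) ->
  (forall x, D x -> \forall n \near \oo, x \in `[a_ n, b_ n]) ->
  {in D, continuous f} -> (forall x, D x -> is_derive x (1:R) F (f x)) ->
  F (b_ n) - F (a_ n) @[n --> \oo] --> l ->
  \int[mu]_(x in D) f x = l.
Proof.
move=> mD intf ab abD xab cf dF Fl.
have mf : measurable_fun D f by case/integrableP: intf => /measurable_EFinP.
have [||||_ h] := @cvg_dominated_Rintegral _ _ mu D
  (fun n => f \_ `[a_ n, b_ n]) f (fun x => `|f x|) mD.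
- move=> n; apply/(measurable_restrict _ _ mD) => //.
  exact: measurable_funS mf.
- move=> x Dx; apply: cvg_near_cst; near=> n.
  rewrite patchE mem_set//=; near: n; exact: xab.
- exact: integrable_norm intf.
- by move=> n x Dx; rewrite patchE; case: ifP => // _; rewrite normr0.
apply: (cvg_unique _ h) => //.
rewrite (_ : (fun n => _) = (fun n => F (b_ n) - F (a_ n)))//.
apply/funext => n; rewrite -Rintegral_mkcondr setIidr//.
apply: FTC_segment => // x xab'; [apply: cf|apply: dF]; rewrite ?inE; exact: (abD n).
Unshelve. all: by end_near. Qed.

Lemma FTC_oo (c d : R) (f F : R -> R) (l0 l1 : R) : c < d ->
  mu.-integrable `]c, d[ (EFin \o f) ->
  {in `]c, d[, forall x, {for x, continuous f}} ->
  {in `]c, d[, forall x, is_derive x (1:R) F (f x)} ->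
  F x @[x --> c^'+] --> l0 -> F x @[x --> d^'-] --> l1 ->
  \int[mu]_(x in `]c, d[) f x = l1 - l0.
Proof.
move=> cd intf cf dF F0 F1.
have dc : 0 < d - c by rewrite subr_gt0.
(* The shift by 3 keeps [e n] strictly below half the length, so that no segment is degenerate. *)
pose e n := (d - c) / n.+3%:R.
have e0 n : 0 < e n by rewrite divr_gt0.
have e1 n : e n < (d - c) / 2 by rewrite /e ltr_pM2l// ltf_pV2 ?posrE// ltr_nat.
have ecvg : e n @[n --> \oo] --> (0:R).
  rewrite -(mulr0 (d - c)); apply: cvgMr.
  have := @cvg_shiftS _ (fun n => n.+2%:R^-1 : R^o) (nbhs (0:R)).
  move=> ->; have -> := @cvg_shiftS _ (fun n => n.+1%:R^-1 : R^o) (nbhs (0:R)).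
  exact: cvg_harmonic.
apply: (@FTC_exhaustion _ f F (fun n => c + e n) (fun n => d - e n)) => //.
- by move=> n; have := e1 n; lra.
- by move=> n x /=; rewrite !in_itv/=; have := e0 n; have := e1 n; lra.
- move=> x /=; rewrite in_itv/= => /andP[cx xd].
  near=> n; rewrite in_itv/=; apply/andP; split.
    have : e n < x - c.
      by near: n; move/cvgr_lt : ecvg; apply; rewrite subr_gt0.
    lra.
  have : e n < d - x by near: n; move/cvgr_lt : ecvg; apply; rewrite subr_gt0.
  lra.
- by move=> x; rewrite inE => xcd; exact: cf.
- apply: cvgB.
  + apply: (cvg_at_leftP F d l1).1 F1 _ _ => //; split.
      by move=> n; have := e0 n; lra.
    by rewrite -[X in _ --> X]subr0; apply: cvgB => //; exact: cvg_cst.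
  + apply: (cvg_at_rightP F c l0).1 F0 _ _ => //; split.
      by move=> n; have := e0 n; lra.
    by rewrite -[X in _ --> X]addr0; apply: cvgD => //; exact: cvg_cst.
Unshelve. all: by end_near. Qed.

Lemma FTC_oy (f F : R -> R) (l0 l1 : R) :
  mu.-integrable `]0, +oo[ (EFin \o f) ->
  {in `]0, +oo[, forall x, {for x, continuous f}} ->
  {in `]0, +oo[, forall x, is_derive x (1:R) F (f x)} ->
  F x @[x --> 0^'+] --> l0 -> F x @[x --> +oo] --> l1 ->
  \int[mu]_(x in `]0, +oo[) f x = l1 - l0.
Proof.
move=> intf cf dF F0 F1.
have ecvg : (n.+2%:R^-1 : R) @[n --> \oo] --> (0:R).
  have -> := @cvg_shiftS _ (fun n => n.+1%:R^-1 : R^o) (nbhs (0:R)).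
  exact: cvg_harmonic.
apply: (@FTC_exhaustion _ f F (fun n => n.+2%:R^-1) (fun n => n.+2%:R)) => //.
- move=> n; apply: (@lt_trans _ _ 1); last by rewrite ltr1n.
  by rewrite invf_lt1// ltr1n.
- move=> n x /=; rewrite !in_itv/= andbT => /andP[+ _]; apply: lt_le_trans.
  by rewrite invr_gt0.
- move=> x /=; rewrite in_itv/= andbT => x0.
  near=> n; rewrite in_itv/=; apply/andP; split.
    by apply/ltW; near: n; move/cvgr_lt : ecvg; apply.
  near: n; exists (Num.truncn x) => // n /= xn; apply/ltW.
  by rewrite (lt_le_trans (truncnS_gt x))// ler_nat ltnS leqW.
- by move=> x; rewrite inE => xcd; exact: cf.
- apply: cvgB.
  + apply: (cvg_comp _ _ _ F1); apply/cvgryPge => A.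
    near=> n; apply: (@le_trans _ _ n%:R); last by rewrite ler_nat leqW.
    by near: n; exact: nbhs_infty_ger.
  + by apply: (cvg_at_rightP F 0 l0).1 F0 _ _ => //; split.
Unshelve. all: by end_near. Qed.

Lemma is_derive_under_Rintegral d (T : measurableType d)
    (m : {measure set T -> \bar R}) (B : set T) (a u v : R)
    (f f' : R -> T -> R) (G : T -> R) : measurable B -> u < a < v ->
  (forall x, u < x < v -> m.-integrable B (EFin \o f x)) ->
  (forall x y, u < x < v -> B y -> is_derive x (1:R) (f ^~ y) (f' x y)) ->
  m.-integrable B (EFin \o G) ->
  (forall x y, u < x < v -> B y -> `|f' x y| <= G y) ->
  is_derive a (1:R) (fun x => \int[m]_(y in B) f x y) (\int[m]_(y in B) f' a y).
Proof.
move=> mB auv intf df iG fG.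
have pE x y : u < x < v -> B y -> partial1of2 f x y = f' x y.
  by move=> xuv By; rewrite partial1of2E; have := df x y xuv By => -[].
have Iuv x : `]u, v[%classic x -> u < x < v by rewrite /= in_itv.
have aI : `]u, v[%classic a by rewrite /= in_itv.
have df' x y : `]u, v[%classic x -> B y -> derivable (f ^~ y) x 1.
  by move=> /Iuv xuv By; have [] := df x y xuv By.
have iG' : m.-integrable B (EFin \o (fun y => `|G y|)) by exact: integrable_norm.
have fG' x y : `]u, v[%classic x -> B y -> `|partial1of2 f x y| <= `|G y|.
  by move=> /Iuv xuv By; rewrite pE// (le_trans (fG _ _ xuv By))// ler_norm.
have intf' x : `]u, v[%classic x -> m.-integrable B (EFin \o f x).
  by move/Iuv; exact: intf.
have G0 y : 0 <= `|G y| by [].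
apply: DeriveDef.
  exact: (derivable_under_integral mB aI intf' df' G0 iG' fG').
rewrite -derive1E (differentiation_under_integral mB aI intf' df' G0 iG' fG').
by apply: eq_Rintegral => y /set_mem By; rewrite pE.
Qed.

Lemma eq_of_derive0 (u v : R) (H : R -> R) :
  (forall x, u < x < v -> is_derive x (1:R) H (0:R)) ->
  forall x y, u < x < v -> u < y < v -> H x = H y.
Proof.
move=> dH; suff h x y : u < x < v -> u < y < v -> x <= y -> H x = H y.
  by move=> x y xuv yuv; have [/h->//|/ltW/h->//] := leP x y.
move=> xuv yuv xy.
have sub z : z \in `[x, y] -> u < z < v by rewrite in_itv/=; lra.
have [||c cxy /eqP] := @MVT_segment R H (fun=> 0) x y xy.
- by move=> z zxy; apply/dH/sub; apply: subset_itv_oo_cc.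
- by apply: derivable_within_continuous => z zxy; have [] := dH z (sub _ zxy).
- by rewrite mul0r subr_eq0 => /eqP.
Qed.

End integration.

Section integrable_real.
Context d (T : measurableType d) (R : realType) (m : {measure set T -> \bar R}).
Variables (D : set T) (mD : measurable D).
Implicit Types f g : T -> R.

Lemma integrable_fB f g : m.-integrable D (EFin \o f) ->
  m.-integrable D (EFin \o g) -> m.-integrable D (EFin \o (fun x => f x - g x)).
Proof. exact: integrableB. Qed.

Lemma integrable_fD f g : m.-integrable D (EFin \o f) ->
  m.-integrable D (EFin \o g) -> m.-integrable D (EFin \o (fun x => f x + g x)).
Proof. exact: integrableD. Qed.

Lemma integrable_fZl (c : R) f : m.-integrable D (EFin \o f) ->
  m.-integrable D (EFin \o (fun x => c * f x)).
Proof. by move=> fi; have := integrableZl mD c fi; apply. Qed.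

End integrable_real.

(** * Trigonometric inequalities *)

Section trigonometry.
Context {R : realType}.
Implicit Types (x u c : R).

Lemma xcos_le_sin x : 0 <= x <= pi -> x * cos x <= sin x.
Proof.
move=> /andP[x0 xpi].
pose f (t : R) := sin t - t * cos t.
have df : {in `[0, pi], forall t, is_derive t (1:R) f (t * sin t)}.
  by move=> t _; rewrite /f; derive_to; ring.
have df0 : {in `[0, pi], forall t : R, 0 <= t * sin t}.
  by move=> t; rewrite in_itv/= => t01; rewrite mulr_ge0 ?sin_ge0_pi//; lra.
have := @ge0_derive_le R f _ _ df df0 0 x.
rewrite !in_itv/= lexx x0 xpi pi_ge0 => /(_ isT isT isT).
by rewrite /f sin0 mul0r subrr subr_ge0.
Qed.

Lemma sin_le_id x : 0 <= x -> sin x <= x.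
Proof.
move=> x0; pose f (t : R) := t - sin t.
have df : {in `[0, x], forall t, is_derive t (1:R) f (1 - cos t)}.
  by move=> t _; rewrite /f; derive_to; ring.
have df0 : {in `[0, x], forall t : R, 0 <= 1 - cos t}.
  by move=> t _; rewrite subr_ge0 cos_le1.
have := @ge0_derive_le R f _ _ df df0 0 x.
rewrite !in_itv/= !lexx x0 => /(_ isT isT isT).
by rewrite /f sin0 subrr subr_ge0.
Qed.

(** By [xcos_le_sin] the quotient sin t / t decreases, so it is least at pi / 2. *)
Lemma jordan_ineq x : 0 <= x <= pi / 2 -> 2 / pi * x <= sin x.
Proof.
move=> /andP[]; rewrite le_eqVlt => /predU1P[<-|x0 xpi].
  by rewrite mulr0 sin0.
have pi0 : 0 < (pi : R) := pi_gt0 R.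
pose f (t : R) := - (sin t / t).
have df : {in `[x, pi / 2], forall t, is_derive t (1:R) f ((sin t - t * cos t) / t ^+ 2)}.
  move=> t; rewrite in_itv/= => t01; rewrite /f; derive_to; first by apply: lt0r_neq0; lra.
  by field; apply: lt0r_neq0; lra.
have df0 : {in `[x, pi / 2], forall t : R, 0 <= (sin t - t * cos t) / t ^+ 2}.
  move=> t; rewrite in_itv/= => t01; rewrite divr_ge0 ?sqr_ge0// subr_ge0.
  by rewrite xcos_le_sin//; lra.
have := @ge0_derive_le R f _ _ df df0 x (pi / 2).
rewrite !in_itv/= !lexx xpi => /(_ isT isT isT).
rewrite /f sin_pihalf lerN2 ler_pdivlMr//.
by rewrite div1r invf_div.
Qed.

(** On the first half this is Jordan's inequality weakened by the factor (pi - x) / pi; the parabola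
    is symmetric about pi / 2, which gives the second half. *)
Lemma sin_lower_bound x : 0 <= x <= pi -> 2 / pi ^+ 2 * x * (pi - x) <= sin x.
Proof.
move=> x0; have pi0 : 0 < (pi : R) := pi_gt0 R.
have h (y : R) : 0 <= y <= pi / 2 -> 2 / pi ^+ 2 * y * (pi - y) <= sin y.
  move=> y0; apply: le_trans (jordan_ineq y0).
  have -> : 2 / pi ^+ 2 * y * (pi - y) = 2 / pi * y * ((pi - y) / pi).
    by move: (pi : R) pi0 => p p0; field; rewrite gt_eqF.
  rewrite ler_piMr//; first by rewrite mulr_ge0 ?divr_ge0//; lra.
  by rewrite ler_pdivrMr//; lra.
have [xp|xp] := lerP x (pi / 2); first by apply: h; lra.
have -> : sin x = sin (pi - x) by rewrite sinB sinpi cospi; ring.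
have -> : 2 / pi ^+ 2 * x * (pi - x) = 2 / pi ^+ 2 * (pi - x) * (pi - (pi - x)) by ring.
by apply: h; lra.
Qed.

(** A linear bound valid up to u = pi: the factor 1 - c measures how far c u stays from pi, the
    other zero of the sine. *)
Lemma sinM_lower_bound c u : 0 < c < 1 -> 0 < u < pi ->
  2 / pi * c * (1 - c) * u <= sin (c * u).
Proof.
move=> c01 u0; have pi0 : 0 < (pi : R) := pi_gt0 R.
have cu0 : 0 < c * u by rewrite mulr_gt0//; lra.
have cupi : c * u < c * pi by rewrite ltr_pM2l//; lra.
have cpi : c * pi < pi by rewrite gtr_pMl//; lra.
apply: le_trans (sin_lower_bound (x := c * u) _); last by lra.
have -> : 2 / pi * c * (1 - c) * u = 2 / pi ^+ 2 * (c * u) * (pi - c * pi).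
  by move: (pi : R) pi0 => p p0; field; rewrite gt_eqF.
apply: ler_wpM2l; last by lra.
by rewrite mulr_ge0 ?divr_ge0 ?sqr_ge0//; lra.
Qed.

Lemma itvM_pi c u : 0 < c < 1 -> 0 < u < pi -> 0 < c * u < pi.
Proof.
move=> c01 u0; apply/andP; split; first by rewrite mulr_gt0//; lra.
suff : c * u < u by lra.
by rewrite gtr_pMl; lra.
Qed.

Lemma sinM_gt0 c u : 0 < c < 1 -> 0 < u < pi -> 0 < sin (c * u).
Proof. by move=> *; rewrite sin_gt0_pi// itvM_pi. Qed.

Lemma cvg_ln_sinc : ln (sin x / x) @[x --> (0:R)^'+] --> (0:R).
Proof.
have pi0 : 0 < (pi : R) := pi_gt0 R.
have c1 : ln (cos x) @[x --> (0:R)^'+] --> (0:R).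
  suff : ln (cos x) @[x --> (0:R)^'+] --> ln (cos (0:R)) by rewrite cos0 ln1.
  apply: cvg_at_right_filter.
  apply: (@continuous_comp R R R cos (@ln R)); first exact: continuous_cos.
  by apply: continuous_ln; rewrite cos0.
apply: (squeeze_cvgr _ c1 (cvg_cst 0)).
near=> x.
have x0 : 0 < x by near: x; exact: nbhs_right_gt.
have xp : x < pi / 2 by near: x; apply: nbhs_right_lt; rewrite divr_gt0.
have cx : 0 < cos x by rewrite cos_gt0_pihalf//; lra.
have sx : 0 < sin x by rewrite sin_gt0_pi//; lra.
rewrite ler_ln ?posrE ?divr_gt0// ler_pdivlMr// mulrC xcos_le_sin/=; last lra.
by rewrite ln_le0// ler_pdivrMr// mul1r sin_le_id// ltW.
Unshelve. all: by end_near. Qed.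

End trigonometry.

(** * Monotonicity of Kanter's kernel *)

Section kanter.
Context {R : realType}.
Implicit Types (a b u v x y z : R).

Definition cot x : R := cos x / sin x.

Definition kanter_rate a u : R :=
  (a ^+ 2 * cot (a * u) + (1 - a) ^+ 2 * cot ((1 - a) * u) - cot u) / (1 - a).

(* Logarithm of Kanter's kernel
   (1 - a) a^(a / (1 - a)) sin(u)^(1 / (1 - a)) / (sin((1 - a) u) sin(a u)^(a / (1 - a))),
   which tends to 1 at 0; [kanter_rate] is the opposite of its derivative. *)
Definition ln_kanter a u : R :=
  ln (1 - a) + a / (1 - a) * ln a + (1 - a)^-1 * ln (sin u)
  - ln (sin ((1 - a) * u)) - a / (1 - a) * ln (sin (a * u)).

Lemma is_derive_ln_kanter a u : 0 < a < 1 -> 0 < u < pi ->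
  is_derive u (1:R) (ln_kanter a) (- kanter_rate a u).
Proof.
move=> a01 u0.
have b01 : 0 < 1 - a < 1 by lra.
have su : 0 < sin u by exact: sin_gt0_pi.
have sa := sinM_gt0 a01 u0; have sb := sinM_gt0 b01 u0.
rewrite /ln_kanter; derive_to => //.
rewrite /kanter_rate /cot; field.
by rewrite !gt_eqF//; lra.
Qed.

(** With s = t u, the derivative of t cot(t u) in t is (sin s cos s - s) / sin(s)^2, which is
    nonpositive. *)
Lemma cot_scaled_le x y u : 0 < u < pi -> 0 < x -> x <= y -> y <= 1 ->
  y * cot (y * u) <= x * cot (x * u).
Proof.
move=> u0 x0 xy y1.
pose f t := - (t * cot (t * u)).
have itv t : t \in `[x, y] -> 0 < t * u < pi.
  rewrite in_itv/= => txy; apply/andP; split; first by rewrite mulr_gt0//; lra.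
  by rewrite (@le_lt_trans _ _ u)//; [rewrite ler_piMl//; lra|lra].
have s0 t : t \in `[x, y] -> 0 < sin (t * u) by move/itv/sin_gt0_pi.
have df : {in `[x, y], forall t, is_derive t (1:R) f
    ((t * u - sin (t * u) * cos (t * u)) / sin (t * u) ^+ 2)}.
  move=> t txy; have s := s0 t txy; rewrite /f /cot; derive_to.
    by rewrite gt_eqF.
  by field: (cos2sin2 (t * u)); rewrite gt_eqF.
have df0 : {in `[x, y], forall t : R, 0 <= (t * u - sin (t * u) * cos (t * u)) / sin (t * u) ^+ 2}.
  move=> t txy; rewrite divr_ge0 ?sqr_ge0// subr_ge0.
  have tu := itv t txy; apply: (@le_trans _ _ (sin (t * u))).
    by rewrite ler_piMr ?cos_le1// ltW// s0.
  by rewrite sin_le_id//; lra.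
have := @ge0_derive_le R f _ _ df df0 x y.
by rewrite !in_itv/= !lexx xy /f lerN2 => /(_ isT isT isT).
Qed.

(** Split cot u with weights a and 1 - a; each part is dominated by [cot_scaled_le] with upper scale
    1. *)
Lemma kanter_rate_ge0 a u : 0 < a < 1 -> 0 < u < pi -> 0 <= kanter_rate a u.
Proof.
move=> a01 u0; rewrite /kanter_rate divr_ge0//; last by lra.
have h1 := @cot_scaled_le a 1 u u0; have h2 := @cot_scaled_le (1 - a) 1 u u0.
rewrite subr_ge0; have -> : cot u = a * (1 * cot (1 * u)) + (1 - a) * (1 * cot (1 * u)).
  by rewrite !mul1r; ring.
by rewrite !expr2 -!mulrA lerD// ler_wpM2l//; lra.
Qed.

(** The function g(t) = - t^2 cot(t u) is convex on ]0, 1]: with s = t u its second derivative is a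
    positive multiple of s (sin s - s cos s) + sin s (s - sin s cos s). The constant c separates the
    chord slopes of g on [x, y] and [y, z]; it is g' at a mean value point of [y, z]. *)
Lemma sqr_cot_convex x y z u : 0 < u < pi -> 0 < x -> x < y -> y < z -> z <= 1 ->
  exists c, [/\ y ^+ 2 * cot (y * u) - z ^+ 2 * cot (z * u) >= c * (z - y) &
              x ^+ 2 * cot (x * u) - y ^+ 2 * cot (y * u) <= c * (y - x)].
Proof.
move=> u0 x0 xy yz z1.
pose m (t : R) : R := - (2 * t) * cot (t * u) + t ^+ 2 * u / sin (t * u) ^+ 2.
pose g (t : R) : R := - (t ^+ 2 * cot (t * u)).
have itv t : t \in `[x, z] -> 0 < t * u < pi.
  rewrite in_itv/= => txy; apply/andP; split; first by rewrite mulr_gt0//; lra.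
  by rewrite (@le_lt_trans _ _ u)//; [rewrite ler_piMl//; lra|lra].
have s0 t : t \in `[x, z] -> 0 < sin (t * u) by move/itv/sin_gt0_pi.
have dg t : t \in `[x, z] -> is_derive t (1:R) g (m t).
  move=> txz; have s := s0 t txz; rewrite /g /m /cot; derive_to.
    by rewrite gt_eqF.
  by field: (cos2sin2 (t * u)); rewrite gt_eqF.
have dm : {in `[x, z], forall t, is_derive t (1:R) m
   (2 / sin (t * u) ^+ 3 * ((t * u) * (sin (t * u) - (t * u) * cos (t * u))
                    + sin (t * u) * (t * u - cos (t * u) * sin (t * u))))}.
  move=> t txz; have s := s0 t txz; rewrite /m /cot; derive_to.
  - by rewrite gt_eqF.
  - by rewrite expf_neq0// gt_eqF.
  by field: (cos2sin2 (t * u)); rewrite gt_eqF.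
have dm0 : {in `[x, z], forall t : R, 0 <=
   (2 / sin (t * u) ^+ 3 * ((t * u) * (sin (t * u) - (t * u) * cos (t * u))
                    + sin (t * u) * (t * u - cos (t * u) * sin (t * u))))}.
  move=> t txz; have s := s0 t txz; have tu := itv t txz.
  rewrite mulr_ge0 ?divr_ge0 ?exprn_ge0 ?(ltW s)// addr_ge0//.
    by rewrite mulr_ge0 ?subr_ge0 ?xcos_le_sin//; lra.
  rewrite mulr_ge0 ?(ltW s)// subr_ge0; apply: (@le_trans _ _ (sin (t * u))).
    by rewrite ler_piMl ?cos_le1// ltW.
  by rewrite sin_le_id//; lra.
have mono := @ge0_derive_le R m _ _ dm dm0.
have itvl t : x <= t <= y -> t \in `[x, z] by rewrite in_itv/=; lra.
have itvr t : y <= t <= z -> t \in `[x, z] by rewrite in_itv/=; lra.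
have [c1 c1xy e1] := mvt_derive xy (fun t txy => dg t (itvl t txy)).
have [c2 c2yz e2] := mvt_derive yz (fun t tyz => dg t (itvr t tyz)).
have m12 : m c1 <= m c2 by apply: mono; rewrite ?in_itv/=; lra.
exists (m c2); split.
  by rewrite -e2 /g; lra.
have -> : x ^+ 2 * cot (x * u) - y ^+ 2 * cot (y * u) = g y - g x by rewrite /g; lra.
by rewrite e1 ler_wpM2r//; lra.
Qed.

(** The rate at x is the slope of the convex function - t^2 cot(t u) between x and 1, plus (1 - x)
    cot((1 - x) u). Both increase with x, the first by convexity and the second by
    [cot_scaled_le]. *)
Lemma kanter_rate_le a b u : 0 < b -> b < a -> a < 1 -> 0 < u < pi ->
  kanter_rate b u <= kanter_rate a u.
Proof.
move=> b0 ba a1 u0.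
have [c []] := @sqr_cot_convex b a 1 u u0 b0 ba a1 (lexx _).
rewrite expr1n !mul1r => h1 h2.
have h3 : (1 - b) * cot ((1 - b) * u) <= (1 - a) * cot ((1 - a) * u).
  by apply: cot_scaled_le; lra.
have E x : x < 1 -> kanter_rate x u = (x ^+ 2 * cot (x * u) - cot u) / (1 - x)
                             + (1 - x) * cot ((1 - x) * u).
  by move=> x1; rewrite /kanter_rate; field; rewrite gt_eqF//; lra.
rewrite !E//; last by lra.
apply: lerD => //.
set s := (a ^+ 2 * cot (a * u) - cot u) / (1 - a).
have es : a ^+ 2 * cot (a * u) - cot u = s * (1 - a).
  by rewrite /s divfK// gt_eqF//; lra.
have cs : c <= s by rewrite ler_pdivlMr//; lra.
have cs' : c * (a - b) <= s * (a - b) by rewrite ler_wpM2r//; lra.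
rewrite ler_pdivrMr; last by lra.
have -> : s * (1 - b) = s * (1 - a) + s * (a - b) by ring.
by rewrite -es; lra.
Qed.

(** The powers of u cancel because 1 / (1 - a) - 1 - a / (1 - a) = 0, and the normalising constants
    absorb the scales a and 1 - a. What remains is a combination of ln(sin(c u) / (c u)). *)
Lemma cvg_ln_kanter a : 0 < a < 1 -> ln_kanter a u @[u --> (0:R)^'+] --> (0:R).
Proof.
move=> a01; have b01 : 0 < 1 - a < 1 by lra.
have pi0 : 0 < (pi : R) := pi_gt0 R.
have sc c : 0 < c -> ln (sin (c * u) / (c * u)) @[u --> (0:R)^'+] --> (0:R).
  move=> c0; apply/cvg_at_rightP => v [v0 cv].
  apply: ((cvg_at_rightP (fun x => ln (sin x / x)) 0 0).1 (cvg_ln_sinc (R := R)) (fun n => c * v n)).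
  split; first by move=> n; rewrite mulr_gt0.
  by rewrite -(mulr0 c); apply: cvgMr.
have h : (1 - a)^-1 * ln (sin (1 * u) / (1 * u)) - ln (sin ((1 - a) * u) / ((1 - a) * u))
    - a / (1 - a) * ln (sin (a * u) / (a * u)) @[u --> (0:R)^'+] --> (0:R).
  rewrite [X in _ --> X](_ : _ = (1 - a)^-1 * 0 - 0 - a / (1 - a) * 0); last by ring.
  by apply: cvgB; [apply: cvgB; [apply: cvgMr|]|apply: cvgMr]; apply: sc; lra.
apply: cvg_trans h; apply: near_eq_cvg; near=> u.
have u0 : 0 < u < pi.
  by apply/andP; split; near: u; [exact: nbhs_right_gt|exact: nbhs_right_lt].
have su : 0 < sin u by exact: sin_gt0_pi.
have sa := sinM_gt0 a01 u0; have sb := sinM_gt0 b01 u0.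
rewrite mul1r !ln_div ?lnM ?posrE ?mulr_gt0//; try lra.
by rewrite /ln_kanter; field; rewrite gt_eqF//; lra.
Unshelve. all: by end_near. Qed.

Lemma ln_kanter_noninc a u v : 0 < a < 1 -> 0 < u -> u <= v -> v < pi ->
  ln_kanter a v <= ln_kanter a u.
Proof.
move=> a01 u0 uv vpi.
have := @ge0_derive_le R (fun x => - ln_kanter a x) (kanter_rate a) `]0, pi[ _ _ u v.
rewrite !in_itv/= lerN2; apply; try lra.
- move=> x; rewrite in_itv/= => x0; rewrite -[kanter_rate a x]opprK.
  by apply: is_derive_fN; exact: is_derive_ln_kanter.
- by move=> x; rewrite in_itv/= => x0; exact: kanter_rate_ge0.
Qed.

Lemma ln_kanter_le0 a u : 0 < a < 1 -> 0 < u < pi -> ln_kanter a u <= 0.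
Proof.
move=> a01 u0; apply: (cvgr_to_ge (cvg_ln_kanter a01)).
near=> v; apply: ln_kanter_noninc => //.
- by apply/ltW; near: v; apply: nbhs_right_lt; lra.
- by lra.
Unshelve. all: by end_near. Qed.

Lemma ln_kanterB_nondec a b u v : 0 < b -> b < a -> a < 1 ->
  0 < u -> u <= v -> v < pi ->
  ln_kanter b u - ln_kanter a u <= ln_kanter b v - ln_kanter a v.
Proof.
move=> b0 ba a1 u0 uv vpi.
have := @ge0_derive_le R (fun x => ln_kanter b x - ln_kanter a x)
  (fun x => - kanter_rate b x - - kanter_rate a x) `]0, pi[ _ _ u v.
rewrite !in_itv/=; apply; try lra.
- move=> x; rewrite in_itv/= => x0; apply: is_derive_fD.
    by apply: is_derive_ln_kanter; lra.
  by apply: is_derive_fN; apply: is_derive_ln_kanter; lra.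
- move=> x; rewrite in_itv/= => x0; have := kanter_rate_le b0 ba a1 x0; lra.
Qed.

(** The difference is nondecreasing in u and starts from the limit 0. *)
Lemma ln_kanter_le a b u : 0 < b -> b < a -> a < 1 -> 0 < u < pi ->
  ln_kanter a u <= ln_kanter b u.
Proof.
move=> b0 ba a1 u0; rewrite -subr_ge0.
have h : ln_kanter b v - ln_kanter a v @[v --> (0:R)^'+] --> (0:R).
  rewrite [X in _ --> X](_ : _ = 0 - 0); last by rewrite subr0.
  by apply: cvgB; apply: cvg_ln_kanter; lra.
apply: (cvgr_to_le h).
near=> v; apply: ln_kanterB_nondec => //.
- by apply/ltW; near: v; apply: nbhs_right_lt; lra.
- by lra.
Unshelve. all: by end_near. Qed.

End kanter.

(** * Moments of Kanter's kernel *)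

Section kanter_integral.
Context {R : realType}.
Implicit Types (b u M k m x : R).
Let mu := @lebesgue_measure R.

(* In the triangle with vertices -1, 0 and z = r e^(i u), where
   r = sin(b u) / sin((1 - b) u), one has 1 + z = rho e^(i b u) with
   rho = sin(u) / sin((1 - b) u).  As u runs through ]0, pi[, the point z runs through
   half of a closed curve around 0, and [binom_kernel M k b u] is the real part of
   (1 + z)^M z^(-k) dz / (i z).  Its integral is thus pi times the binomial coefficient
   of M over k; for M b = k the sine vanishes and the integrand is, up to a constant, the
   k-th power of Kanter's kernel. *)
Definition ln_side1 b u : R := ln (sin u) - ln (sin ((1 - b) * u)).
Definition ln_side b u : R := ln (sin (b * u)) - ln (sin ((1 - b) * u)).
(** The logarithmic derivative r'/r of the radius. Along the curve dz / (i z) = (1 - i r'/r) du,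
    which explains the sine term of [binom_kernel]. *)
Definition side_rate b u : R := b * cot (b * u) - (1 - b) * cot ((1 - b) * u).
Definition binom_mod M k b u : R := expR (M * ln_side1 b u - k * ln_side b u).
Definition binom_kernel M k b u : R := binom_mod M k b u *
  (cos ((M * b - k) * u) + side_rate b u * sin ((M * b - k) * u)).

Lemma sinD_scaled b u : sin u = sin (b * u) * cos ((1 - b) * u) + cos (b * u) * sin ((1 - b) * u).
Proof. by rewrite -sinD; congr sin; ring. Qed.

Lemma cosD_scaled b u : cos u = cos (b * u) * cos ((1 - b) * u) - sin (b * u) * sin ((1 - b) * u).
Proof. by rewrite -cosD; congr cos; ring. Qed.

Lemma is_derive_binom_mod M k b u : 0 < b < 1 -> 0 < u < pi ->
  is_derive u (1:R) (binom_mod M k b)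
    ((M * (cot u - (1 - b) * cot ((1 - b) * u)) - k * side_rate b u) * binom_mod M k b u).
Proof.
move=> b01 u0; have a01 : 0 < 1 - b < 1 by lra.
have su : 0 < sin u by exact: sin_gt0_pi.
have sb := sinM_gt0 b01 u0; have sa := sinM_gt0 a01 u0.
rewrite /binom_mod /ln_side1 /ln_side; derive_to => //.
by rewrite /side_rate /cot; field; rewrite !gt_eqF.
Qed.

(** The primitive is the imaginary part of (1 + z)^M z^(-k), in polar form. *)
Lemma is_derive_binom_primitive M k b u : 0 < b < 1 -> 0 < u < pi ->
  is_derive u (1:R) (fun u => binom_mod M k b u * sin ((M * b - k) * u))
    (M * binom_kernel (M - 1) (k - 1) b u - k * binom_kernel M k b u).
Proof.
move=> b01 u0; have a01 : 0 < 1 - b < 1 by lra.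
have su : 0 < sin u by exact: sin_gt0_pi.
have sb := sinM_gt0 b01 u0; have sa := sinM_gt0 a01 u0.
have dm := is_derive_binom_mod M k b01 u0.
derive_to.
(* Lowering both exponents multiplies by z / (1 + z), of modulus sin(b u) / sin(u) and argument (1 -
   b) u. *)
have -> : binom_kernel (M - 1) (k - 1) b u = binom_mod M k b u * (sin (b * u) / sin u) *
  (cos ((M * b - k) * u + (1 - b) * u) + side_rate b u * sin ((M * b - k) * u + (1 - b) * u)).
  rewrite /binom_kernel; congr (_ * (cos _ + _ * sin _)); [|ring|ring].
  rewrite /binom_mod -[in X in _ = _ * X](lnK (x := sin (b * u) / sin u)) ?posrE ?divr_gt0//.
  rewrite -expRD ln_div ?posrE// /ln_side1 /ln_side; congr expR; ring.
rewrite /binom_kernel sinD cosD /side_rate /cot (cosD_scaled b u).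
set e := binom_mod _ _ _ _; set th := _ * u.
move: su; rewrite (sinD_scaled b u) => su.
by field; rewrite !gt_eqF.
Qed.

Lemma continuous_binom_kernel M k b u : 0 < b < 1 -> 0 < u < pi ->
  {for u, continuous (binom_kernel M k b)}.
Proof.
move=> b01 u0; have a01 : 0 < 1 - b < 1 by lra.
have sb := sinM_gt0 b01 u0; have sa := sinM_gt0 a01 u0.
have dm := is_derive_binom_mod M k b01 u0.
suff [d hd] : exists d, is_derive u (1:R) (binom_kernel M k b) d.
  exact: is_derive_continuous hd.
rewrite /binom_kernel /side_rate /cot; eexists; der.
  by rewrite gt_eqF.
by rewrite gt_eqF.
Qed.

Lemma norm_cot_le x : 0 < x < pi -> `|cot x| <= (sin x)^-1.
Proof.
move=> x0; have s0 : 0 < sin x by exact: sin_gt0_pi.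
by rewrite /cot normrM normfV (gtr0_norm s0) ler_piMl ?invr_ge0 ?cos_max// ltW.
Qed.

Lemma norm_sin_le x : `|sin x| <= `|x|.
Proof.
have [x0|x0] := lerP 0 x.
  have [x1|x1] := lerP x 1; last first.
    by rewrite (le_trans (sin_max x))// ger0_norm// ltW.
  rewrite !ger0_norm ?sin_le_id// sin_ge0_pi// x0 (le_trans x1)//.
  by have := @pi_ge2 R; lra.
rewrite -normrN -sinN -[X in _ <= X]normrN.
have {}x0 : 0 <= - x by lra.
have [x1|x1] := lerP (- x) 1; last first.
  by rewrite (le_trans (sin_max _))// ger0_norm// ltW.
rewrite !ger0_norm ?sin_le_id// sin_ge0_pi// x0 (le_trans x1)//.
by have := @pi_ge2 R; lra.
Qed.

(** The constant [m] is left free so that one value can serve a whole neighbourhood of [b], as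
    differentiation in [b] under the integral requires. *)
Definition side_bound m b u := [/\ 0 < m, 0 < b < 1, 0 < u < pi,
  m * u <= sin (b * u) & m * u <= sin ((1 - b) * u)].

Lemma side_boundP b u : 0 < b < 1 -> 0 < u < pi ->
  side_bound (2 / pi * (b * (1 - b))) b u.
Proof.
move=> b01 u0; have pi0 := pi_gt0 R; split => //.
- by rewrite !mulr_gt0 ?invr_gt0//; lra.
- by have := sinM_lower_bound b01 u0; congr (_ <= _); ring.
- have a01 : 0 < 1 - b < 1 by lra.
  by have := sinM_lower_bound a01 u0; congr (_ <= _); ring.
Qed.

Lemma ln_side1_le m b u : side_bound m b u -> ln_side1 b u <= - ln m.
Proof.
move=> [m0 b01 u0 mb ma]; have a01 : 0 < 1 - b < 1 by lra.
have mu0 : 0 < m * u by rewrite mulr_gt0//; lra.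
have u0' : 0 < u by lra.
have h1 : ln (sin u) <= ln u.
  by rewrite ler_ln ?posrE ?sin_gt0_pi// ?sin_le_id//; lra.
have : ln (m * u) <= ln (sin ((1 - b) * u)).
  by rewrite ler_ln ?posrE ?(lt_le_trans mu0).
by rewrite lnM ?posrE// /ln_side1; lra.
Qed.

Lemma ln_side_ge m b u : side_bound m b u -> ln m <= ln_side b u.
Proof.
move=> [m0 b01 u0 mb ma]; have a01 : 0 < 1 - b < 1 by lra.
have mu0 : 0 < m * u by rewrite mulr_gt0//; lra.
have u0' : 0 < u by lra.
have sa := sinM_gt0 a01 u0.
have h1 : ln (sin ((1 - b) * u)) <= ln u.
  have au := itvM_pi a01 u0.
  rewrite ler_ln ?posrE// (@le_trans _ _ ((1 - b) * u))// ?sin_le_id//; first by lra.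
  by rewrite ler_piMl//; lra.
have : ln (m * u) <= ln (sin (b * u)).
  by rewrite ler_ln ?posrE ?(lt_le_trans mu0).
by rewrite lnM ?posrE// /ln_side; lra.
Qed.

Lemma norm_cot_side_le m c u : 0 < m -> 0 < c < 1 -> 0 < u < pi ->
  m * u <= sin (c * u) -> `|cot (c * u)| <= (m * u)^-1.
Proof.
move=> m0 c01 u0 mc; apply: le_trans (norm_cot_le (itvM_pi c01 u0)) _.
have mu0 : 0 < m * u by rewrite mulr_gt0//; lra.
by rewrite lef_pV2 ?posrE// (lt_le_trans mu0).
Qed.

Lemma norm_side_rate_le m b u : side_bound m b u -> `|side_rate b u| <= 2 / (m * u).
Proof.
move=> [m0 b01 u0 mb ma]; have a01 : 0 < 1 - b < 1 by lra.
apply: le_trans (ler_normB _ _) _; rewrite (normrM b) (normrM (1 - b)).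
have hb := norm_cot_side_le m0 b01 u0 mb; have ha := norm_cot_side_le m0 a01 u0 ma.
have -> : 2 / (m * u) = (m * u)^-1 + (m * u)^-1 by ring.
by apply: lerD; rewrite -[X in _ <= X]mul1r ler_pM// ger0_norm//; lra.
Qed.

(** The pole of [side_rate], of size 2 / (m u), is compensated by the sine, of size |M b - k| u. *)
Lemma norm_binom_kernel_le M k m b u : 0 <= M -> 0 <= k -> side_bound m b u ->
  `|binom_kernel M k b u| <=
    expR (M * - ln m - k * ln m) * (1 + 2 * `|M * b - k| / m).
Proof.
move=> M0 k0 H; have [m0 b01 u0 _ _] := H.
rewrite normrM ger0_norm ?expR_ge0// ler_pM ?expR_ge0//.
  rewrite ler_expR lerB// ler_wpM2l//; [exact: ln_side1_le|exact: ln_side_ge].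
apply: le_trans (ler_normD _ _) _; apply: lerD; first exact: cos_max.
rewrite normrM; apply: (@le_trans _ _ (2 / (m * u) * (`|M * b - k| * u))).
  apply: ler_pM => //; first exact: norm_side_rate_le.
  by rewrite (le_trans (norm_sin_le _))// normrM (ger0_norm (x := u))//; lra.
rewrite le_eqVlt; apply/orP; left; apply/eqP; field.
by rewrite !gt_eqF//; lra.
Qed.

Lemma integrable_oo_bounded (c d C : R) (f : R -> R) :
  {in `]c, d[, forall x, {for x, continuous f}} ->
  {in `]c, d[, forall x, `|f x| <= C} ->
  mu.-integrable `]c, d[ (EFin \o f).
Proof.
move=> cf fC; apply: measurable_bounded_integrable => //.
- have : (@lebesgue_measure R `]c, d[%classic < +oo)%E; last by [].
  by rewrite lebesgue_measure_itv/=; case: ifPn => // _; rewrite -EFinB ltry.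
- apply: open_continuous_measurable_fun => //.
  by move=> x; rewrite inE => /cf.
- exists C; split; first exact: num_real.
  by move=> y Cy x /= /fC/le_trans; apply; exact: ltW.
Qed.

Lemma integrable_binom_kernel M k b : 0 <= M -> 0 <= k -> 0 < b < 1 ->
  mu.-integrable `]0, pi[ (EFin \o binom_kernel M k b).
Proof.
move=> M0 k0 b01; apply: integrable_oo_bounded.
  by move=> x; rewrite in_itv/= => x0; exact: continuous_binom_kernel.
move=> x; rewrite in_itv/= => x0.
exact: norm_binom_kernel_le M0 k0 (side_boundP b01 x0).
Qed.

Lemma cvg0_of_norm_le (T : Type) (F : set_system T) {FF : Filter F} (f g : T -> R) :
  (\forall x \near F, `|f x| <= g x) -> g @ F --> (0:R) -> f @ F --> (0:R).
Proof.
move=> fg g0; apply: norm_cvg0; apply: (squeeze_cvgr _ (cvg_cst 0) g0).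
by near do rewrite normr_ge0/=.
Unshelve. all: by end_near. Qed.

Lemma cvg_mul_sin_right (C c : R) : C * `|sin (c * u)| @[u --> (0:R)^'+] --> (0:R).
Proof.
suff : C * `|sin (c * u)| @[u --> (0:R)^'+] --> C * `|sin (c * 0)|.
  by rewrite mulr0 sin0 normr0 mulr0.
apply: cvgMr; apply: cvg_norm; apply: cvg_at_right_filter.
by apply: continuous_cvg; [exact: continuous_sin|apply: cvgMr; exact: cvg_id].
Qed.

Lemma cvg_power_sin_pi (C M : R) : 0 < M -> C * (sin u) `^ M @[u --> (pi:R)^'-] --> (0:R).
Proof.
move=> M0; rewrite -(mulr0 C); apply: cvgMr.
apply/cvg_at_leftP => v [v1 cv].
(* From rank N on the sequence lies in ]0, pi[, so its sines tend to 0 through positive values. *)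
have [N _ vN] : \forall n \near \oo, 0 < v n by move/cvgr_gt : cv; apply; exact: pi_gt0.
rewrite -(cvg_shiftn N).
apply: ((cvg_at_rightP (fun a => a `^ M) 0 0).1 (powR_cvg0 M0) (fun n => sin (v (n + N)%N))).
split; first by move=> n; rewrite sin_gt0_pi// v1 vN//= leq_addl.
suff : sin (v (n + N)%N) @[n --> \oo] --> sin (pi : R) by rewrite sinpi.
apply: continuous_cvg; first exact: continuous_sin.
by rewrite (cvg_shiftn N v).
Qed.

End kanter_integral.

(** * Recursion and homotopy invariance for the integrals of [binom_kernel] *)

Section kanter_moments.
Context {R : realType}.
Implicit Types (b u M k m x : R).
Let mu := @lebesgue_measure R.

Lemma binom_mod_le M k m b u : 0 <= M -> 0 <= k -> side_bound m b u ->
  binom_mod M k b u <= expR (M * - ln m - k * ln m).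
Proof.
move=> M0 k0 H; rewrite ler_expR lerB// ler_wpM2l//.
  exact: ln_side1_le.
exact: ln_side_ge.
Qed.

(** For u >= 1 the denominator sin((1 - b) u) stays above m, so the factor sin(u)^M survives in the
    bound. It makes the boundary terms at pi vanish. *)
Lemma binom_mod_le_power M k m b u : 0 <= M -> 0 <= k -> side_bound m b u -> 1 <= u ->
  binom_mod M k b u <= expR (M * - ln m - k * ln m) * sin u `^ M.
Proof.
move=> M0 k0 H u1; have [m0 b01 u0 mb ma] := H.
have su : 0 < sin u by exact: sin_gt0_pi.
rewrite /powR gt_eqF// -expRD ler_expR.
have h1 := ler_wpM2l k0 (ln_side_ge H).
have h2 : ln m <= ln (sin ((1 - b) * u)).
  have mmu : m <= m * u by rewrite ler_peMr// ltW.
  by rewrite ler_ln ?posrE// ?(le_trans mmu)// (lt_le_trans m0)// (le_trans mmu).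
have := ler_wpM2l M0 h2; rewrite /ln_side1; lra.
Qed.

Let near0_itv : \forall u \near (0:R)^'+, 0 < u < pi.
Proof.
near=> u; apply/andP; split; near: u; [exact: nbhs_right_gt|].
by apply: nbhs_right_lt; exact: pi_gt0.
Unshelve. all: by end_near. Qed.

Let nearpi_itv : \forall u \near (pi:R)^'-, 1 <= u /\ 0 < u < pi.
Proof.
near=> u; have u1 : 1 < u.
  by near: u; apply: nbhs_left_gt; have := @pi_ge2 R; lra.
split; first exact: ltW.
by apply/andP; split; [lra|near: u; exact: nbhs_left_lt].
Unshelve. all: by end_near. Qed.

(* M (1 + z)^(M - 1) z^(1 - k) dz / z - k (1 + z)^M z^(-k) dz / z is the differential
   of (1 + z)^M z^(-k). *)
Lemma binom_kernel_rec M k b : 1 <= M -> 1 <= k -> 0 < b < 1 ->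
  M * \int[mu]_(u in `]0, pi[) binom_kernel (M - 1) (k - 1) b u =
  k * \int[mu]_(u in `]0, pi[) binom_kernel M k b u.
Proof.
move=> M1 k1 b01.
have i1 : mu.-integrable `]0, pi[ (EFin \o binom_kernel (M - 1) (k - 1) b).
  by apply: integrable_binom_kernel => //; lra.
have i2 : mu.-integrable `]0, pi[ (EFin \o binom_kernel M k b).
  by apply: integrable_binom_kernel => //; lra.
have M0 : 0 <= M by lra. have k0 : 0 <= k by lra.
apply/eqP; rewrite -subr_eq0 -!RintegralZl// -RintegralB//; last 2 first.
- exact: integrable_fZl.
- exact: integrable_fZl.
apply/eqP; rewrite [RHS](_ : _ = 0 - 0); last by rewrite subr0.
apply: (@FTC_oo R 0 pi _ (fun u => binom_mod M k b u * sin ((M * b - k) * u))).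
- exact: pi_gt0.
- by apply: integrable_fB => //; exact: integrable_fZl.
- move=> u; rewrite in_itv/= => u0.
  by apply: cvgB; apply: cvgMr; exact: continuous_binom_kernel.
- by move=> u; rewrite in_itv/= => u0; exact: is_derive_binom_primitive.
- apply: (cvg0_of_norm_le _ (cvg_mul_sin_right (expR (M * - ln (2 / pi * (b * (1 - b))) - k * ln (2 / pi * (b * (1 - b))))) (M * b - k))).
  near=> u; have u0 : 0 < u < pi by near: u.
  rewrite normrM ger0_norm ?expR_ge0// ler_wpM2r//.
  exact: binom_mod_le M0 k0 (side_boundP b01 u0).
- apply: (cvg0_of_norm_le _ (cvg_power_sin_pi (expR (M * - ln (2 / pi * (b * (1 - b))) - k * ln (2 / pi * (b * (1 - b))))) (M := M) _)); last by lra.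
  near=> u; have [u1 u0] : 1 <= u /\ 0 < u < pi by near: u.
  rewrite normrM ger0_norm ?expR_ge0//.
  apply: (@le_trans _ _ (binom_mod M k b u * 1)); first by rewrite ler_wpM2l ?expR_ge0// sin_max.
  rewrite mulr1; exact: binom_mod_le_power M0 k0 (side_boundP b01 u0) u1.
Unshelve. all: by end_near. Qed.

(** The derivative in [b] at k = 0; larger integers k are reached from k = 0 through
    [binom_kernel_rec]. *)
Definition binom_kernel_dside M b u : R := binom_mod M 0 b u *
  (M * u * cot ((1 - b) * u) * (cos ((M * b - 0) * u) + side_rate b u * sin ((M * b - 0) * u))
   + ((cot (b * u) - b * u / sin (b * u) ^+ 2 + cot ((1 - b) * u)
       - (1 - b) * u / sin ((1 - b) * u) ^+ 2) * sin ((M * b - 0) * u)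
      - M * u * sin ((M * b - 0) * u) + side_rate b u * (M * u) * cos ((M * b - 0) * u))).

Lemma is_derive_binom_kernel_side M b u : 0 < b < 1 -> 0 < u < pi ->
  is_derive b (1:R) (fun b => binom_kernel M 0 b u) (binom_kernel_dside M b u).
Proof.
move=> b01 u0; have a01 : 0 < 1 - b < 1 by lra.
have sb := sinM_gt0 b01 u0; have sa := sinM_gt0 a01 u0.
have de : is_derive b (1:R) (fun b => binom_mod M 0 b u)
    (M * u * cot ((1 - b) * u) * binom_mod M 0 b u).
  rewrite /binom_mod /ln_side1 /ln_side; derive_to => //.
  by rewrite /cot; field; rewrite !gt_eqF.
rewrite /binom_kernel /side_rate /cot; derive_to; rewrite ?gt_eqF//.
rewrite /binom_kernel_dside /side_rate /cot.
set e := binom_mod _ _ _ _.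
by field: (cos2sin2 (b * u)) (cos2sin2 ((1 - b) * u)); rewrite !gt_eqF.
Qed.

(** For a holomorphic form F dz, the b-derivative of F z_u is the u-derivative of F z_b. Here z_b /
    z = u (cot(b u) + cot((1 - b) u)) is real, since the argument u of z does not depend on b; hence
    the real part of (1 + z)^M z_b / (i z) carries the sine. *)
Lemma is_derive_binom_kernel_dside M b u : 0 < b < 1 -> 0 < u < pi ->
  is_derive u (1:R) (fun u => binom_mod M 0 b u *
     (sin ((M * b - 0) * u) * (u * (cot (b * u) + cot ((1 - b) * u)))))
    (binom_kernel_dside M b u).
Proof.
move=> b01 u0; have a01 : 0 < 1 - b < 1 by lra.
have sb := sinM_gt0 b01 u0; have sa := sinM_gt0 a01 u0.
have su : 0 < sin u by exact: sin_gt0_pi.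
have de := is_derive_binom_mod M 0 b01 u0.
rewrite [in X in is_derive _ _ X]/cot; derive_to; rewrite ?gt_eqF//.
rewrite /binom_kernel_dside /side_rate /cot (cosD_scaled b u).
set e := binom_mod _ _ _ _.
move: su; rewrite (sinD_scaled b u) => su.
by field: (cos2sin2 (b * u)) (cos2sin2 ((1 - b) * u)); rewrite !gt_eqF.
Qed.

(** Poles in u are balanced by a factor u or by the sine, which is at most M u. The bound depends on
    [b] only through [m], hence it dominates uniformly near a given [b]. *)
Lemma norm_binom_kernel_dside_le M m b u : 0 <= M -> side_bound m b u ->
  `|binom_kernel_dside M b u| <= expR (M * - ln m - 0 * ln m) *
     (M / m * (1 + 2 * M / m) + ((2 / m + 2 / m ^+ 2) * M + M * pi + 2 * M / m)).
Proof.
move=> M0 H; have [m0 b01 u0 mb ma] := H; have a01 : 0 < 1 - b < 1 by lra.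
have sb := sinM_gt0 b01 u0; have sa := sinM_gt0 a01 u0.
have u0' : 0 < u by lra.
have mu0 : 0 < m * u by rewrite mulr_gt0.
have hb := norm_cot_side_le m0 b01 u0 mb; have ha := norm_cot_side_le m0 a01 u0 ma.
have hq := norm_side_rate_le H.
have hs : `|sin ((M * b - 0) * u)| <= M * u.
  rewrite (le_trans (norm_sin_le _))// ger0_norm ?subr0 ?mulr_ge0//; try lra.
  by rewrite ler_wpM2r ?(ltW u0')// ler_piMr//; lra.
have hsq c : 0 < c < 1 -> m * u <= sin (c * u) ->
    `|c * u / sin (c * u) ^+ 2| <= (m ^+ 2 * u)^-1.
  move=> c01 mc; have sc := sinM_gt0 c01 u0.
  rewrite ger0_norm; last by rewrite divr_ge0 ?sqr_ge0// mulr_ge0//; lra.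
  apply: (@le_trans _ _ (u / (m * u) ^+ 2)).
    rewrite ler_pM ?mulr_ge0 ?invr_ge0 ?sqr_ge0//; try lra.
      by rewrite ler_piMl//; lra.
    by rewrite lef_pV2 ?posrE ?exprn_gt0// lerXn2r ?nnegrE// ltW.
  by rewrite le_eqVlt; apply/orP; left; apply/eqP; field; rewrite !gt_eqF.
have hsb := hsq _ b01 mb; have hsa := hsq _ a01 ma.
rewrite normrM ger0_norm ?expR_ge0// ler_pM ?expR_ge0//.
  by apply: binom_mod_le.
set q := side_rate b u in hq *; set S := sin _ in hs *; set C := cos _.
set x := cot _ in hb *; set y := cot _ in ha *.
have hqS : `|q * S| <= 2 * M / m.
  rewrite normrM (le_trans (ler_pM _ _ hq hs))//.
  by rewrite le_eqVlt; apply/orP; left; apply/eqP; field; rewrite !gt_eqF.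
have C1 : `|C| <= 1 by exact: cos_max.
apply: le_trans (ler_normD _ _) _; apply: lerD.
  rewrite normrM; apply: ler_pM => //.
    rewrite normrM ger0_norm ?mulr_ge0//; last lra.
    rewrite (le_trans (ler_wpM2l _ ha)) ?mulr_ge0//; first by lra.
    by rewrite le_eqVlt; apply/orP; left; apply/eqP; field; rewrite !gt_eqF.
  by rewrite (le_trans (ler_normD _ _))// lerD.
apply: le_trans (ler_normD _ _) _; apply: lerD.
  apply: le_trans (ler_normB _ _) _; apply: lerD.
    rewrite normrM; apply: (@le_trans _ _ ((2 / (m * u) + 2 / (m ^+ 2 * u)) * (M * u))).
      apply: ler_pM => //.
      by move: hb ha hsb hsa; rewrite !ler_norml; lra.
    by rewrite le_eqVlt; apply/orP; left; apply/eqP; field; rewrite !gt_eqF.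
  rewrite normrM ger0_norm ?mulr_ge0//; last lra.
  rewrite -[X in _ <= X]mulr1 ler_pM ?mulr_ge0//; try lra.
    by rewrite ler_wpM2l//; lra.
  by exact: sin_max.
rewrite normrM normrM -[X in _ <= X]mulr1 ler_pM// ?mulr_ge0//.
rewrite (ger0_norm (x := M * u)) ?mulr_ge0//; last lra.
rewrite (le_trans (ler_wpM2r _ hq)) ?mulr_ge0//; first by lra.
by rewrite le_eqVlt; apply/orP; left; apply/eqP; field; rewrite !gt_eqF.
Qed.

Lemma continuous_binom_kernel_dside M b u : 0 < b < 1 -> 0 < u < pi ->
  {for u, continuous (binom_kernel_dside M b)}.
Proof.
move=> b01 u0; have a01 : 0 < 1 - b < 1 by lra.
have sb := sinM_gt0 b01 u0; have sa := sinM_gt0 a01 u0.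
have dm := is_derive_binom_mod M 0 b01 u0.
suff [d hd] : exists d, is_derive u (1:R) (binom_kernel_dside M b) d.
  exact: is_derive_continuous hd.
rewrite /binom_kernel_dside /side_rate /cot; eexists; der;
  by rewrite ?expf_neq0// gt_eqF.
Qed.

Lemma Rintegral_binom_kernel_dside M b : 0 < M -> 0 < b < 1 ->
  \int[mu]_(u in `]0, pi[) binom_kernel_dside M b u = 0.
Proof.
move=> M0 b01; have M0' := ltW M0; have pi0 := pi_gt0 R.
pose m : R := 2 / pi * (b * (1 - b)).
have m0 : 0 < m by rewrite !mulr_gt0 ?invr_gt0//; lra.
pose K := expR (M * - ln m - 0 * ln m).
have pibound u : 0 < u < pi -> `|u * (cot (b * u) + cot ((1 - b) * u))| <= 2 / m.
  move=> u0; have [_ _ _ mb ma] := side_boundP b01 u0; have a01 : 0 < 1 - b < 1 by lra.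
  have hb := norm_cot_side_le m0 b01 u0 mb; have ha := norm_cot_side_le m0 a01 u0 ma.
  have u0' : 0 < u by lra.
  rewrite normrM ger0_norm ?(ltW u0')//.
  apply: (@le_trans _ _ (u * (2 / (m * u)))).
    rewrite ler_pM2l//; move: hb ha; rewrite !ler_norml; lra.
  by rewrite le_eqVlt; apply/orP; left; apply/eqP; field; rewrite !gt_eqF.
rewrite [RHS](_ : _ = 0 - 0); last by rewrite subr0.
apply: (@FTC_oo R 0 pi _ (fun u => binom_mod M 0 b u *
     (sin ((M * b - 0) * u) * (u * (cot (b * u) + cot ((1 - b) * u)))))) => //.
- apply: integrable_oo_bounded.
    by move=> u; rewrite in_itv/= => u0; exact: continuous_binom_kernel_dside.
  move=> u; rewrite in_itv/= => u0.
  exact: norm_binom_kernel_dside_le M0' (side_boundP b01 u0).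
- by move=> u; rewrite in_itv/= => u0; exact: continuous_binom_kernel_dside.
- by move=> u; rewrite in_itv/= => u0; exact: is_derive_binom_kernel_dside.
- apply: (cvg0_of_norm_le _ (cvg_mul_sin_right (K * (2 / m)) (M * b - 0))).
  near=> u; have u0 : 0 < u < pi by near: u.
  rewrite !normrM ger0_norm ?expR_ge0// -mulrA ler_pM ?expR_ge0 ?mulr_ge0//.
    by apply: binom_mod_le => //; exact: side_boundP.
  by rewrite mulrC -normrM ler_wpM2r//; exact: pibound.
- apply: (cvg0_of_norm_le _ (cvg_power_sin_pi (K * (2 / m)) (M := M) M0)).
  near=> u; have [u1 u0] : 1 <= u /\ 0 < u < pi by near: u.
  rewrite normrM ger0_norm ?expR_ge0//.
  rewrite [X in _ <= X](_ : _ = K * sin u `^ M * (1 * (2 / m))); last by ring.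
  rewrite ler_pM ?expR_ge0//.
    exact: (binom_mod_le_power M0' (lexx 0) (side_boundP b01 u0)).
  by rewrite normrM ler_pM// ?sin_max// pibound.
Unshelve. all: by end_near. Qed.

(* Homotopy invariance of the contour integral of (1 + z)^M dz / z: the derivative of
   the integrand in the parameter b of the contour is a total derivative in u. *)
Lemma Rintegral_binom_kernel_cst M b b' : 0 < M -> 0 < b < 1 -> 0 < b' < 1 ->
  \int[mu]_(u in `]0, pi[) binom_kernel M 0 b u =
  \int[mu]_(u in `]0, pi[) binom_kernel M 0 b' u.
Proof.
move=> M0 b01 b'01; have pi0 := pi_gt0 R.
apply: (@eq_of_derive0 R 0 1
  (fun b => \int[mu]_(u in `]0, pi[) binom_kernel M 0 b u)) => // a a01.
(* For x between a / 2 and (1 + a) / 2 one has x > a / 2 and 1 - x > (1 - a) / 2, so this constant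
   is below that of [side_boundP] at x. *)
pose m : R := 2 / pi * (a / 2 * ((1 - a) / 2)).
have m0 : 0 < m by rewrite !mulr_gt0 ?invr_gt0//; lra.
pose C := expR (M * - ln m - 0 * ln m) *
     (M / m * (1 + 2 * M / m) + ((2 / m + 2 / m ^+ 2) * M + M * pi + 2 * M / m)).
apply: (is_derive_eq _ (Rintegral_binom_kernel_dside M0 a01)).
have mI : measurable (`]0, pi[%classic : set (measurableTypeR R)) by [].
have a12 : a / 2 < a < (1 + a) / 2 by lra.
have x01 x : a / 2 < x < (1 + a) / 2 -> 0 < x < 1 by lra.
have u0pi u : (`]0, pi[%classic : set R) u -> 0 < u < pi by rewrite /= in_itv.
have intk x (xa : a / 2 < x < (1 + a) / 2) := integrable_binom_kernel (ltW M0) (lexx 0) (x01 x xa).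
have derk x u (xa : a / 2 < x < (1 + a) / 2) (u0 : (`]0, pi[%classic : set R) u) :=
  is_derive_binom_kernel_side M (x01 x xa) (u0pi u u0).
apply: (@is_derive_under_Rintegral _ _ _ mu _ a _ _ (binom_kernel M 0)
  (binom_kernel_dside M) (fun=> C) mI a12 intk derk).
- apply: integrable_oo_bounded; first by move=> x _; exact: cvg_cst.
  by move=> x _; exact: lexx.
- move=> x u xa /=; rewrite in_itv/= => u0.
  have {}x01 := x01 x xa.
  apply: norm_binom_kernel_dside_le; first exact: ltW.
  have [_ _ _ h1 h2] := side_boundP x01 u0.
  have mx : m * u <= 2 / pi * (x * (1 - x)) * u.
    rewrite ler_pM2r; last by lra.
    rewrite ler_pM2l ?divr_gt0//; apply: ler_pM; lra.
  by split => //; exact: le_trans mx _.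
Qed.

End kanter_moments.

(** * Shrinking the contour, and the values of the integrals *)

Section kanter_moments_value.
Context {R : realType}.
Implicit Types (a b u M k m x : R).
Let mu := @lebesgue_measure R.

(** These bounds persist as b tends to 0, where the constant of [side_boundP] degenerates. The first
    holds since the difference of the sines is 2 cos(u/2) sin((1 - 2 b) u/2). *)
Lemma sin_side_le b u : 0 < b <= 1 / 2 -> 0 < u < pi ->
  sin (b * u) <= sin ((1 - b) * u) /\ sin u <= 2 * sin ((1 - b) * u).
Proof.
move=> b01 u0; have b01' : 0 < b < 1 by lra.
have a01 : 0 < 1 - b < 1 by lra.
have sb := sinM_gt0 b01' u0; have sa := sinM_gt0 a01 u0.
have h : sin (b * u) <= sin ((1 - b) * u).
  have -> : b * u = u / 2 - (1 - 2 * b) * u / 2 by field.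
  have -> : (1 - b) * u = u / 2 + (1 - 2 * b) * u / 2 by field.
  rewrite sinB sinD -subr_ge0.
  set X := (X in 0 <= X); have -> : X = 2 * (cos (u / 2) * sin ((1 - 2 * b) * u / 2)).
    by rewrite /X; ring.
  rewrite !mulr_ge0//; first by rewrite cos_ge0_pihalf//; lra.
  rewrite sin_ge0_pi//; apply/andP; split; first by rewrite divr_ge0// mulr_ge0//; lra.
  rewrite ler_pdivrMr//; apply: (@le_trans _ _ u); first by rewrite ler_piMl//; lra.
  by lra.
split => //; rewrite (sinD_scaled b u).
have : sin (b * u) * cos ((1 - b) * u) <= sin (b * u) by rewrite ler_piMr ?cos_le1// ltW.
have : cos (b * u) * sin ((1 - b) * u) <= sin ((1 - b) * u) by rewrite ler_piMl ?cos_le1// ltW.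
by lra.
Qed.

(** The first bound is uniform in b and u and dominates the integrand; the second is O(b) for fixed
    u and gives the pointwise limit. *)
Lemma norm_side_term_le M b u : 0 < M -> 0 < b <= 1 / 2 -> 0 < u < pi ->
  `|side_rate b u * sin ((M * b - 0) * u)| <= M * pi / 2 /\
  `|side_rate b u * sin ((M * b - 0) * u)| <= b * (M * pi / 2 + 2 * M * u / sin u).
Proof.
move=> M0 b01 u0; have b01' : 0 < b < 1 by lra.
have a01 : 0 < 1 - b < 1 by lra.
have sb := sinM_gt0 b01' u0; have sa := sinM_gt0 a01 u0.
have su : 0 < sin u by exact: sin_gt0_pi.
have [h1 h2] := sin_side_le b01 u0.
have u0' : 0 < u by lra.
have hs : `|sin ((M * b - 0) * u)| <= M * b * u.
  by rewrite (le_trans (norm_sin_le _))// subr0 ger0_norm// !mulr_ge0//; lra.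
have jb : 2 / pi * (b * u) <= sin (b * u).
  apply: jordan_ineq; rewrite mulr_ge0 ?(ltW u0')//; last lra.
  rewrite /= (@le_trans _ _ (1 / 2 * u))//; first by rewrite ler_wpM2r ?(ltW u0')//; lra.
  by lra.
have pi0 := pi_gt0 R.
have jb' : b * u / sin (b * u) <= pi / 2.
  have e : pi / 2 * (2 / pi * (b * u)) = b * u.
    by move: (pi : R) pi0 => p p0; field; rewrite gt_eqF.
  by rewrite ler_pdivrMr// -[X in X <= _]e ler_pM2l// divr_gt0.
have cb := norm_cot_le (itvM_pi b01' u0); have ca := norm_cot_le (itvM_pi a01 u0).
have e1 : `|side_rate b u * sin ((M * b - 0) * u)| <=
    b / sin (b * u) * (M * b * u) + (1 - b) / sin ((1 - b) * u) * (M * b * u).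
  rewrite -mulrDl normrM ler_pM// (le_trans (ler_normB _ _))//.
  rewrite (normrM b) (normrM (1 - b)).
  by apply: lerD; apply: ler_pM => //; rewrite ger0_norm//; lra.
have m1 : b / sin (b * u) * (M * b * u) = b * (M * (b * u / sin (b * u))) by ring.
have m2 : b * (M * (b * u / sin (b * u))) <= b * (M * (pi / 2)).
  by rewrite ler_wpM2l ?ler_wpM2l//; lra.
split.
  apply: le_trans e1 _.
  apply: (@le_trans _ _ (b * (M * (pi / 2)) + (1 - b) * (M * (pi / 2)))); last by lra.
  apply: lerD; first by rewrite m1.
  have -> : (1 - b) / sin ((1 - b) * u) * (M * b * u) = (1 - b) * (M * (b * u / sin ((1 - b) * u))) by ring.
  rewrite !ler_wpM2l//; try lra.
  apply: le_trans jb'; rewrite ler_wpM2l// ?lef_pV2//.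
  by rewrite mulr_ge0//; lra.
apply: le_trans e1 _; rewrite mulrDr; apply: lerD.
  by rewrite m1 (le_trans m2)//; lra.
have -> : (1 - b) / sin ((1 - b) * u) * (M * b * u) = b * (M * u * ((1 - b) / sin ((1 - b) * u))) by ring.
have -> : 2 * M * u / sin u = M * u * (2 / sin u) by ring.
have Mu0 : 0 <= M * u by rewrite mulr_ge0//; lra.
rewrite ler_wpM2l//; first by lra.
rewrite ler_wpM2l// ler_pdivrMr// mulrAC ler_pdivlMr//.
apply: le_trans h2; rewrite ler_piMl//; lra.
Qed.

Lemma norm_binom_kernel_side_le M b u : 0 < M -> 0 < b <= 1 / 2 -> 0 < u < pi ->
  `|binom_kernel M 0 b u| <= expR (M * ln 2) * (1 + M * pi / 2).
Proof.
move=> M0 b01 u0; have b01' : 0 < b < 1 by lra.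
have a01 : 0 < 1 - b < 1 by lra.
have sb := sinM_gt0 b01' u0; have sa := sinM_gt0 a01 u0.
have su : 0 < sin u by exact: sin_gt0_pi.
have [h1 h2] := sin_side_le b01 u0.
rewrite normrM ger0_norm ?expR_ge0// ler_pM ?expR_ge0//.
  rewrite ler_expR mul0r subr0 ler_wpM2l ?(ltW M0)// /ln_side1 lerBlDr -lnM ?posrE//.
  by rewrite ler_ln// posrE// mulr_gt0.
rewrite (le_trans (ler_normD _ _))// lerD ?cos_max//.
by have [] := norm_side_term_le M0 b01 u0.
Qed.

Lemma cvg_binom_kernel_side M u (b_ : nat -> R) : 0 < M -> 0 < u < pi ->
  (forall n, 0 < b_ n <= 1 / 2) -> b_ n @[n --> \oo] --> (0:R) ->
  binom_kernel M 0 (b_ n) u @[n --> \oo] --> (1:R).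
Proof.
move=> M0 u0 b01 cb.
have su : 0 < sin u by exact: sin_gt0_pi.
have c1 : (1 - b_ n) * u @[n --> \oo] --> u.
  rewrite -[X in _ --> X]mul1r; apply: cvgMl.
  by rewrite -[X in _ --> X]subr0; apply: cvgB => //; exact: cvg_cst.
have c2 : ln_side1 (b_ n) u @[n --> \oo] --> (0:R).
  rewrite -(subrr (ln (sin u))); apply: cvgB; first exact: cvg_cst.
  apply: continuous_cvg; first exact: continuous_ln.
  by apply: continuous_cvg => //; exact: continuous_sin.
have c3 : binom_mod M 0 (b_ n) u @[n --> \oo] --> (1:R).
  rewrite /binom_mod -[X in _ --> X]expR0; apply: continuous_cvg; first exact: continuous_expR.
  under eq_fun do rewrite mul0r subr0.
  by rewrite -(mulr0 M); apply: cvgMr.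
rewrite -[X in _ --> X](mulr1 1); apply: cvgM => //.
rewrite -[X in _ --> X](addr0 1); apply: cvgD.
  rewrite -[X in _ --> X]cos0; apply: continuous_cvg; first exact: continuous_cos.
  under eq_fun do rewrite subr0.
  rewrite -(mul0r u); apply: cvgMl.
  by rewrite -(mulr0 M); apply: cvgMr.
apply: (cvg0_of_norm_le (g := fun n => b_ n * (M * pi / 2 + 2 * M * u / sin u))).
  by apply: nearW => n; have [] := norm_side_term_le M0 (b01 n) u0.
by rewrite -[X in _ --> X](mul0r (M * pi / 2 + 2 * M * u / sin u)); apply: cvgMl.
Qed.

Lemma cvg_invS : (n.+2%:R^-1 : R) @[n --> \oo] --> (0:R).
Proof.
have -> := @cvg_shiftS _ (fun n => n.+1%:R^-1 : R^o) (nbhs (0:R)).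
exact: cvg_harmonic.
Qed.

Lemma Rintegral_cst_0pi (c : R) : \int[mu]_(x in `]0, pi[) c = c * pi.
Proof.
have e : @lebesgue_measure R `]0%R, (pi:R)[%classic = (pi:R)%:E.
  by rewrite lebesgue_measure_itv/= lte_fin pi_gt0 -EFinB subr0.
by rewrite Rintegral_cst//; congr (_ * _); exact: (congr1 fine e).
Qed.

(** By homotopy the value does not depend on [b]. Along b = 1 / (n + 2) each point z tends to the
    origin, where (1 + z)^M is 1, and the integrand tends to 1. *)
Lemma Rintegral_binom_kernel0 M b : 0 < M -> 0 < b < 1 ->
  \int[mu]_(u in `]0, pi[) binom_kernel M 0 b u = pi.
Proof.
move=> M0 b01.
pose b_ n : R := n.+2%:R^-1.
have hb n : 0 < b_ n <= 1 / 2.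
  by rewrite invr_gt0 ltr0n/= div1r lef_pV2 ?posrE// ler_nat.
have mD : measurable `]0, (pi:R)[%classic by exact: measurable_itv.
have i1 n : mu.-integrable `]0, pi[ (EFin \o binom_kernel M 0 (b_ n)).
  by apply: integrable_binom_kernel => //; have := hb n; lra.
have [||||_] := @cvg_dominated_Rintegral R _ _ mu `]0, pi[%classic (fun n => binom_kernel M 0 (b_ n))
  (fun=> 1) (fun=> expR (M * ln 2) * (1 + M * pi / 2)) mD.
- by move=> n; case/integrableP: (i1 n) => /measurable_EFinP.
- move=> u /=; rewrite in_itv/= => u0; apply: cvg_binom_kernel_side => //.
  exact: cvg_invS.
- by apply: integrable_oo_bounded; [move=> x _; exact: cvg_cst|move=> x _; exact: lexx].
- by move=> n u /=; rewrite in_itv/= => u0; exact: norm_binom_kernel_side_le.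
rewrite Rintegral_cst_0pi mul1r => h.
apply: (cvg_unique _ _ h) => //.
apply: cvg_near_cst; apply: nearW => n.
by apply: Rintegral_binom_kernel_cst => //; have := hb n; lra.
Qed.

Lemma Rintegral_binom_kernel_nat M b n : 0 < M -> 0 < b < 1 ->
  n`!%:R * \int[mu]_(u in `]0, pi[) binom_kernel (M + n%:R) n%:R b u =
  pi * \prod_(i < n) (M + i.+1%:R).
Proof.
move=> M0 b01; elim: n => [|n IHn].
  by rewrite big_ord0 mulr1 fact0 mul1r addr0 Rintegral_binom_kernel0.
have n0 : 0 <= n%:R :> R by [].
have := @binom_kernel_rec R (M + n.+1%:R) n.+1%:R b _ _ b01.
rewrite -natr1 => /(_ _ _)/wrap[|| h]; [lra|lra|].
move: h; rewrite addrA !addrK natr1 => h.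
rewrite factS natrM [n.+1%:R * _]mulrC -mulrA -h mulrCA IHn big_ord_recr/= -natr1.
ring.
Qed.

(** The exponent is M = n / (1 - a), written n a / (1 - a) + n to fit the recursion. With b = 1 - a
    this gives M b = n. *)
Lemma expR_ln_kanter a u n : 0 < a < 1 -> 0 < u < pi ->
  expR (ln_kanter a u) ^+ n = ((1 - a) * a `^ (a / (1 - a))) ^+ n *
    binom_kernel (n%:R * (a / (1 - a)) + n%:R) n%:R (1 - a) u.
Proof.
move=> a01 u0.
have th : (n%:R * (a / (1 - a)) + n%:R) * (1 - a) - n%:R = 0.
  by field; rewrite gt_eqF//; lra.
rewrite /binom_kernel th mul0r cos0 sin0 mulr0 addr0 mulr1 /binom_mod.
have a0 : a != 0 by rewrite gt_eqF//; lra.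
have b0 : 0 < 1 - a by lra.
rewrite /powR (negbTE a0) -[in RHS](lnK (x := 1 - a)) ?posrE// -expRD.
rewrite -!expRM_natl -expRD; congr expR.
rewrite /ln_kanter /ln_side1 /ln_side lnK ?posrE//.
rewrite subKr.
by field; rewrite gt_eqF.
Qed.

Lemma kanter_moment a n : 0 < a < 1 ->
  n`!%:R * \int[mu]_(u in `]0, pi[) expR (ln_kanter a u) ^+ n =
  pi * (((1 - a) * a `^ (a / (1 - a))) ^+ n *
        \prod_(i < n) (n%:R * (a / (1 - a)) + i.+1%:R)).
Proof.
move=> a01; have mD : measurable `]0, (pi:R)[%classic by exact: measurable_itv.
(* The value at n = 0 is separate because the starting exponent n a / (1 - a) must be positive. *)
case: n => [|n].
  rewrite big_ord0 !expr0 mulr1 fact0 mul1r mulr1.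
  under eq_Rintegral do rewrite expr0.
  by rewrite Rintegral_cst_0pi mul1r.
have M0 : 0 < n.+1%:R * (a / (1 - a)) by rewrite mulr_gt0// divr_gt0//; lra.
have b01 : 0 < 1 - a < 1 by lra.
under eq_Rintegral.
  move=> u; rewrite inE/= in_itv/= => u0; rewrite expR_ln_kanter//; over.
rewrite RintegralZl//; last first.
  by apply: integrable_binom_kernel => //; rewrite ltW// addr_gt0.
by rewrite mulrCA Rintegral_binom_kernel_nat// mulrCA.
Qed.

End kanter_moments_value.

(** * Laws with small moments *)

Section exp_taylor.
Context {R : realType}.
Implicit Types x : R.

Definition exp_poly m x : R := \sum_(i < m) x ^+ i / i`!%:R.

Lemma is_derive_exp_poly m x :
  is_derive x (1:R) (exp_poly m.+1) (exp_poly m x).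
Proof.
elim: m => [|m IHm].
  rewrite /exp_poly (_ : (fun x => _) = fun=> 1) ?big_ord0; first exact: is_derive_fcst.
  by apply/funext => y; rewrite big_ord_recr big_ord0/= add0r expr0 fact0 divr1.
rewrite (_ : exp_poly m.+2 = fun x => exp_poly m.+1 x + x ^+ m.+1 / m.+1`!%:R); last first.
  by apply/funext => y; rewrite /exp_poly big_ord_recr.
derive_to; rewrite /exp_poly big_ord_recr/=; congr (_ + _).
rewrite factS natrM; field.
by rewrite pnatr_eq0 -lt0n fact_gt0 addrC natr1 pnatr_eq0.
Qed.

(** The remainder r of order m + 1 has minus the remainder of order m as derivative. By induction
    x^(m+1) / (m+1)! plus or minus r is nondecreasing, and it vanishes at 0. *)
Lemma exp_taylor m x : 0 <= x -> `|expR (- x) - exp_poly m (- x)| <= x ^+ m / m`!%:R.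
Proof.
elim: m x => [|m IHm] x x0.
  rewrite /exp_poly big_ord0 subr0 expr0 fact0 divr1 ger0_norm ?expR_ge0//.
  by rewrite -expR0 ler_expR oppr_le0.
pose r y := expR (- y) - exp_poly m.+1 (- y).
pose p (y : R) := y ^+ m.+1 / m.+1`!%:R.
have dp y : is_derive y (1:R) p (y ^+ m / m`!%:R).
  rewrite /p; derive_to; rewrite factS natrM/=; field.
  by rewrite pnatr_eq0 -lt0n fact_gt0 addrC natr1 pnatr_eq0.
have dr y : is_derive y (1:R) r (- (expR (- y) - exp_poly m (- y))).
  have dq : is_derive y (1:R) (fun y => exp_poly m.+1 (- y)) (- 1 * exp_poly m (- y)).
    exact: (is_derive_fcomp (is_derive_exp_poly m (- y)) (is_derive_fN (is_derive_fid y))).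
  by rewrite /r; derive_to; ring.
have r0 : r 0 = 0.
  rewrite /r oppr0 expR0 /exp_poly big_ord_recl/= expr0 fact0 divr1 big1 ?addr0 ?subrr//.
  by move=> i _; rewrite expr0n mul0r.
have p0 : p 0 = 0 by rewrite /p expr0n mul0r.
have bd y : y \in `[0, x] -> `|expR (- y) - exp_poly m (- y)| <= y ^+ m / m`!%:R.
  by rewrite in_itv/= => /andP[y0 _]; exact: IHm.
have h1 := @ge0_derive_le R (fun y => p y + r y) _ `[0, x]
  (fun y _ => is_derive_fD (dp y) (dr y)).
have h2 := @ge0_derive_le R (fun y => p y - r y) _ `[0, x]
  (fun y _ => is_derive_fD (dp y) (is_derive_fN (dr y))).
have x0x : (0 \in `[0, x]) && (x \in `[0, x]) by rewrite !in_itv/= !lexx x0.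
move/andP: x0x => [i0 ix].
rewrite ler_norml; apply/andP; split.
  have : p 0 + r 0 <= p x + r x.
    by apply: h1 => // y /bd; rewrite ler_norml; lra.
  rewrite r0 p0 -/(r x) -/(p x); lra.
have : p 0 - r 0 <= p x - r x.
  by apply: h2 => // y /bd; rewrite ler_norml; lra.
rewrite r0 p0 -/(r x) -/(p x); lra.
Qed.

Lemma fact_add_le n m : ((n + m)`! <= n`! * m`! * 2 ^ (n + m))%N.
Proof.
have bin_le k l : ('C(k, l) <= 2 ^ k)%N.
  elim: k l => [|k IHk] [|l]; rewrite ?bin0 ?bin0n// ?expn_gt0//.
  by rewrite binS expnS mul2n -addnn leq_add.
rewrite -(@bin_fact (n + m) n) ?leq_addr// addKn mulnC leq_mul2l.
by rewrite bin_le orbT.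
Qed.

End exp_taylor.

(** * Uniqueness in the moment problem on the half-line *)

Section moment_problem.
Context {R : realType}.
Let D := `[0%R, +oo[%classic : set R.
Let mD : measurable (D : set (measurableTypeR R)).
Proof. exact: measurable_itv. Qed.
Implicit Types (P Q : {measure set (measurableTypeR R) -> \bar R}) (c e : R).

Definition small_moments P := forall n,
  (\int[P]_(x in `[0%R, +oo[) (x ^+ n)%:E <= (n`!%:R)%:E)%E.

(** Up to sign, the n-th derivative at c of the Laplace transform of P. *)
Definition exp_moment P n c := \int[P]_(x in `[0%R, +oo[) (x ^+ n * expR (- (c * x))).

Let Dge0 x : D x -> 0 <= x. Proof. by rewrite /D /= in_itv/= andbT. Qed.

Lemma integrable_pow P n : small_moments P -> P.-integrable D (EFin \o (fun x => x ^+ n)).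
Proof.
move=> hP; apply/integrableP; split.
  by apply/measurable_EFinP; apply: measurable_funTS; exact: exprn_measurable.
apply: (@le_lt_trans _ _ (n`!%:R)%:E); last by rewrite ltry.
apply: le_trans (hP n); rewrite le_eqVlt; apply/orP; left; apply/eqP.
by apply: eq_integral => x /set_mem /Dge0 x0; rewrite gee0_abs// lee_fin exprn_ge0.
Qed.

Lemma measurable_pow_exp n c : measurable_fun D (fun x : R => x ^+ n * expR (- (c * x))).
Proof.
apply: measurable_funTS; apply: measurable_funM => //.
by apply: measurableT_comp => //; apply: measurableT_comp.
Qed.

Lemma integrable_pow_exp P n c : small_moments P -> 0 <= c ->
  P.-integrable D (EFin \o (fun x => x ^+ n * expR (- (c * x)))).
Proof.
move=> hP c0; apply: (le_integrable mD _ _ (integrable_pow n hP)).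
  by apply/measurable_EFinP; exact: measurable_pow_exp.
move=> x /Dge0 x0; rewrite lee_fin normrM ler_piMr// ger0_norm ?expR_ge0//.
by rewrite -expR0 ler_expR oppr_le0 mulr_ge0.
Qed.

Lemma Rintegral_exp_poly P n c e m : small_moments P -> 0 <= c ->
  P.-integrable D (EFin \o (fun x => x ^+ n * expR (- (c * x)) * exp_poly m (- (e * x)))) /\
  \int[P]_(x in D) (x ^+ n * expR (- (c * x)) * exp_poly m (- (e * x))) =
  \sum_(i < m) ((- e) ^+ i / i`!%:R) * exp_moment P (n + i) c.
Proof.
move=> hP c0; elim: m => [|m [IHi IHm]].
  rewrite big_ord0 /exp_poly (_ : (fun x => _) = fun=> 0); last first.
    by apply/funext => x; rewrite big_ord0 mulr0.
  split; first exact: integrable0.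
  by rewrite /Rintegral integral0.
have ii := integrable_pow_exp (n + m) hP c0.
have e1 : (fun x => x ^+ n * expR (- (c * x)) * exp_poly m.+1 (- (e * x))) =
  (fun x => x ^+ n * expR (- (c * x)) * exp_poly m (- (e * x)) +
    ((- e) ^+ m / m`!%:R) * (x ^+ (n + m) * expR (- (c * x)))).
  apply/funext => x; rewrite /exp_poly big_ord_recr/= mulrDr; congr (_ + _).
  by rewrite -(mulNr e x) exprMn exprD; ring.
rewrite e1; split; first by apply: integrable_fD => //; exact: integrable_fZl.
rewrite RintegralD//; last exact: integrable_fZl.
by rewrite RintegralZl// IHm big_ord_recr.
Qed.

Lemma exp_moment_taylor P n c e m : small_moments P -> 0 <= c -> 0 <= e ->
  `|exp_moment P n (c + e) -
    \sum_(i < m) ((- e) ^+ i / i`!%:R) * exp_moment P (n + i) c| <=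
  e ^+ m * (n + m)`!%:R / m`!%:R.
Proof.
move=> hP c0 e0; have [ii <-] := Rintegral_exp_poly n e m hP c0.
have ice : P.-integrable D (EFin \o (fun x => x ^+ n * expR (- ((c + e) * x)))).
  by apply: integrable_pow_exp => //; exact: addr_ge0.
rewrite -RintegralB//; apply: le_trans (le_normr_Rintegral mD _) _.
  exact: integrable_fB.
have im := integrable_pow (n + m) hP.
apply: (@le_trans _ _ (\int[P]_(x in D) (e ^+ m / m`!%:R * x ^+ (n + m)))).
  apply: le_Rintegral => //.
  - exact: integrable_norm (integrable_fB mD ice ii).
  - exact: integrable_fZl.
  move=> x /Dge0 x0.
  have -> : x ^+ n * expR (- ((c + e) * x)) - x ^+ n * expR (- (c * x)) * exp_poly m (- (e * x))
     = x ^+ n * expR (- (c * x)) * (expR (- (e * x)) - exp_poly m (- (e * x))).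
    by rewrite mulrDl opprD expRD; ring.
  have -> : e ^+ m / m`!%:R * x ^+ (n + m) = x ^+ n * 1 * ((e * x) ^+ m / m`!%:R).
    by rewrite exprMn exprD; ring.
  rewrite !normrM; apply: ler_pM; rewrite ?mulr_ge0//; last by apply: exp_taylor; rewrite mulr_ge0.
  apply: ler_pM => //; first by rewrite ger0_norm ?exprn_ge0.
  by rewrite ger0_norm ?expR_ge0// -expR0 ler_expR oppr_le0 mulr_ge0.
rewrite RintegralZl// mulrAC ler_pM2r ?invr_gt0 ?ltr0n ?fact_gt0//.
apply: ler_wpM2l; first exact: exprn_ge0.
rewrite /Rintegral -lee_fin fineK ?hP//.
exact: integrable_fin_num im.
Qed.

(* Since the moments are at most n!, the Taylor expansion of e^(-e x) may be integrated
   term by term for small e, with a radius that does not depend on c: equality of all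
   the moments weighted by e^(-c x) propagates from c to c + e. *)
Lemma exp_moment_step P Q c e : small_moments P -> small_moments Q ->
  0 <= c -> 0 <= e <= 4^-1 -> (forall n, exp_moment P n c = exp_moment Q n c) ->
  forall n, exp_moment P n (c + e) = exp_moment Q n (c + e).
Proof.
move=> hP hQ c0 /andP[e0 e4] PQ n.
suff : `|exp_moment P n (c + e) - exp_moment Q n (c + e)| <= 0.
  by rewrite normr_le0 subr_eq0 => /eqP.
have h m : `|exp_moment P n (c + e) - exp_moment Q n (c + e)| <=
    2 * n`!%:R * 2 ^+ n * 2^-1 ^+ m.
  have h1 := exp_moment_taylor n m hP c0 e0; have h2 := exp_moment_taylor n m hQ c0 e0.
  have e12 : \sum_(i < m) (- e) ^+ i / i`!%:R * exp_moment P (n + i) c =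
      \sum_(i < m) (- e) ^+ i / i`!%:R * exp_moment Q (n + i) c.
    by apply: eq_bigr => i _; rewrite PQ.
  rewrite -e12 in h2.
  (* By [fact_add_le] the left side is at most n! 2^n (2 e)^m; the radius 1/4 makes it decay
     geometrically in m. *)
  have h3 : e ^+ m * (n + m)`!%:R / m`!%:R <= n`!%:R * 2 ^+ n * 2^-1 ^+ m.
    rewrite ler_pdivrMr ?ltr0n ?fact_gt0//.
    apply: (@le_trans _ _ (4^-1 ^+ m * (n`! * m`! * 2 ^ (n + m))%N%:R)).
      by apply: ler_pM => //; [exact: exprn_ge0|rewrite lerXn2r// nnegrE|rewrite ler_nat fact_add_le].
    rewrite !natrM natrX exprD le_eqVlt; apply/orP; left; apply/eqP.
    have -> : 4^-1 = 2^-1 * 2^-1 :> R by field.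
    have : 2^-1 ^+ m * 2 ^+ m = 1 :> R by rewrite -exprMn mulVf// expr1n.
    rewrite exprMn => h22.
    transitivity (n`!%:R * m`!%:R * 2 ^+ n * 2^-1 ^+ m * (2^-1 ^+ m * 2 ^+ m) : R); first ring.
    by rewrite h22; ring.
  by move: h1 h2; rewrite !ler_norml; lra.
have c2 : 2 * n`!%:R * 2 ^+ n * 2^-1 ^+ m @[m --> \oo] --> (0 : R).
  rewrite -[X in _ --> X](mulr0 (2 * n`!%:R * 2 ^+ n)); apply: cvgMr; apply: cvg_expr.
  by rewrite ger0_norm// invf_lt1// ltr1n.
by apply: (cvgr_to_ge c2); exact: nearW.
Qed.

Lemma exp_moment_eq P Q c : small_moments P -> small_moments Q ->
  (forall n, exp_moment P n 0 = exp_moment Q n 0) -> 0 <= c ->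
  exp_moment P 0 c = exp_moment Q 0 c.
Proof.
move=> hP hQ PQ c0.
(* Since N > 4 c, the point c is reached from 0 in N steps of length at most 1/4. *)
pose N := (Num.truncn (4 * c)).+1.
have N0 : 0 < N%:R :> R by rewrite ltr0n.
have e01 : 0 <= c / N%:R <= 4^-1.
  rewrite divr_ge0//= ler_pdivrMr// -ler_pdivrMl// invrK.
  by rewrite ltW// truncnS_gt.
have : forall j n, exp_moment P n (j%:R * (c / N%:R)) = exp_moment Q n (j%:R * (c / N%:R)).
  elim=> [|j IHj] n; first by rewrite mul0r.
  rewrite -natr1 mulrDl mul1r; apply: exp_moment_step => //.
  by rewrite mulr_ge0//; lra.
by move=> /(_ N 0%N); rewrite mulrCA divff ?mulr1// gt_eqF.
Qed.

Lemma Rintegral_exp_sum P (a : nat -> R) c m : small_moments P -> 0 <= c ->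
  P.-integrable D (EFin \o (fun x => \sum_(i < m) a i * expR (- (i%:R * c * x)))) /\
  \int[P]_(x in D) (\sum_(i < m) a i * expR (- (i%:R * c * x))) =
  \sum_(i < m) a i * exp_moment P 0 (i%:R * c).
Proof.
move=> hP c0; elim: m => [|m [IHi IHm]].
  rewrite big_ord0 (_ : (fun x => _) = fun=> 0); last first.
    by apply/funext => x; rewrite big_ord0.
  split; first exact: integrable0.
  by rewrite /Rintegral integral0.
have ii : P.-integrable D (EFin \o (fun x => a m * (x ^+ 0 * expR (- (m%:R * c * x))))).
  by apply: integrable_fZl => //; apply: integrable_pow_exp => //; rewrite mulr_ge0.
have e1 : (fun x => \sum_(i < m.+1) a i * expR (- (i%:R * c * x))) =
  (fun x => \sum_(i < m) a i * expR (- (i%:R * c * x)) + a m * (x ^+ 0 * expR (- (m%:R * c * x)))).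
  by apply/funext => x; rewrite big_ord_recr/= expr0 mul1r.
rewrite e1; split; first exact: integrable_fD.
rewrite RintegralD// IHm big_ord_recr/= RintegralZl//.
by apply: integrable_pow_exp => //; rewrite mulr_ge0.
Qed.

(** The binomial expansion reduces these integrals to Laplace transforms at multiples of c. *)
Lemma Rintegral_onem_exp P Q c N : small_moments P -> small_moments Q ->
  (forall n, exp_moment P n 0 = exp_moment Q n 0) -> 0 <= c ->
  [/\ P.-integrable D (EFin \o (fun x => (1 - expR (- (c * x))) ^+ N)),
      Q.-integrable D (EFin \o (fun x => (1 - expR (- (c * x))) ^+ N)) &
  \int[P]_(x in D) ((1 - expR (- (c * x))) ^+ N) =
  \int[Q]_(x in D) ((1 - expR (- (c * x))) ^+ N)].
Proof.
move=> hP hQ PQ c0.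
pose a i : R := (-1) ^+ i *+ 'C(N, i).
have e1 : (fun x => (1 - expR (- (c * x))) ^+ N) =
    fun x => \sum_(i < N.+1) a i * expR (- (i%:R * c * x)).
  apply/funext => x; rewrite exprBn; apply: eq_bigr => i _.
  have -> : expR (- (c * x)) ^+ i = expR (- (i%:R * c * x)).
    by rewrite -expRM_natl; congr expR; ring.
  by rewrite expr1n mulr1; exact/esym/mulrnAl.
have [iP eP] := Rintegral_exp_sum a N.+1 hP c0.
have [iQ eQ] := Rintegral_exp_sum a N.+1 hQ c0.
rewrite e1; split=> //; rewrite eP eQ; apply: eq_bigr => i _.
by congr (_ * _); apply: exp_moment_eq => //; rewrite mulr_ge0.
Qed.

Lemma bernoulli_ineq (t : R) N : 0 <= t <= 1 -> 1 - N%:R * t <= (1 - t) ^+ N.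
Proof.
move=> t01; elim: N => [|N IHN]; first by rewrite mul0r subr0 expr0.
rewrite exprS; apply: (@le_trans _ _ ((1 - t) * (1 - N%:R * t))).
  have : 0 <= N%:R * t * t by rewrite !mulr_ge0//; lra.
  by rewrite -natr1; lra.
by apply: ler_wpM2l => //; lra.
Qed.

Lemma fine_tail P (A : set R) : small_moments P -> measurable (A : set (measurableTypeR R)) -> A `<=` D ->
  P.-integrable D (EFin \o \1_A) /\ \int[P]_(x in D) \1_A x = fine (P A).
Proof.
move=> hP mA AD; have := hP 0%N.
under eq_integral do rewrite expr0.
rewrite integral_cst// mul1e => PD1.
have PD : (P D < +oo)%E by apply: le_lt_trans PD1 _; rewrite ltry.
split; last by rewrite /Rintegral integral_indic// setIidl.
apply: measurable_bounded_integrable => //.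
exists 1; split; first exact: num_real.
move=> r r1 x _; apply: le_trans (ltW r1).
by rewrite indicE; case: (x \in A); rewrite ?normr1 ?normr0.
Qed.

(* As n tends to infinity, (1 - 2^(- n x / x0))^(2^n) tends to 0 for x < x0 and to 1 for
   x > x0. *)
Lemma tail_le P Q (z y : R) : small_moments P -> small_moments Q ->
  (forall n, exp_moment P n 0 = exp_moment Q n 0) -> 0 < z -> z < y ->
  fine (P `]y, +oo[%classic) <= fine (Q `[z, +oo[%classic).
Proof.
move=> hP hQ PQ z0 zy.
pose x0 := (y + z) / 2.
have x00 : 0 < x0 by rewrite /x0; lra.
have ln20 : 0 < ln 2 :> R by rewrite ln_gt0// ltr1n.
(* The approximate indicator is at least 1 - r1^n beyond y, by Bernoulli, and at most r2^n below z,
   by (1 - t)^N <= e^(- N t). *)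
pose r1 := expR (- (ln 2 * ((y - x0) / x0))).
pose r2 := expR (- (ln 2 * ((x0 - z) / x0))).
have r1_ : 0 <= r1 < 1.
  rewrite expR_ge0/= expR_lt1 oppr_lt0 mulr_gt0 ?divr_gt0//; rewrite /x0; lra.
have r2_ : 0 <= r2 < 1.
  rewrite expR_ge0/= expR_lt1 oppr_lt0 mulr_gt0 ?divr_gt0//; rewrite /x0; lra.
have key n : fine (P `]y, +oo[%classic) * (1 - r1 ^+ n) <=
    fine (Q `[z, +oo[%classic) + r2 ^+ n * fine (Q D).
  pose c := n%:R * (ln 2 / x0).
  have c0 : 0 <= c by rewrite mulr_ge0// divr_ge0// ltW.
  have [iP iQ ePQ] := Rintegral_onem_exp (2 ^ n) hP hQ PQ c0.
  have N2 : (2 ^ n)%N%:R = expR (n%:R * ln 2) :> R.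
    by rewrite expRM_natl lnK ?posrE// natrX.
  have t01 x : D x -> 0 <= expR (- (c * x)) <= 1.
    by move=> /Dge0 xx; rewrite expR_ge0/= expR_le1 oppr_le0 mulr_ge0.
  have yD : `]y, +oo[ `<=` D.
    by move=> x /=; rewrite /D/= !in_itv/= !andbT; lra.
  have zD : `[z, +oo[ `<=` D.
    by move=> x /=; rewrite /D/= !in_itv/= !andbT; lra.
  have [iy ey] := fine_tail hP (measurable_itv `]y, +oo[) yD.
  have [iz ez] := fine_tail hQ (measurable_itv `[z, +oo[) zD.
  have [iD eD] := fine_tail hQ mD (@subset_refl _ D).
  rewrite -ey -ez -eD -RintegralZr//.
  rewrite -RintegralZl// -RintegralD//; last exact: integrable_fZl.
  apply: (@le_trans _ _ (\int[P]_(x in D) ((1 - expR (- (c * x))) ^+ (2 ^ n)))).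
    apply: le_Rintegral => //.
      rewrite (_ : EFin \o _ = EFin \o (fun x => (1 - r1 ^+ n) * \1_`]y, +oo[ x)).
        exact: integrable_fZl.
      by apply/funext => x /=; rewrite mulrC.
    move=> x Dx; rewrite indicE; case: (boolP (x \in _)) => [|_]; last first.
      by rewrite mul0r exprn_ge0// subr_ge0; have := t01 x Dx; lra.
    rewrite inE/= in_itv/= andbT => yx; rewrite mul1r.
    apply: le_trans (bernoulli_ineq _ (t01 x Dx)).
    rewrite lerD2l lerN2 N2 -expRD -expRM_natl ler_expR /c.
    have -> : n%:R * ln 2 + - (n%:R * (ln 2 / x0) * x) = n%:R * (ln 2 * ((x0 - x) / x0)).
      by field; rewrite gt_eqF.
    rewrite ler_wpM2l// -mulrN ler_pM2l// -mulNr ler_pM2r ?invr_gt0//; lra.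
  rewrite ePQ; apply: le_Rintegral => //.
    by apply: integrable_fD => //; exact: integrable_fZl.
  move=> x Dx; rewrite [\1_D x]indicE mem_set// mulr1 indicE.
  case: (boolP (x \in _)) => [_|].
    apply: (@le_trans _ _ 1); last by rewrite lerDl exprn_ge0//; lra.
    by rewrite exprn_ile1//; have := t01 x Dx; lra.
  rewrite notin_setE/= in_itv/= andbT => /negP; rewrite -ltNge => xz.
  rewrite add0r.
  apply: (@le_trans _ _ (expR (- ((2 ^ n)%N%:R * expR (- (c * x)))))).
    rewrite -(mulrN (2 ^ n)%N%:R) expRM_natl lerXn2r ?nnegrE ?expR_ge0//.
      by have := t01 x Dx; lra.
    by have := @expR_ge1Dx R (- expR (- (c * x))); lra.
  rewrite N2 -expRD -expRM_natl.
  apply: (@le_trans _ _ (expR (- (expR (n%:R * (ln 2 * ((x0 - z) / x0))))))).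
    rewrite ler_expR lerN2 ler_expR /c.
    have -> : n%:R * ln 2 + - (n%:R * (ln 2 / x0) * x) = n%:R * (ln 2 * ((x0 - x) / x0)).
      by field; rewrite gt_eqF.
    rewrite ler_wpM2l// ler_pM2l// ler_pM2r ?invr_gt0//; lra.
  (* With v = e^s one has v <= e^v, hence exp(- e^s) <= e^(-s). *)
  rewrite mulrN expRN [X in _ <= X]expRN lef_pV2 ?posrE ?expR_gt0//.
  by have := @expR_ge1Dx R (expR (n%:R * (ln 2 * ((x0 - z) / x0)))); lra.
have cl : fine (P `]y, +oo[%classic) * (1 - r1 ^+ n) @[n --> \oo] --> fine (P `]y, +oo[%classic).
  rewrite -[X in _ --> X]mulr1; apply: cvgMr.
  rewrite -[X in _ --> X]subr0; apply: cvgB; first exact: cvg_cst.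
  by apply: cvg_expr; rewrite ger0_norm; lra.
have cr : fine (Q `[z, +oo[%classic) + r2 ^+ n * fine (Q D) @[n --> \oo] --> fine (Q `[z, +oo[%classic).
  rewrite -[X in _ --> X]addr0; apply: cvgD; first exact: cvg_cst.
  rewrite -[X in _ --> X](mul0r (fine (Q D))); apply: cvgMl.
  by apply: cvg_expr; rewrite ger0_norm; lra.
by apply: (ler_cvg_to cl cr); exact: nearW.
Qed.

Lemma moment_unique P Q : small_moments P -> small_moments Q ->
  (forall n, (\int[P]_(x in D) (x ^+ n)%:E = \int[Q]_(x in D) (x ^+ n)%:E)%E) ->
  P setT = 1%E -> Q setT = 1%E ->
  P `]-oo, 0[%classic = 0%E -> Q `]-oo, 0[%classic = 0%E ->
  forall A, measurable (A : set (measurableTypeR R)) -> P A = Q A.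
Proof.
move=> hP hQ PQ P1 Q1 P0 Q0.
have PQ' n : exp_moment P n 0 = exp_moment Q n 0.
  rewrite /exp_moment /Rintegral; congr fine.
  under eq_integral do rewrite mul0r oppr0 expR0 mulr1.
  under [RHS]eq_integral do rewrite mul0r oppr0 expR0 mulr1.
  exact: PQ.
have finP (M : {measure set (measurableTypeR R) -> \bar R}) (A : set R) : M setT = 1%E ->
    measurable (A : set (measurableTypeR R)) -> M A \is a fin_num.
  move=> M1 mA; rewrite ge0_fin_numE//; apply: (@le_lt_trans _ _ 1%E); last by rewrite ltry.
  by rewrite -M1; apply: le_measure; rewrite ?inE.
have half (M N : {measure set (measurableTypeR R) -> \bar R}) : small_moments M -> small_moments N ->
    (forall n, exp_moment M n 0 = exp_moment N n 0) -> M setT = 1%E -> N setT = 1%E ->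
    forall x : R, 0 <= x -> (M `]x, +oo[%classic <= N `]x, +oo[%classic)%E.
  move=> hM hN MN M1 N1 x x0.
  (* The offsets 2 / (n + 1) here and 1 / (n + 1) in the comparison below create the gap that
     [tail_le] asks for, and keep its lower point positive when x = 0. *)
  pose F n := `](x + 2 * n.+1%:R^-1), +oo[%classic : set R.
  have FU : \bigcup_n F n = `]x, +oo[%classic.
    apply/seteqP; split => [y [n _]|y].
      rewrite /F/= !in_itv/= !andbT; apply: le_lt_trans.
      by rewrite lerDl mulr_ge0.
    rewrite /= in_itv/= andbT => xy; have yx : 0 < (y - x) / 2 by lra.
    exists (Num.truncn ((y - x) / 2)^-1) => //; rewrite /F/= in_itv/= andbT.
    set k := (Num.Def.trunc _).+1.
    have h : k%:R^-1 < (y - x) / 2.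
      by rewrite invf_plt ?posrE ?ltr0n// truncnS_gt.
    by lra.
  have cF : (M \o F) n @[n --> \oo] --> M `]x, +oo[%classic.
    rewrite -FU; apply: nondecreasing_cvg_mu.
    - by move=> n; exact: measurable_itv.
    - by apply: bigcup_measurable => n _; exact: measurable_itv.
    - move=> n m nm; apply/subsetPset => y; rewrite /F/= !in_itv/= !andbT.
      apply: le_lt_trans; rewrite lerD2l ler_pM2l// lef_pV2 ?posrE//.
      by rewrite ler_nat ltnS.
  have -> : M `]x, +oo[%classic = limn (M \o F) by apply/esym/cvg_lim.
  apply: lime_le; first by apply/cvg_ex; exists (M `]x, +oo[%classic).
  apply: nearW => n.
  have n0 : 0 < n.+1%:R^-1 :> R by rewrite invr_gt0.
  have fM : M (F n) \is a fin_num by apply: finP => //; exact: measurable_itv.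
  have fN y : N `[y, +oo[%classic \is a fin_num by apply: finP => //; exact: measurable_itv.
  apply: (@le_trans _ _ (N `[x + n.+1%:R^-1, +oo[%classic)).
    rewrite /= -(fineK fM) -(fineK (fN _)) lee_fin.
    rewrite /F; move: (n.+1%:R^-1) n0 => h h0.
    by apply: tail_le => //; lra.
  apply: le_measure; rewrite ?inE; [exact: measurable_itv|exact: measurable_itv|].
  by move=> y; rewrite /= !in_itv/= !andbT; apply: lt_le_trans; rewrite ltrDl.
have neg (M : {measure set (measurableTypeR R) -> \bar R}) (x : R) : M setT = 1%E ->
    M `]-oo, 0[%classic = 0%E -> x < 0 -> M `]x, +oo[%classic = 1%E.
  move=> M1 M0 x0.
  have Mx : M `]-oo, x]%classic = 0%E.
    apply/eqP; rewrite eq_le measure_ge0 andbT -M0.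
    apply: le_measure; rewrite ?inE; [exact: measurable_itv|exact: measurable_itv|].
    by move=> y; rewrite /= !in_itv/=; lra.
  have : M setT = (M `]-oo, x]%classic + M `]x, +oo[%classic)%E.
    rewrite -measureU; [|exact: measurable_itv|exact: measurable_itv|].
      congr (M _); apply/seteqP; split => // y _; rewrite /= !in_itv/= andbT.
      by have [] := lerP y x; [left|right].
    apply/seteqP; split => // y []; rewrite /= !in_itv/=; lra.
  by rewrite M1 Mx add0e.
have tailE x : P `]x, +oo[%classic = Q `]x, +oo[%classic.
  have [x0|x0] := leP 0 x; last by rewrite !neg.
  by apply/eqP; rewrite eq_le; apply/andP; split; apply: half.
move=> A mA.
apply: (@measure_unique _ R (measurableTypeR R) (@RGenOInfty.G R)
  (fun n => `](- n%:R), +oo[%classic) _ _ _ _ P Q _ _ A mA).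
- exact: RGenOInfty.measurableE.
- move=> _ _ [x ->] [y ->]; exists (Num.max x y); apply/seteqP; split => z.
    by rewrite /= !in_itv/= !andbT gt_max => -[-> ->].
  by rewrite /= !in_itv/= !andbT gt_max => /andP.
- by move=> n; exists (- n%:R).
- apply/seteqP; split => // x _; exists (Num.truncn (- x)).+1 => //=.
  by rewrite in_itv/= andbT; have := truncnS_gt (- x); lra.
- by move=> _ [x ->].
- by move=> n; apply: (@le_lt_trans _ _ 1%E); [rewrite -P1; apply: le_measure; rewrite ?inE|rewrite ltry].
Qed.

End moment_problem.

(** * Negative moments of positive stable variables *)

Section gamma_integral.
Context {R : realType}.
Implicit Types (s t z : R).
Let mu := @lebesgue_measure R.
Let H := `]0%R, +oo[%classic : set R.

(** The inequality ln v < v at v = t / (2 s), which yields C = (2 s)^s. *)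
Lemma powR_le_expR s : 0 <= s -> exists2 C, 0 < C & forall t, 0 < t -> t `^ s <= C * expR (t / 2).
Proof.
rewrite le_eqVlt => /predU1P[<-|s0].
  by exists 1 => // t t0; rewrite powRr0 mul1r -expR0 ler_expR divr_ge0// ltW.
exists (expR (s * ln (2 * s))); first exact: expR_gt0.
move=> t t0; rewrite /powR gt_eqF// -expRD ler_expR.
have s20 : 0 < 2 * s by rewrite mulr_gt0.
have := @ln_sublinear R (t / (2 * s)); rewrite divr_gt0// => /(_ isT).
rewrite ln_div ?posrE// => h.
have : s * (ln t - ln (2 * s)) <= s * (t / (2 * s)) by rewrite ler_pM2l// ltW.
have -> : s * (t / (2 * s)) = t / 2 by field; rewrite gt_eqF.
by lra.
Qed.

Lemma integral_expR_tail c z : 0 < c ->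
  (\int[mu]_(t in `[z, +oo[) (expR (- (c * t)))%:E = (expR (- (c * z)) / c)%:E)%E.
Proof.
move=> c0.
have dF t : is_derive t (1:R) (fun t => - (expR (- (c * t)) / c)) (expR (- (c * t))).
  by derive_to; field; rewrite gt_eqF.
rewrite (@ge0_continuous_FTC2y R _ (fun t => - (expR (- (c * t)) / c)) z 0)//.
- by rewrite EFinN oppeK add0e.
- apply: continuous_subspaceT => t; have [d hd] : exists d, is_derive t (1:R) (fun t => expR (- (c * t))) d.
    by eexists; der.
  exact: is_derive_continuous hd.
- rewrite -oppr0; apply: cvgN; rewrite -[X in _ --> X](mul0r c^-1); apply: cvgMl.
  apply: (cvg_comp (fun t => c * t) (fun t => expR (- t))); last exact: cvgr_expR.
  exact: gt0_cvgMry.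
- by apply: cvg_at_right_filter; exact: is_derive_continuous (dF z).
- by move=> t _; rewrite derive1E; exact: derive_val.
Qed.

Lemma integrable_expR_tail c : 0 < c -> mu.-integrable H (EFin \o (fun t => expR (- (c * t)))).
Proof.
move=> c0; apply/integrableP; split.
  apply/measurable_EFinP; apply: measurable_funTS.
  by apply: measurableT_comp => //; apply: measurableT_comp.
under eq_integral do rewrite gee0_abs ?lee_fin ?expR_ge0//.
apply: (@le_lt_trans _ _ (\int[mu]_(t in `[0%R, +oo[) (expR (- (c * t)))%:E)%E).
  apply: ge0_subset_integral => //.
  - exact: measurable_itv.
  - apply/measurable_EFinP; apply: measurable_funTS.
    by apply: measurableT_comp => //; apply: measurableT_comp.
  - by move=> t _; rewrite lee_fin expR_ge0.
  - by move=> t; rewrite /H/= !in_itv/= !andbT; exact: ltW.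
by rewrite integral_expR_tail// ltry.
Qed.

(** This is Gamma(s + 1). The shift keeps the integrand bounded near 0 for s >= 0 and makes the
    value at n equal to n!. *)
Definition gamma1 s := \int[mu]_(t in H) (t `^ s * expR (- t)).

Lemma is_derive_powR_exp s t : 0 < t -> is_derive t (1:R) (fun t => t `^ s * expR (- t))
  (s * t `^ (s - 1) * expR (- t) - t `^ s * expR (- t)).
Proof.
move=> t0; have dp : is_derive t (1:R) (fun t => t `^ s) (s * t `^ (s - 1)) by exact: is_derive1_powR.
by derive_to; ring.
Qed.

Lemma integrable_gamma s : 0 <= s -> mu.-integrable H (EFin \o (fun t => t `^ s * expR (- t))).
Proof.
move=> s0; have [C C0 hC] := powR_le_expR s0.
have mH : measurable (H : set (measurableTypeR R)) by exact: measurable_itv.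
apply: (@le_integrable _ _ _ _ _ mH _ (EFin \o (fun t => C * expR (- (2^-1 * t))))).
- apply/measurable_EFinP; apply: open_continuous_measurable_fun => // t.
  rewrite inE /H/= in_itv/= andbT => t0.
  exact: is_derive_continuous (is_derive_powR_exp s t0).
- move=> t; rewrite /H/= in_itv/= andbT => t0.
  rewrite lee_fin !ger0_norm ?mulr_ge0 ?expR_ge0 ?powR_ge0// ?(ltW C0)//.
  have -> : C * expR (- (2^-1 * t)) = C * expR (t / 2) * expR (- t).
    by rewrite -mulrA -expRD; congr (_ * expR _); field.
  by rewrite ler_pM2r ?expR_gt0// hC.
- by apply: integrable_fZl => //; apply: integrable_expR_tail; rewrite invr_gt0.
Qed.

Lemma gamma1_EFin s : 0 <= s -> (\int[mu]_(t in H) (t `^ s * expR (- t))%:E)%E = (gamma1 s)%:E.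
Proof.
move=> s0; rewrite /gamma1 /Rintegral fineK//.
by apply: integrable_fin_num (integrable_gamma s0); exact: measurable_itv.
Qed.

Lemma gamma10 : gamma1 0 = 1.
Proof.
have := @integral_expR_tail 1 0 ltr01.
rewrite mulr0 oppr0 expR0 divr1 -integral_itv_obnd_cbnd; last first.
  apply/measurable_EFinP; apply: measurable_funTS.
  by apply: measurableT_comp => //; apply: measurableT_comp.
move=> h; apply: EFin_inj; rewrite -gamma1_EFin// -h.
by apply: eq_integral => t _; rewrite powRr0 !mul1r.
Qed.

Lemma gamma1S s : 0 <= s -> gamma1 (s + 1) = (s + 1) * gamma1 s.
Proof.
move=> s0; have s1 : 0 <= s + 1 by lra.
have mH : measurable (H : set (measurableTypeR R)) by exact: measurable_itv.
have i1 := integrable_gamma s0; have i2 := integrable_gamma s1.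
apply/eqP; rewrite eq_sym -subr_eq0 /gamma1 -RintegralZl// -RintegralB//; last first.
  exact: integrable_fZl.
apply/eqP; rewrite [RHS](_ : _ = 0 - 0); last by rewrite subr0.
apply: (@FTC_oy R _ (fun t => t `^ (s + 1) * expR (- t))).
- by apply: integrable_fB => //; exact: integrable_fZl.
- move=> t; rewrite in_itv/= andbT => t0.
  by apply: cvgB; [apply: cvgMr|]; exact: is_derive_continuous (is_derive_powR_exp _ t0).
- move=> t; rewrite in_itv/= andbT => t0.
  by apply: is_derive_eq (is_derive_powR_exp (s + 1) t0) _; rewrite addrK; ring.
- rewrite -[X in _ --> X](mul0r (expR (- 0))); apply: cvgM.
    by apply: powR_cvg0; lra.
  apply: cvg_at_right_filter; apply: continuous_cvg; first exact: continuous_expR.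
  by apply: cvgN; exact: cvg_id.
- have [C C0 hC] := powR_le_expR s1.
  apply: (cvg0_of_norm_le (g := fun t => C * expR (- (2^-1 * t)))).
    near=> t; have t0 : 0 < t by near: t; exact: nbhs_pinfty_gt.
    rewrite ger0_norm ?mulr_ge0 ?expR_ge0 ?powR_ge0//.
    have -> : C * expR (- (2^-1 * t)) = C * expR (t / 2) * expR (- t).
      by rewrite -mulrA -expRD; congr (_ * expR _); field.
    by rewrite ler_pM2r ?expR_gt0// hC.
  rewrite -(mulr0 C); apply: cvgMr.
  apply: (cvg_comp (fun t => 2^-1 * t) (fun t => expR (- t))); last exact: cvgr_expR.
  by apply: gt0_cvgMry; rewrite // invr_gt0.
Unshelve. all: by end_near. Qed.

Lemma gamma1D s n : 0 <= s -> gamma1 (s + n%:R) = \prod_(i < n) (s + i.+1%:R) * gamma1 s.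
Proof.
move=> s0; elim: n => [|n IHn]; first by rewrite addr0 big_ord0 mul1r.
have sn : 0 <= s + n%:R by rewrite addr_ge0.
rewrite -natr1 addrA (gamma1S sn) IHn big_ord_recr/= -natr1.
move: (gamma1 s) (\prod_(i < n) _) => g p; ring.
Qed.

Lemma gamma1_nat n : gamma1 n%:R = n`!%:R.
Proof.
elim: n => [|n IHn]; first by rewrite gamma10 fact0.
by rewrite -natr1 gamma1S// IHn factS natrM natr1.
Qed.

Lemma Rintegral_oy_gt0 (c : R) (f : R -> R) : 0 < c ->
  mu.-integrable H (EFin \o f) -> (forall t, 0 < t -> 0 <= f t) ->
  (forall t, 1 <= t <= 2 -> c <= f t) -> 0 < \int[mu]_(t in H) f t.
Proof.
move=> c0 fi f0 fc; have mH : measurable (H : set (measurableTypeR R)) by exact: measurable_itv.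
have H0 t : H t -> 0 < t by rewrite /H/= in_itv/= andbT.
rewrite lt_neqAle; apply/andP; split; last by apply: Rintegral_ge0 => t /H0; exact: f0.
apply/eqP => /esym g0.
have : (\int[mu]_(t in `[1%R, 2%R]) c%:E <= (\int[mu]_(t in H) f t)%R%:E)%E.
  rewrite /Rintegral fineK; last exact: integrable_fin_num fi.
  apply: (@le_trans _ _ (\int[mu]_(t in `[1%R, 2%R]) (f t)%:E)%E).
    apply: ge0_le_integral => //.
    - by move=> t _; rewrite lee_fin ltW.
    - case/integrableP : fi => + _; apply: measurable_funS => //.
      by move=> t; rewrite /H/= !in_itv/=; lra.
  apply: ge0_subset_integral => //.
  - by case/integrableP : fi.
  - by move=> t /H0 t0; rewrite lee_fin f0.
  - by move=> t; rewrite /H/= !in_itv/=; lra.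
have m12 : (@lebesgue_measure R `[1%R, 2%R]%classic = 1)%E.
  rewrite lebesgue_measure_itv/= lte_fin ltr1n -EFinB; congr EFin; lra.
rewrite g0 integral_cst//.
move=> h; have : (c%:E * 1 <= 0%:E :> \bar R)%E by rewrite -m12; exact: h.
by rewrite mule1 lee_fin leNgt c0.
Qed.

Lemma gamma1_gt0 s : 0 <= s -> 0 < gamma1 s.
Proof.
move=> s0; apply: (@Rintegral_oy_gt0 (expR (- 2))); first exact: expR_gt0.
- exact: integrable_gamma.
- by move=> t _; rewrite mulr_ge0 ?powR_ge0 ?expR_ge0.
move=> t t12; rewrite -[X in X <= _]mul1r ler_pM ?expR_ge0//; last by rewrite ler_expR; lra.
by rewrite -(powRr0 t) ler_powR//; lra.
Qed.

End gamma_integral.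

Section stretched_exponential.
Context {R : realType}.
Implicit Types (s t z : R).
Let mu := @lebesgue_measure R.

(** The integrand is the integral of e^(-t) over t > z y^(1/s). Exchanging the integrals leaves
    e^(-t) times the length (t / z)^s of the section in y; this takes the place of a change of
    variables. *)
Lemma integral_stretched s z : 0 < s -> 0 < z ->
  (\int[mu]_(y in `]0%R, +oo[) (expR (- (z * y `^ s^-1)))%:E = (z `^ (- s) * gamma1 s)%:E)%E.
Proof.
move=> s0 z0.
have sV0 : 0 < s^-1 by rewrite invr_gt0.
pose A := [set p : measurableTypeR R * measurableTypeR R | 0 < p.1 /\ z * p.1 `^ s^-1 < p.2].
have mpow (T : Type) : measurable_fun setT (fun y : R => z * y `^ s^-1).
  by apply: measurable_funM => //; exact: measurable_powR.
have mA : measurable A.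
  rewrite (_ : A = (fun p => 0 < p.1) @^-1` [set true] `&`
    (fun p : R * R => z * p.1 `^ s^-1 < p.2) @^-1` [set true]); last first.
    by apply/seteqP; split => p /=.
  apply: measurableI; rewrite -[X in measurable X]setTI.
    by apply: measurable_fun_ltr => //; exact: measurable_cst.
  apply: measurable_fun_ltr => //.
  by apply: measurable_funM => //; apply: (measurableT_comp (measurable_powR _)).
pose f (p : R * R) : \bar R := (\1_A p * expR (- p.2))%:E.
have mf : measurable_fun setT f.
  apply/measurable_EFinP; apply: measurable_funM; first exact: measurable_indic.
  by apply: measurableT_comp => //; apply: measurableT_comp.
have f0 p : (0 <= f p)%E by rewrite lee_fin mulr_ge0 ?expR_ge0// indicE.
have := @fubini_tonelli _ _ _ _ R mu mu f mf f0.
have -> : (\int[mu]_x \int[mu]_y f (x, y) = \int[mu]_(y in `]0%R, +oo[) (expR (- (z * y `^ s^-1)))%:E)%E.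
  rewrite [RHS]integral_mkcond; apply: eq_integral => y _.
  rewrite patchE; case: ifPn => [|]; last first.
    rewrite notin_setE/= in_itv/= andbT => y0.
    by apply: integral0_eq => t _; rewrite /f indicE memNset ?mul0r// => -[/= ].
  rewrite inE/= in_itv/= andbT => y0.
  rewrite -[LHS](_ : (\int[mu]_(t in `](z * y `^ s^-1)%R, +oo[) (expR (- (1 * t)))%:E = _)%E); last first.
    rewrite integral_mkcond; apply: eq_integral => t _; rewrite patchE /f indicE mul1r.
    case: ifPn; rewrite ?inE ?notin_setE/= in_itv/= andbT => h; first by rewrite mem_set// mul1r.
    by rewrite memNset ?mul0r// => -[].
  rewrite integral_itv_obnd_cbnd.
    by rewrite integral_expR_tail// mul1r divr1.
  apply/measurable_EFinP; apply: measurable_funTS.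
  by apply: measurableT_comp => //; apply: measurableT_comp.
move=> ->.
rewrite EFinM -gamma1_EFin ?ltW// -ge0_integralZl//; last 3 first.
- by case/integrableP: (integrable_gamma (ltW s0)).
- by move=> t _; rewrite lee_fin mulr_ge0 ?expR_ge0 ?powR_ge0.
- by rewrite lee_fin powR_ge0.
rewrite [RHS]integral_mkcond; apply: eq_integral => t _.
rewrite patchE; case: ifPn => [|]; last first.
  rewrite notin_setE/= in_itv/= andbT => /negP; rewrite -leNgt => t0.
  apply: integral0_eq => y _; rewrite /f indicE memNset ?mul0r// => -[/= y0].
  by apply/negP; rewrite -leNgt (le_trans t0)// mulr_ge0 ?powR_ge0// ltW.
rewrite inE/= in_itv/= andbT => t0.
rewrite -[LHS](_ : (\int[mu]_(y in `]0%R, ((t / z) `^ s)%R[) (expR (- t))%:E = _)%E); last first.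
  rewrite integral_mkcond; apply: eq_integral => y _; rewrite patchE /f indicE.
  have E (y0 : 0 < y) : (z * y `^ s^-1 < t) = (y < (t / z) `^ s).
    rewrite mulrC -ltr_pdivlMr//; apply/idP/idP => h.
      have := gt0_ltr_powR s0 _ _ h; rewrite !nnegrE powR_ge0 divr_ge0 ?ltW// => /(_ isT isT).
      by rewrite -powRrM mulVf ?gt_eqF// powRr1// ltW.
    have := gt0_ltr_powR sV0 _ _ h; rewrite !nnegrE powR_ge0 (ltW y0) => /(_ isT isT).
    by rewrite -powRrM divff ?gt_eqF// powRr1// divr_ge0// ltW.
  case: ifPn; rewrite ?inE ?notin_setE/= in_itv/= => h.
    by rewrite mem_set ?mul1r//; case/andP: h => y0 h; split => //=; rewrite E.
  by rewrite memNset ?mul0r// => -[/= y0]; rewrite E// => h'; apply: h; rewrite y0.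
rewrite integral_cst//.
have m1 : @lebesgue_measure R `]0%R, ((t / z) `^ s)%R[%classic = ((t / z) `^ s)%:E.
  by rewrite lebesgue_measure_itv/= lte_fin powR_gt0 ?divr_gt0// -EFinB subr0.
transitivity ((expR (- t))%:E * ((t / z) `^ s)%:E)%E; first by rewrite -m1.
rewrite -!EFinM; congr EFin; rewrite powRM ?invr_ge0 ?ltW// -(powR_inv1 (ltW z0)) -powRrM mulN1r; ring.
Qed.

End stretched_exponential.

Section stable_moments.
Context {R : realType} d (T : measurableType d) (P : probability T R).
Let mu := @lebesgue_measure R.

(** Integrate the Laplace transform at y^(1/s) over y > 0. By [integral_stretched], integrating
    first in y gives Z^(-s) Gamma(s + 1), while integrating first over the space gives the integral
    of e^(- y^(alpha/s)). The product form makes sense before finiteness is known. *)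
Lemma stable_neg_moment (alpha s : R) (Z : {RV P >-> R}) : 0 < alpha -> 0 < s ->
  positive_stable alpha Z ->
  ('E_P[fun w => (Z w `^ (- s))%R] * (gamma1 s)%:E = (gamma1 (s / alpha))%:E)%E.
Proof.
move=> a0 s0 [Zpos hZ].
pose g (p : T * measurableTypeR R) : \bar R :=
  (\1_`]0%R, +oo[ p.2 * expR (- (Z p.1 * p.2 `^ s^-1)))%:E.
have mg : measurable_fun setT g.
  apply/measurable_EFinP; apply: measurable_funM.
    by apply: (measurableT_comp _ measurable_snd); exact: measurable_indic.
  apply: measurableT_comp => //; apply: measurableT_comp => //.
  apply: measurable_funM; first exact: (measurableT_comp _ measurable_fst).
  exact: (measurableT_comp (measurable_powR _) measurable_snd).
have g0 p : (0 <= g p)%E by rewrite lee_fin mulr_ge0 ?expR_ge0// indicE.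
have := @fubini_tonelli _ _ _ _ R P mu g mg g0.
have inner w : 0 < Z w -> (\int[mu]_y g (w, y) = (Z w `^ (- s))%:E * (gamma1 s)%:E)%E.
  move=> Zw; rewrite -EFinM -integral_stretched// [RHS]integral_mkcond.
  apply: eq_integral => y _; rewrite patchE /g indicE/=.
  by case: ifPn => h; rewrite ?mul1r ?mul0r.
have mZ : measurable_fun setT (fun w => (Z w `^ (- s))%:E).
  by apply/measurable_EFinP; exact: (measurableT_comp (measurable_powR _)).
have -> : (\int[P]_w \int[mu]_y g (w, y) = 'E_P[fun w => (Z w `^ (- s))%R] * (gamma1 s)%:E)%E.
  rewrite unlock -ge0_integralZr//; last 2 first.
  - by move=> w _; rewrite lee_fin powR_ge0.
  - by rewrite lee_fin ltW// gamma1_gt0// ltW.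
  apply: ae_eq_integral => //.
  - exact: (@measurable_fun_fubini_tonelli_F _ _ _ _ R mu g mg g0).
  - exact: emeasurable_funM.
  by apply: filterS Zpos => w Zw _; exact: inner.
move=> ->.
have -> : gamma1 (s / alpha) = 1 `^ (- (s / alpha)) * gamma1 (s / alpha) by rewrite powR1 mul1r.
rewrite -integral_stretched ?divr_gt0//.
rewrite [RHS]integral_mkcond; apply: eq_integral => y _; rewrite patchE.
case: ifPn; rewrite ?inE ?notin_setE/= in_itv/= andbT => y0; last first.
  apply: integral0_eq => w _; rewrite /g indicE memNset ?mul0r//=.
  by rewrite in_itv/= andbT.
transitivity ('E_P[fun w => expR (- (y `^ s^-1 * Z w))])%E.
  rewrite unlock; apply: eq_integral => w _; rewrite /g indicE mem_set ?mul1r//=.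
    by rewrite mulrC.
  by rewrite in_itv/= andbT.
rewrite hZ ?powR_ge0// mul1r; congr (expR (- _))%:E.
by rewrite -powRrM invf_div mulrC.
Qed.

(** For s = n alpha / (1 - alpha) one has s / alpha = s + n, so the quotient of the two Gamma values
    is a finite product. *)
Lemma stable_moment (alpha k : R) (Z : {RV P >-> R}) n : 0 < alpha < 1 -> 0 <= k ->
  positive_stable alpha Z ->
  'E_P[fun w => ((k * Z w `^ (- (alpha / (1 - alpha)))) ^+ n)%R]%E =
  (k ^+ n * \prod_(i < n) (n%:R * (alpha / (1 - alpha)) + i.+1%:R))%:E.
Proof.
move=> a01 k0 hZ; case: n => [|n].
  rewrite big_ord0 expr0 mulr1.
  rewrite unlock; under eq_integral do rewrite expr0.
  by have := @expectation_cst _ _ _ P 1; rewrite unlock.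
have p0 : 0 < alpha / (1 - alpha) by rewrite divr_gt0//; lra.
pose s := n.+1%:R * (alpha / (1 - alpha)).
have s0 : 0 < s by rewrite mulr_gt0.
have a0 : 0 < alpha by lra.
have := stable_neg_moment a0 s0 hZ.
have -> : s / alpha = s + n.+1%:R by rewrite /s; field; rewrite !gt_eqF//; lra.
rewrite gamma1D ?ltW// EFinM => h.
have g0 := gamma1_gt0 (ltW s0).
have e1 : 'E_P[fun w => (Z w `^ (- s))%R]%E = (\prod_(i < n.+1) (s + i.+1%:R))%:E.
  move: h; rewrite -EFinM; case: 'E_P[_]%E => [r| |].
  - by rewrite -EFinM => -[] /(mulIf (lt0r_neq0 g0)) ->.
  - by rewrite gt0_mulye ?lte_fin.
  - by rewrite gt0_mulNye ?lte_fin.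
rewrite -/s EFinM -e1 !unlock -ge0_integralZl//; last 3 first.
- by apply/measurable_EFinP; exact: (measurableT_comp (measurable_powR _)).
- by move=> w _; rewrite lee_fin powR_ge0.
- by rewrite lee_fin exprn_ge0.
apply: eq_integral => w _; rewrite -EFinM; congr EFin.
rewrite exprMn; congr (_ * _); rewrite -powR_mulrn ?powR_ge0// -powRrM; congr powR.
by rewrite /s; ring.
Qed.

End stable_moments.

(** * Moments of the exponential of a spectrally negative 1-stable variable *)

Section gaussian_shift.
Context {R : realType}.
Implicit Types (a e x y : R).
Let mu := @lebesgue_measure R.
Let H := `]0%R, +oo[%classic : set R.

Let mH : measurable (H : set (measurableTypeR R)).
Proof. exact: measurable_itv. Qed.

(** Completing the square: (y - (A + 1))^2 >= 0. A Gaussian thus turns any linear exponent into an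
    integrable exponential bound. *)
Lemma gauss_le_exp (A C y : R) : expR (C + A * y - y ^+ 2 / 2) <= expR (C + (A + 1) ^+ 2 / 2) * expR (- (1 * y)).
Proof.
rewrite -expRD ler_expR mul1r; have := sqr_ge0 (y - (A + 1)); nra.
Qed.

Lemma cvg_expRN_pinfty (K : R) : K * expR (- (1 * y)) @[y --> +oo] --> (0 : R).
Proof.
rewrite -[X in _ --> X](mulr0 K); apply: cvgMr.
under eq_fun do rewrite mul1r.
exact: cvgr_expR.
Qed.

Lemma integrable_exp_bound (K : R) (f : R -> R) :
  (forall y, 0 < y -> {for y, continuous f}) ->
  (forall y, 0 < y -> `|f y| <= K * expR (- (1 * y))) ->
  mu.-integrable H (EFin \o f).
Proof.
move=> cf fK.
apply: (@le_integrable _ _ _ _ _ mH _ (EFin \o (fun t => K * expR (- (1 * t))))).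
- apply/measurable_EFinP; apply: open_continuous_measurable_fun => // t.
  by rewrite inE /H/= in_itv/= andbT; exact: cf.
- move=> t; rewrite /H/= in_itv/= andbT => t0.
  by rewrite lee_fin (le_trans (fK _ t0))// ler_norm.
- by apply: integrable_fZl => //; exact: integrable_expR_tail.
Qed.

(* Shift of the contour [x + i y, y > 0] of a holomorphic function with real part f and
   imaginary part F; only one of the Cauchy-Riemann equations is needed. *)
Lemma Rintegral_shift_cst (u v : R) (f g F : R -> R -> R) :
  (forall x y, u < x < v -> 0 < y -> is_derive x (1:R) (f ^~ y) (g x y)) ->
  (forall x y, u < x < v -> 0 < y -> is_derive y (1:R) (F x) (g x y)) ->
  (forall x y, u < x < v -> 0 < y -> {for y, continuous (f x)}) ->
  (forall x y, u < x < v -> 0 < y -> {for y, continuous (g x)}) ->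
  (forall x, u < x < v -> F x y @[y --> 0^'+] --> (0:R)) ->
  (forall x0, u < x0 < v -> exists u' v' K, [/\ u < u', u' < x0 < v', v' < v &
     forall x y, u' < x < v' -> 0 < y ->
       [/\ `|f x y| <= K * expR (- (1 * y)), `|g x y| <= K * expR (- (1 * y)) &
           `|F x y| <= K * expR (- (1 * y))]]) ->
  forall x y, u < x < v -> u < y < v ->
    \int[mu]_(t in H) f x t = \int[mu]_(t in H) f y t.
Proof.
move=> df dF cf cg F0 bd.
apply: (@eq_of_derive0 R u v (fun x => \int[mu]_(t in H) f x t)) => x0 x0uv.
have [u' [v' [K [uu' x0u'v' vv' hK]]]] := bd x0 x0uv.
(* The derivative of the integral in x integrates to the boundary values of F, which vanish at 0 and
   at infinity. *)
have g0 : \int[mu]_(t in H) g x0 t = 0.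
  rewrite [RHS](_ : _ = 0 - 0); last by rewrite subr0.
  apply: (@FTC_oy R _ (F x0)).
  - apply: (@integrable_exp_bound K); first by move=> y y0; exact: cg.
    by move=> y y0; have [] := hK x0 y x0u'v' y0.
  - by move=> y; rewrite in_itv/= andbT => y0; exact: cg.
  - by move=> y; rewrite in_itv/= andbT => y0; exact: dF.
  - exact: F0.
  - apply: (cvg0_of_norm_le _ (cvg_expRN_pinfty K)).
    near=> y; have y0 : 0 < y by near: y; exact: nbhs_pinfty_gt.
    by have [] := hK x0 y x0u'v' y0.
apply: (is_derive_eq _ g0).
apply: (@is_derive_under_Rintegral _ _ _ mu H x0 u' v' f g (fun y => K * expR (- (1 * y)))) => //.
- move=> x xu'v'; apply: (@integrable_exp_bound K).
    by move=> y y0; apply: cf => //; lra.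
  by move=> y y0; have [] := hK x y xu'v' y0.
- by move=> x y xu'v'; rewrite /H/= in_itv/= andbT => y0; apply: df => //; lra.
- by apply: integrable_fZl => //; exact: integrable_expR_tail.
- move=> x y xu'v'; rewrite /H/= in_itv/= andbT => y0.
  by have [] := hK x y xu'v' y0.
Unshelve. all: by end_near. Qed.

(** Half of the Gaussian integral, carried as a symbolic factor and cancelled at the end by
    positivity. *)
Definition gauss_half := \int[mu]_(y in H) expR (- (y ^+ 2 / 2)).

(** The functions f and F are the real and imaginary parts of e^(z^2 / 2) at z = x + i y; the
    contour is moved from abscissa x to abscissa 0. *)
Lemma gauss_fourier x :
  \int[mu]_(y in H) (expR (- (y ^+ 2 / 2)) * cos (x * y)) = expR (- (x ^+ 2 / 2)) * gauss_half.
Proof.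
pose X : R := (`|x| + 1)%R.

have X1 : 1 <= X by rewrite lerDr.
have xX : - X < x < X by have := ler_norm x; have := ler_norm (- x); rewrite normrN /X; lra.
pose f (x y : R) : R := expR ((x ^+ 2 - y ^+ 2) / 2) * cos (x * y).
pose g (x y : R) : R := expR ((x ^+ 2 - y ^+ 2) / 2) * (x * cos (x * y) - y * sin (x * y)).
pose F (x y : R) : R := expR ((x ^+ 2 - y ^+ 2) / 2) * sin (x * y).
have df t y : is_derive t (1:R) (f ^~ y) (g t y) by rewrite /f /g; derive_to; field.
have dF t y : is_derive y (1:R) (F t) (g t y) by rewrite /F /g; derive_to; field.
have cf t y : exists d, is_derive y (1:R) (f t) d by rewrite /f; eexists; der.
have cg t y : exists d, is_derive y (1:R) (g t) d by rewrite /g; eexists; der.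
have shift := @Rintegral_shift_cst (- X) X f g F.
have X0 : - X < 0 < X by lra.
have {shift} h := shift (fun t y _ _ => df t y) (fun t y _ _ => dF t y) _ _ _ _ _ _ xX X0.
have {}h : \int[mu]_(t in H) f x t = \int[mu]_(t in H) f 0 t.
  apply: h.
  - by move=> t y _ _; have [d] := cf t y; exact: is_derive_continuous.
  - by move=> t y _ _; have [d] := cg t y; exact: is_derive_continuous.
  - move=> t _; rewrite [X in _ --> X](_ : _ = F t 0); last by rewrite /F mulr0 sin0 mulr0.
    by apply: cvg_at_right_filter; exact: is_derive_continuous (dF t 0).
  - move=> t tX; exists ((t - X) / 2), ((t + X) / 2).
    pose K := expR (X ^+ 2 / 2 + X + (1 + 1) ^+ 2 / 2).
    exists K; split; [lra|lra|lra|].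
    move=> z y zX y0.
    have z2 : z ^+ 2 <= X ^+ 2 by nra.
    have zX' : `|z| <= X by rewrite ler_norml; lra.
    have bd w : `|w| <= expR (X + y) -> `|expR ((z ^+ 2 - y ^+ 2) / 2) * w| <= K * expR (- (1 * y)).
      move=> hw; rewrite normrM ger0_norm ?expR_ge0//.
      apply: (@le_trans _ _ (expR (X ^+ 2 / 2 - y ^+ 2 / 2) * expR (X + y))).
        by apply: ler_pM; rewrite ?expR_ge0// ler_expR; lra.
      apply: le_trans (gauss_le_exp 1 (X ^+ 2 / 2 + X) y).
      by rewrite -expRD ler_expR; lra.
    have e1 : 1 <= expR (X + y) by rewrite -[X in X <= _]expR0 ler_expR; lra.
    split; apply: bd.
    - by apply: le_trans (cos_max _) _.
    - apply: (@le_trans _ _ (X + y)); last by have := @expR_ge1Dx R (X + y); lra.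
      apply: le_trans (ler_normB _ _) _; rewrite !normrM; apply: lerD.
        by rewrite -[X in _ <= X]mulr1; apply: ler_pM => //; exact: cos_max.
      rewrite (ger0_norm (ltW y0)) -[X in _ <= X]mulr1; apply: ler_pM => //; [exact: ltW|exact: sin_max].
    - by apply: le_trans (sin_max _) _.
have e1 : (fun y => expR (- (y ^+ 2 / 2)) * cos (x * y)) = fun y => expR (- (x ^+ 2 / 2)) * f x y.
  by apply/funext => y; rewrite /f mulrA -expRD; congr (expR _ * _); field.
have e2 : (fun y => expR (- (y ^+ 2 / 2))) = f 0.
  by apply/funext => y; rewrite /f mul0r cos0 mulr1; congr expR; field.
rewrite e1 RintegralZl//; first by rewrite h /gauss_half e2.
apply: (@integrable_exp_bound (expR (x ^+ 2 / 2 + (0 + 1) ^+ 2 / 2))).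
  by move=> y _; have [d] := cf x y; exact: is_derive_continuous.
move=> y y0; apply: le_trans (gauss_le_exp 0 (x ^+ 2 / 2) y).
rewrite normrM ger0_norm ?expR_ge0// -[X in _ <= X]mulr1; apply: ler_pM; rewrite ?expR_ge0 ?cos_max//.
by rewrite ler_expR; lra.
Qed.

(* [stirling_re] and [stirling_im] are the real and imaginary parts of
   (s - a)^2 / (2 e^2) + s log s - s at s = x + i e y. *)
Definition ln_mod x w : R := ln (x ^+ 2 + w ^+ 2) / 2.
Definition stirling_re a e x y : R := (x - a) ^+ 2 / (2 * e ^+ 2) - y ^+ 2 / 2
  + x * ln_mod x (e * y) - e * y * atan (e * y / x) - x.
Definition stirling_im a e x y : R := (x - a) * y / e
  + e * y * ln_mod x (e * y) + x * atan (e * y / x) - e * y.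
Definition stirling_cos a e x y : R := expR (stirling_re a e x y) * cos (stirling_im a e x y).
(** Dividing by e accounts for the scaling s = x + i e y in the Cauchy-Riemann equation, so that the
    y-derivative equals the x-derivative of [stirling_cos]. *)
Definition stirling_sin a e x y : R := expR (stirling_re a e x y) * sin (stirling_im a e x y) / e.
Definition stirling_dcos a e x y : R := expR (stirling_re a e x y) *
  (((x - a) / e ^+ 2 + ln_mod x (e * y)) * cos (stirling_im a e x y)
   - (y / e + atan (e * y / x)) * sin (stirling_im a e x y)).

Lemma sqrD_gt0 x w : 0 < x -> 0 < x ^+ 2 + w ^+ 2.
Proof. by move=> x0; rewrite ltr_wpDr ?sqr_ge0// exprn_gt0. Qed.

Lemma is_derive_stirling_x a e x y : 0 < e -> 0 < x ->
  is_derive x (1:R) (fun x => stirling_cos a e x y) (stirling_dcos a e x y).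
Proof.
move=> e0 x0; have h := sqrD_gt0 (e * y) x0.
have dre : is_derive x (1:R) (fun x => stirling_re a e x y) ((x - a) / e ^+ 2 + ln_mod x (e * y)).
  rewrite /stirling_re /ln_mod; derive_to => //; first by rewrite gt_eqF.
  move: h; set L := ln _ => h; field.
  by rewrite !gt_eqF.
have dim : is_derive x (1:R) (fun x => stirling_im a e x y) (y / e + atan (e * y / x)).
  rewrite /stirling_im /ln_mod; derive_to => //; first by rewrite gt_eqF.
  by field; rewrite !gt_eqF.
by rewrite /stirling_cos /stirling_dcos; derive_to; ring.
Qed.

Lemma is_derive_stirling_re_y a e x y : 0 < e -> 0 < x ->
  is_derive y (1:R) (stirling_re a e x) (- y - e * atan (e * y / x)).
Proof.
move=> e0 x0; have h := sqrD_gt0 (e * y) x0.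
rewrite /stirling_re /ln_mod; derive_to => //.
by field; rewrite !gt_eqF.
Qed.

Lemma is_derive_stirling_im_y a e x y : 0 < e -> 0 < x ->
  is_derive y (1:R) (stirling_im a e x) ((x - a) / e + e * ln_mod x (e * y)).
Proof.
move=> e0 x0; have h := sqrD_gt0 (e * y) x0.
rewrite /stirling_im /ln_mod; derive_to => //.
by field; rewrite !gt_eqF.
Qed.

Lemma is_derive_stirling_y a e x y : 0 < e -> 0 < x ->
  is_derive y (1:R) (stirling_sin a e x) (stirling_dcos a e x y).
Proof.
move=> e0 x0; have dre := is_derive_stirling_re_y a y e0 x0.
have dim := is_derive_stirling_im_y a y e0 x0.
rewrite /stirling_sin /stirling_dcos; derive_to.
by field; rewrite !gt_eqF.
Qed.

Lemma continuous_stirling_cos a e x y : 0 < e -> 0 < x -> {for y, continuous (stirling_cos a e x)}.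
Proof.
move=> e0 x0; have dre := is_derive_stirling_re_y a y e0 x0.
have dim := is_derive_stirling_im_y a y e0 x0.
suff [d hd] : exists d, is_derive y (1:R) (stirling_cos a e x) d by exact: is_derive_continuous hd.
by rewrite /stirling_cos; eexists; der.
Qed.

Lemma continuous_stirling_dcos a e x y : 0 < e -> 0 < x -> {for y, continuous (stirling_dcos a e x)}.
Proof.
move=> e0 x0; have dre := is_derive_stirling_re_y a y e0 x0.
have dim := is_derive_stirling_im_y a y e0 x0; have h := sqrD_gt0 (e * y) x0.
suff [d hd] : exists d, is_derive y (1:R) (stirling_dcos a e x) d by exact: is_derive_continuous hd.
by rewrite /stirling_dcos /ln_mod; eexists; der.
Qed.

Lemma ln_mod_le x w : 0 < x -> 0 <= w -> ln_mod x w <= x + w.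
Proof.
move=> x0 w0; have h := sqrD_gt0 w x0; have xw : 0 < x + w by lra.
rewrite /ln_mod ler_pdivrMr//; apply: (@le_trans _ _ (ln ((x + w) ^+ 2))).
  by rewrite ler_ln ?posrE ?exprn_gt0//; nra.
by rewrite lnXn// mulr2n; have := ln_sublinear xw; lra.
Qed.

Lemma ln_mod_ge x1 x w : 0 < x1 -> x1 <= x -> ln x1 <= ln_mod x w.
Proof.
move=> x0 x1x; have xx : 0 < x by lra.
have h := sqrD_gt0 w xx.
rewrite /ln_mod ler_pdivlMr// mulr_natr -lnXn// ler_ln ?posrE ?exprn_gt0//.
by have := sqr_ge0 w; nra.
Qed.

Lemma atan_bound x : 0 <= x -> 0 <= atan x <= pi / 2.
Proof. by move=> x0; rewrite -[X in X <= _]atan0 le_atan//= ltW// atan_ltpi2. Qed.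

(** The arctangent enters with a favourable sign and ln |s| is at most x + e y, so the Gaussian term
    wins. *)
Lemma stirling_re_le a e x y : 0 < e -> 0 < a -> 0 < x <= a + 1 -> 0 <= y ->
  stirling_re a e x y <= (x - a) ^+ 2 / (2 * e ^+ 2) + (a + 1) ^+ 2 + (a + 1) * e * y - y ^+ 2 / 2.
Proof.
move=> e0 a0 xa y0.
have ey : 0 <= e * y by rewrite mulr_ge0// ltW.
have x0 : 0 < x by lra.
have h1 := ln_mod_le x0 ey.
have h2 : x * ln_mod x (e * y) <= (a + 1) * ((a + 1) + e * y).
  apply: (@le_trans _ _ (x * (x + e * y))); first by rewrite ler_pM2l.
  by apply: ler_pM; lra.
have at0 : 0 <= e * y * atan (e * y / x).
  by rewrite mulr_ge0//; have /andP[] := atan_bound (divr_ge0 ey (ltW x0)).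
rewrite /stirling_re; nra.
Qed.

Lemma Rintegral_stirling_cst a e x : 0 < e -> 0 < a -> 0 < x < a + 1 ->
  \int[mu]_(y in H) stirling_cos a e x y = \int[mu]_(y in H) stirling_cos a e a y.
Proof.
move=> e0 a0 xa.
have shift := @Rintegral_shift_cst 0 (a + 1) (stirling_cos a e) (stirling_dcos a e) (stirling_sin a e).
have aa : 0 < a < a + 1 by lra.
have df : forall x y, 0 < x < a + 1 -> 0 < y -> is_derive x (1:R) ((stirling_cos a e) ^~ y) (stirling_dcos a e x y).
  by move=> z y z0 _; apply: is_derive_stirling_x; lra.
have dF : forall x y, 0 < x < a + 1 -> 0 < y -> is_derive y (1:R) (stirling_sin a e x) (stirling_dcos a e x y).
  by move=> z y z0 _; apply: is_derive_stirling_y; lra.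
have {shift} h := shift df dF _ _ _ _ _ _ xa aa.
apply: h.
- by move=> z y z0 y0; apply: continuous_stirling_cos; lra.
- by move=> z y z0 y0; apply: continuous_stirling_dcos; lra.
- move=> z z0; have z0' : 0 < z by lra.
  rewrite [X in _ --> X](_ : _ = stirling_sin a e z 0); last first.
    rewrite /stirling_sin (_ : stirling_im a e z 0 = 0) ?sin0 ?mulr0 ?mul0r//.
    by rewrite /stirling_im !mulr0 !mul0r atan0 !mulr0; ring.
  by apply: cvg_at_right_filter; exact: is_derive_continuous (is_derive_stirling_y a 0 e0 z0').
(* Staying above x0 / 2 bounds from below the logarithm in [stirling_dcos]. The constants C1 and C2
   control [stirling_re], C3 and C4 the factor in front of the exponential, of linear growth in
   y. *)
move=> x0 x0a; exists (x0 / 2), ((x0 + a + 1) / 2).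
pose C1 := (a + 1) ^+ 2 / (2 * e ^+ 2) + (a + 1) ^+ 2.
pose C2 := (a + 1) * e.
pose C3 := (a + 1) / e ^+ 2 + (`|ln (x0 / 2)| + (a + 1)) + pi / 2 + 1 + e^-1.
pose C4 := e + e^-1.
pose K := expR (C1 + C3 + (C2 + C4 + 1) ^+ 2 / 2).
have ei : 0 < e^-1 by rewrite invr_gt0.
have C30 : 0 <= C3.
  rewrite /C3 !addr_ge0 ?divr_ge0 ?pi_ge0 ?sqr_ge0 ?invr_ge0 ?normr_ge0//; lra.
exists K; split; [lra|lra|lra|].
move=> z y z0 y0.
have z0' : 0 < z by lra.
have ey : 0 <= e * y by rewrite mulr_ge0// ltW.
have bd w : `|w| <= expR (C3 + C4 * y) -> `|expR (stirling_re a e z y) * w| <= K * expR (- (1 * y)).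
  move=> hw; rewrite normrM ger0_norm ?expR_ge0//.
  apply: (@le_trans _ _ (expR (C1 + C2 * y - y ^+ 2 / 2) * expR (C3 + C4 * y))).
    apply: ler_pM; rewrite ?expR_ge0// ler_expR.
    have hz : 0 < z <= a + 1 by lra.
    apply: le_trans (stirling_re_le e0 a0 hz (ltW y0)) _.
    rewrite /C1 /C2 lerD2r lerD2r lerD2r ler_pM2r ?invr_gt0 ?mulr_gt0 ?exprn_gt0//.
    by nra.
  apply: le_trans (gauss_le_exp (C2 + C4) (C1 + C3) y).
  by rewrite -expRD ler_expR; lra.
have C4y : 0 <= C4 * y by rewrite mulr_ge0 ?addr_ge0// ltW.
have e1 : 1 + C3 + C4 * y <= expR (C3 + C4 * y) by have := @expR_ge1Dx R (C3 + C4 * y); lra.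
have at0 := atan_bound (divr_ge0 ey (ltW z0')).
split.
- by apply: bd; apply: le_trans (cos_max _) _; lra.
- apply: bd; apply: le_trans e1.
  apply: le_trans (ler_normB _ _) _; rewrite !normrM.
  have l1 : `|(z - a) / e ^+ 2 + ln_mod z (e * y)| <= (a + 1) / e ^+ 2 + (`|ln (x0 / 2)| + (a + 1) + e * y).
    apply: le_trans (ler_normD _ _) _; apply: lerD.
      rewrite normrM (ger0_norm (x := (e ^+ 2)^-1)) ?invr_ge0 ?sqr_ge0// ler_pM2r ?invr_gt0 ?exprn_gt0//.
      by rewrite ler_norml; lra.
    have u1 := ln_mod_le z0' ey.
    have u2 : ln (x0 / 2) <= ln_mod z (e * y) by apply: ln_mod_ge; lra.
    have := ler_norm (- ln (x0 / 2)); rewrite normrN => u3.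
    by have := normr_ge0 (ln (x0 / 2)); rewrite ler_norml; lra.
  have l2 : `|y / e + atan (e * y / z)| <= e^-1 * y + pi / 2.
    have ye : 0 <= y / e by rewrite divr_ge0// ltW.
    by rewrite ger0_norm; lra.
  have s1 := ler_pM (normr_ge0 _) (normr_ge0 _) l1 (cos_max (stirling_im a e z y)).
  have s2 := ler_pM (normr_ge0 _) (normr_ge0 _) l2 (sin_max (stirling_im a e z y)).
  rewrite /C3 /C4; lra.
- rewrite /stirling_sin -mulrA; apply: bd; apply: le_trans e1.
  rewrite normrM (ger0_norm (x := e^-1)) ?(ltW ei)//.
  have := ler_wpM2r (ltW ei) (sin_max (stirling_im a e z y)).
  have : e^-1 <= C3.
    rewrite /C3 lerDr !addr_ge0 ?divr_ge0 ?pi_ge0 ?sqr_ge0 ?normr_ge0//; lra.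
  lra.
Qed.

End gaussian_shift.

(** * From the characteristic function to the exponential moments of X *)

Section one_stable_mellin.
Context {R : realType}.
Implicit Types (a e x y : R).
Let mu := @lebesgue_measure R.
Let H := `]0%R, +oo[%classic : set R.

Let mH : measurable (H : set (measurableTypeR R)).
Proof. exact: measurable_itv. Qed.

Let H0 y : H y -> 0 < y. Proof. by rewrite /H/= in_itv/= andbT. Qed.

(** Boundary value of [stirling_cos] on the imaginary axis, where the argument of s is pi / 2. The
    terms in e y form the characteristic function at e y; the others come from the Gaussian centred
    at a. *)
Definition stirling_edge a e y : R := expR (a ^+ 2 / (2 * e ^+ 2) - y ^+ 2 / 2 - e * y * (pi / 2)) *
  cos (- a * y / e + e * y * ln (e * y) - e * y).

Lemma ln_mod0 y : 0 < y -> ln (0 ^+ 2 + y ^+ 2) / 2 = ln y.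
Proof. by move=> y0; rewrite expr0n add0r lnXn// mulr2n; field. Qed.

Lemma cvg_ln_mod (x_ w_ : nat -> R) x w : 0 < x ^+ 2 + w ^+ 2 ->
  x_ n @[n --> \oo] --> x -> w_ n @[n --> \oo] --> w ->
  ln_mod (x_ n) (w_ n) @[n --> \oo] --> ln (x ^+ 2 + w ^+ 2) / 2.
Proof.
move=> xw cx cw; rewrite /ln_mod; apply: cvgMl; apply: continuous_cvg; first exact: continuous_ln.
by apply: cvgD; [apply: cvgM|apply: cvgM].
Qed.

Lemma cvg_stirling_edge a e y : 0 < a -> 0 < e -> 0 < y ->
  stirling_cos a e (a / n.+2%:R) y @[n --> \oo] --> stirling_edge a e y.
Proof.
move=> a0 e0 y0; have ey : 0 < e * y by rewrite mulr_gt0.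
have cx : a / n.+2%:R @[n --> \oo] --> (0 : R).
  by rewrite -[X in _ --> X](mulr0 a); apply: cvgMr; exact: cvg_invS.
have cl : ln_mod (a / n.+2%:R) (e * y) @[n --> \oo] --> ln (e * y).
  rewrite -(ln_mod0 ey); apply: cvg_ln_mod => //; last exact: cvg_cst.
  by rewrite expr0n add0r exprn_gt0.
have cat : atan (e * y / (a / n.+2%:R)) @[n --> \oo] --> (pi / 2 : R).
  apply: (cvg_comp (fun n => e * y / (a / n.+2%:R)) (@atan R)); last exact: cvgy_atan.
  apply/cvgryPge => A; near=> n.
  have -> : e * y / (a / n.+2%:R) = e * y / a * n.+2%:R.
    by rewrite invf_div mulrCA mulrC -!mulrA [_^-1 * _]mulrC.
  rewrite -ler_pdivrMl ?divr_gt0//; apply: (@le_trans _ _ n%:R); last by rewrite ler_nat leqW.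
  by near: n; exact: nbhs_infty_ger.
have cxa : a / n.+2%:R - a @[n --> \oo] --> - a.
  by rewrite -[X in _ --> X]add0r; apply: cvgB => //; exact: cvg_cst.
rewrite /stirling_cos /stirling_edge; apply: cvgM.
  apply: continuous_cvg; first exact: continuous_expR.
  rewrite /stirling_re [X in _ --> X](_ : _ = (- a) * (- a) / (2 * e ^+ 2) - y ^+ 2 / 2 + 0 * ln (e * y) - e * y * (pi / 2) - 0); last first.
    by rewrite mulrNN -expr2; ring.
  apply: cvgB => //; apply: cvgB; last exact: cvgMr.
  apply: cvgD; last exact: cvgM.
  apply: cvgB; last exact: cvg_cst.
  by apply: cvgMl; apply: cvgM.
apply: continuous_cvg; first exact: continuous_cos.
rewrite /stirling_im [X in _ --> X](_ : _ = (- a) * y / e + e * y * ln (e * y) + 0 * (pi / 2) - e * y); last by ring.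
apply: cvgB; last exact: cvg_cst.
apply: cvgD; last exact: cvgM.
by apply: cvgD; [apply: cvgMl; exact: cvgMl|exact: cvgMr].
Unshelve. all: by end_near. Qed.

Lemma stirling_cos_bound a e x y : 0 < e -> 0 < a -> 0 < x <= a + 1 -> 0 < y ->
  `|stirling_cos a e x y| <= expR ((x - a) ^+ 2 / (2 * e ^+ 2) + (a + 1) ^+ 2 + ((a + 1) * e + 1) ^+ 2 / 2) * expR (- (1 * y)).
Proof.
move=> e0 a0 xa y0; apply: le_trans (gauss_le_exp _ _ _).
rewrite normrM ger0_norm ?expR_ge0// -[X in _ <= X]mulr1; apply: ler_pM; rewrite ?expR_ge0 ?cos_max//.
by rewrite ler_expR; apply: le_trans (stirling_re_le e0 a0 xa (ltW y0)) _.
Qed.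

(** The integral is the same on all the lines x = a / (n + 2); dominated convergence carries it to
    the axis x = 0, where the logarithm is singular at the origin. *)
Lemma Rintegral_stirling_edge a e : 0 < a -> 0 < e ->
  mu.-integrable H (EFin \o stirling_edge a e) /\
  \int[mu]_(y in H) stirling_edge a e y = \int[mu]_(y in H) stirling_cos a e a y.
Proof.
move=> a0 e0.
have xa n : 0 < a / n.+2%:R < a + 1.
  apply/andP; split; first by rewrite divr_gt0.
  apply: (@le_lt_trans _ _ a); last by lra.
  by rewrite ler_pdivrMr// ler_peMr ?(ltW a0)// ler1n.
pose K := expR ((a + 1) ^+ 2 / (2 * e ^+ 2) + (a + 1) ^+ 2 + ((a + 1) * e + 1) ^+ 2 / 2).
have e20 : 0 < 2 * e ^+ 2 by rewrite mulr_gt0// exprn_gt0.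
have bd n y : 0 < y -> `|stirling_cos a e (a / n.+2%:R) y| <= K * expR (- (1 * y)).
  move: (a / n.+2%:R) (xa n) => z h y0.
  apply: le_trans (stirling_cos_bound e0 a0 _ y0) _; first by lra.
  rewrite ler_pM2r ?expR_gt0// ler_expR lerD2r lerD2r ler_pM2r ?invr_gt0//.
  by nra.
have cf n y : 0 < y -> {for y, continuous (stirling_cos a e (a / n.+2%:R))}.
  by move=> y0; apply: continuous_stirling_cos => //; have /andP[] := xa n.
have ii n : mu.-integrable H (EFin \o stirling_cos a e (a / n.+2%:R)).
  by apply: (@integrable_exp_bound R K); [exact: cf|exact: bd].
have [||||i0 h] := @cvg_dominated_Rintegral R _ _ mu H (fun n => stirling_cos a e (a / n.+2%:R))
   (stirling_edge a e) (fun y => K * expR (- (1 * y))) mH.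
- by move=> n; case/integrableP : (ii n) => /measurable_EFinP.
- by move=> y /H0 y0; exact: cvg_stirling_edge.
- by apply: integrable_fZl => //; exact: integrable_expR_tail.
- by move=> n y /H0 y0; exact: bd.
split=> //; apply: (cvg_unique _ h) => //.
by apply: cvg_near_cst; apply: nearW => n; exact: Rintegral_stirling_cst.
Qed.

(** On the line x = a the term (x - a)^2 / (2 e^2), singular in e, disappears. As e tends to 0 only
    the Gaussian and the value of s log s - s at a remain. *)
Lemma cvg_stirling_main a : 0 < a ->
  \int[mu]_(y in H) stirling_cos a n.+1%:R^-1 a y @[n --> \oo] --> gauss_half * expR (a * ln a - a).
Proof.
move=> a0.
pose K := expR ((a + 1) ^+ 2 + ((a + 1) + 1) ^+ 2 / 2).
have e0 n : 0 < n.+1%:R^-1 :> R by rewrite invr_gt0.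
have e1 n : n.+1%:R^-1 <= 1 :> R by rewrite invf_le1// ler1n.
have bd n y : 0 < y -> `|stirling_cos a n.+1%:R^-1 a y| <= K * expR (- (1 * y)).
  move=> y0; have aa : 0 < a <= a + 1 by lra.
  apply: le_trans (stirling_cos_bound (e0 n) a0 aa y0) _.
  rewrite ler_pM2r ?expR_gt0// ler_expR subrr expr0n mul0r add0r lerD2l ler_pM2r ?invr_gt0//.
  have := e0 n; have := e1 n; move: (n.+1%:R^-1) => z z1 z0.
  by rewrite lerXn2r ?nnegrE//; nra.
have ii n : mu.-integrable H (EFin \o stirling_cos a n.+1%:R^-1 a).
  apply: (@integrable_exp_bound R K); last exact: bd.
  by move=> y y0; exact: continuous_stirling_cos.
have [||||_] := @cvg_dominated_Rintegral R _ _ mu H (fun n => stirling_cos a n.+1%:R^-1 a)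
   (fun y => expR (a * ln a - a) * expR (- (y ^+ 2 / 2))) (fun y => K * expR (- (1 * y))) mH.
- by move=> n; case/integrableP : (ii n) => /measurable_EFinP.
- move=> y /H0 y0.
  have ce : n.+1%:R^-1 * y @[n --> \oo] --> (0 : R).
    by rewrite -[X in _ --> X](mul0r y); apply: cvgMl; exact: cvg_harmonic.
  have cl : ln_mod a (n.+1%:R^-1 * y) @[n --> \oo] --> ln a.
    rewrite [X in _ --> X](_ : _ = ln (a ^+ 2 + 0 ^+ 2) / 2); last first.
      by rewrite expr0n addr0 lnXn// mulr2n; field.
    apply: cvg_ln_mod => //; last exact: cvg_cst.
    by rewrite expr0n addr0 exprn_gt0.
  have cat : atan (n.+1%:R^-1 * y / a) @[n --> \oo] --> (0 : R).
    rewrite -[X in _ --> X]atan0; apply: continuous_cvg; first exact: continuous_atan.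
    by rewrite -[X in _ --> X](mul0r a^-1); exact: cvgMl.
  rewrite /stirling_cos [X in _ --> X](_ : _ = expR (- (y ^+ 2 / 2) + a * ln a - 0 * 0 - a) * cos (0 * ln a + a * 0 - 0)); last first.
    have -> : 0 * ln a + a * 0 - 0 = 0 :> R by ring.
    by rewrite cos0 mulr1 -expRD; congr expR; ring.
  apply: cvgM.
    apply: continuous_cvg; first exact: continuous_expR.
    rewrite /stirling_re; under eq_fun do rewrite subrr expr0n mul0r add0r.
    apply: cvgB; last exact: cvg_cst.
    apply: cvgB; last exact: cvgM.
    apply: cvgD; first exact: cvg_cst.
    exact: cvgMr.
  apply: continuous_cvg; first exact: continuous_cos.
  rewrite /stirling_im; under eq_fun do rewrite subrr !mul0r add0r.
  by apply: cvgB => //; apply: cvgD; [exact: cvgM|exact: cvgMr].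
- by apply: integrable_fZl => //; exact: integrable_expR_tail.
- by move=> n y /H0 y0; exact: bd.
rewrite RintegralZl//; first by rewrite mulrC.
apply: (@integrable_exp_bound R (expR (0 + (0 + 1) ^+ 2 / 2))).
  move=> y _; suff [d hd] : exists d, is_derive y (1:R) (fun y => expR (- (y ^+ 2 / 2))) d.
    exact: is_derive_continuous hd.
  by eexists; der.
move=> y y0; apply: le_trans (gauss_le_exp 0 0 y).
by rewrite ger0_norm ?expR_ge0// ler_expR; lra.
Qed.

Lemma integrable_gauss : mu.-integrable H (EFin \o (fun y => expR (- (y ^+ 2 / 2)))).
Proof.
apply: (@integrable_exp_bound R (expR (0 + (0 + 1) ^+ 2 / 2))).
  move=> y _; suff [d hd] : exists d, is_derive y (1:R) (fun y => expR (- (y ^+ 2 / 2))) d.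
    exact: is_derive_continuous hd.
  by eexists; der.
move=> y y0; apply: le_trans (gauss_le_exp 0 0 y).
by rewrite ger0_norm ?expR_ge0// ler_expR; lra.
Qed.

Lemma gauss_half_gt0 : 0 < gauss_half :> R.
Proof.
apply: (@Rintegral_oy_gt0 R (expR (- 2))); first exact: expR_gt0.
- exact: integrable_gauss.
- by move=> t _; exact: expR_ge0.
- by move=> t t12; rewrite ler_expR; nra.
Qed.

Lemma integrable_gauss_cos x : mu.-integrable H (EFin \o (fun y => expR (- (y ^+ 2 / 2)) * cos (x * y))).
Proof.
apply: (@integrable_exp_bound R (expR (0 + (0 + 1) ^+ 2 / 2))).
  move=> y _; suff [d hd] : exists d, is_derive y (1:R) (fun y => expR (- (y ^+ 2 / 2)) * cos (x * y)) d.
    exact: is_derive_continuous hd.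
  by eexists; der.
move=> y y0; apply: le_trans (gauss_le_exp 0 0 y).
rewrite normrM ger0_norm ?expR_ge0// -[X in _ <= X]mulr1; apply: ler_pM; rewrite ?expR_ge0 ?cos_max//.
by rewrite ler_expR; lra.
Qed.

Section with_variable.
Context d (T : measurableType d) (P : probability T R).
Variable X : {RV P >-> R}.

Lemma integrable_bounded_RV (f : R -> R) (C : R) : measurable_fun setT f -> (forall x, `|f x| <= C) ->
  P.-integrable setT (EFin \o (fun w => f (X w))).
Proof.
move=> mf fC; apply: measurable_bounded_integrable => //.
- by rewrite (le_lt_trans (probability_le1 _ _))// ltry.
- exact: (measurableT_comp mf).
- exists C; split; first exact: num_real.
  by move=> r Cr w _; exact: le_trans (fC _) (ltW Cr).
Qed.

(* The moment is tempered by a Gaussian factor, written as a Fourier transform; Fubini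
   then brings in the characteristic function, that is, the function exp(s log s - s)
   on the imaginary axis.  The contour is shifted to the real part a before e tends
   to 0. *)
Lemma gauss_char_fun (a e : R) : 0 < a -> 0 < e -> one_stable X ->
  (\int[P]_w (expR (a * X w - (e * X w) ^+ 2 / 2) * gauss_half)%:E =
   (\int[mu]_(y in H) stirling_edge a e y)%R%:E)%E.
Proof.
move=> a0 e0 hX.
(* Completing the square: a X - (e X)^2 / 2 = a^2 / (2 e^2) - (e (X - m))^2 / 2, and [gauss_fourier]
   applies to e (X - m). *)
pose m := a / e ^+ 2.
pose c := expR (a ^+ 2 / (2 * e ^+ 2)).
have c0 : 0 <= c by exact: expR_ge0.
pose f (p : T * measurableTypeR R) : \bar R :=
  (\1_H p.2 * (c * (expR (- (p.2 ^+ 2 / 2)) * cos (e * (X p.1 - m) * p.2))))%:E.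
have mf : measurable_fun setT f.
  apply/measurable_EFinP; apply: measurable_funM.
    by apply: (measurableT_comp _ measurable_snd); exact: measurable_indic.
  apply: measurable_funM => //; apply: measurable_funM.
    apply: measurableT_comp => //; apply: measurableT_comp => //.
    by apply: measurable_funM => //; apply: (measurableT_comp (exprn_measurable _) measurable_snd).
  apply: (measurableT_comp (continuous_measurable_fun (@continuous_cos R))).
  apply: measurable_funM; last exact: measurable_snd.
  apply: measurable_funM => //; apply: measurable_funB => //.
  exact: (measurableT_comp _ measurable_fst).
(* The cosine changes sign, so the exchange needs absolute integrability, which the Gaussian
   provides. *)
have fi : (P \x mu)%E.-integrable setT f.
  apply/integrable12ltyP => //.
  apply: (@le_lt_trans _ _ (\int[P]_w (c * gauss_half)%:E)%E); last first.
    have := @expectation_cst _ _ _ P (c * gauss_half); rewrite unlock => ->; by rewrite ltry.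
  apply: ge0_le_integral => //.
  - by move=> w _; apply: integral_ge0 => y _; exact: abse_ge0.
  - by apply: (@measurable_fun_fubini_tonelli_F _ _ _ _ R mu (fun p => `|f p|%E)) => //; exact: measurableT_comp.
  move=> w _.
  have -> : ((c * gauss_half)%:E = \int[mu]_(y in H) (c * expR (- (y ^+ 2 / 2)))%:E)%E.
    rewrite /gauss_half -RintegralZl//; last exact: integrable_gauss.
    rewrite /Rintegral fineK//; apply: integrable_fin_num => //.
    by apply: integrable_fZl => //; exact: integrable_gauss.
  rewrite [X in (_ <= X)%E]integral_mkcond; apply: ge0_le_integral => //.
  - apply: measurableT_comp => //; exact: (measurableT_comp mf (measurable_pair1 w)).
  - apply/(measurable_restrict _ _ _) => //.
    have := integrable_fZl mH c integrable_gauss.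
    by rewrite setTI; case/integrableP.
  move=> y _; rewrite patchE /f indicE/=; case: ifPn => yH; last by rewrite mul0r normr0.
  rewrite mul1r lee_fin !normrM (ger0_norm c0) ger0_norm ?expR_ge0//.
  by rewrite ler_wpM2l// ler_piMr ?expR_ge0// cos_max.
have := Fubini fi.
have -> : (\int[P]_w \int[mu]_y f (w, y) = \int[P]_w (expR (a * X w - (e * X w) ^+ 2 / 2) * gauss_half)%:E)%E.
  apply: eq_integral => w _.
  rewrite (_ : (fun y => f (w, y)) = (fun y => (c * (expR (- (y ^+ 2 / 2)) * cos (e * (X w - m) * y)))%:E) \_ H); last first.
    by apply/funext => y; rewrite patchE /f indicE/=; case: ifPn => _; rewrite ?mul1r ?mul0r.
  rewrite -integral_mkcond.
  have ig := integrable_gauss_cos (e * (X w - m)).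
  have -> : (\int[mu]_(y in H) (c * (expR (- (y ^+ 2 / 2)) * cos (e * (X w - m) * y)))%:E =
      (\int[mu]_(y in H) (c * (expR (- (y ^+ 2 / 2)) * cos (e * (X w - m) * y))))%R%:E)%E.
    by rewrite /Rintegral fineK//; apply: integrable_fin_num => //; exact: integrable_fZl.
  rewrite RintegralZl// gauss_fourier mulrA -expRD; congr (expR _ * _)%:E.
  by rewrite /m; field; rewrite gt_eqF.
move=> ->.
have -> : ((\int[mu]_(y in H) stirling_edge a e y)%R%:E = \int[mu]_(y in H) (stirling_edge a e y)%:E)%E.
  by rewrite /Rintegral fineK//; apply: integrable_fin_num => //; have [] := Rintegral_stirling_edge a0 e0.
rewrite [RHS]integral_mkcond; apply: eq_integral => y _.
rewrite patchE; case: ifPn => yH; last first.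
  by apply: integral0_eq => w _; rewrite /f indicE (negbTE yH) mul0r.
have y0 : 0 < y by apply: H0; rewrite inE in yH.
have ey : 0 < e * y by rewrite mulr_gt0.
have := hX (e * y); rewrite /char_fun /complex_exp (gtr0_norm ey) => -[hc hs].
have ic := integrable_bounded_RV (f := fun x => cos (e * y * x)) (C := 1) _ (fun x => cos_max _).
have is_ := integrable_bounded_RV (f := fun x => sin (e * y * x)) (C := 1) _ (fun x => sin_max _).
have mcos : measurable_fun setT (fun x : R => cos (e * y * x)).
  by apply: (measurableT_comp (continuous_measurable_fun (@continuous_cos R))); exact: measurable_funM.
have msin : measurable_fun setT (fun x : R => sin (e * y * x)).
  by apply: (measurableT_comp (continuous_measurable_fun (@continuous_sin R))); exact: measurable_funM.
have {}ic := ic mcos. have {}is_ := is_ msin.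
have {}hc : \int[P]_w cos (e * y * X w) = expR (- (pi * (e * y) / 2)) * cos (e * y * (ln (e * y) - 1)).
  by rewrite -hc [in RHS]unlock.
have {}hs : \int[P]_w sin (e * y * X w) = expR (- (pi * (e * y) / 2)) * sin (e * y * (ln (e * y) - 1)).
  by rewrite -hs [in RHS]unlock.
have mT : measurable (setT : set T) by [].
have ef : (fun w => f (w, y)) = EFin \o (fun w => c * expR (- (y ^+ 2 / 2)) * (cos (e * y * m) * cos (e * y * X w) + sin (e * y * m) * sin (e * y * X w))).
  apply/funext => w; rewrite /f indicE yH mul1r/= mulrA; congr (_ * _)%:E.
  rewrite (_ : e * (X w - m) * y = e * y * X w - e * y * m); last by ring.
  by rewrite cosB; ring.
have iZ : P.-integrable setT (EFin \o (fun w => (cos (e * y * m) * cos (e * y * X w) + sin (e * y * m) * sin (e * y * X w)))).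
  by apply: integrable_fD => //; exact: integrable_fZl.
transitivity ((\int[P]_w (c * expR (- (y ^+ 2 / 2)) * (cos (e * y * m) * cos (e * y * X w) + sin (e * y * m) * sin (e * y * X w))))%R%:E).
  rewrite ef /Rintegral fineK//; apply: integrable_fin_num => //.
  exact: integrable_fZl.
rewrite RintegralZl// RintegralD//; try exact: integrable_fZl.
rewrite !RintegralZl// hc hs; congr EFin.
rewrite /stirling_edge (_ : - a * y / e + e * y * ln (e * y) - e * y = e * y * (ln (e * y) - 1) - e * y * m); last first.
  by rewrite /m; field; rewrite gt_eqF.
rewrite cosB (_ : expR (a ^+ 2 / (2 * e ^+ 2) - y ^+ 2 / 2 - e * y * (pi / 2)) = c * expR (- (y ^+ 2 / 2)) * expR (- (pi * (e * y) / 2))); last first.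
  by rewrite /c -!expRD; congr expR; ring.
ring.
Qed.

(** The tempered integrands increase as e = 1 / (n + 1) decreases. Monotone convergence therefore
    applies, and finiteness of the moment comes out of the limit. *)
Lemma one_stable_moment (a : R) : 0 < a -> one_stable X ->
  'E_P[fun w => expR (a * X w)]%E = (expR (a * ln a - a))%:E.
Proof.
move=> a0 hX; rewrite unlock.
have g0 := gauss_half_gt0.
have e0 n : 0 < n.+1%:R^-1 :> R by rewrite invr_gt0.
pose g n (w : T) : \bar R := (expR (a * X w - (n.+1%:R^-1 * X w) ^+ 2 / 2) * gauss_half)%:E.
have mX : measurable_fun setT X by [].
have mg n : measurable_fun setT (g n).
  apply/measurable_EFinP; apply: measurable_funM => //; apply: measurableT_comp => //.
  apply: measurable_funB; first exact: measurable_funM.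
  apply: measurable_funM => //; apply: (measurableT_comp (exprn_measurable _)).
  exact: measurable_funM.
have c1 : (\int[P]_w g n w @[n --> \oo] --> \int[P]_w (expR (a * X w) * gauss_half)%:E)%E.
  rewrite (_ : (fun w => (expR (a * X w) * gauss_half)%:E) = fun w => limn (g ^~ w)).
    apply: cvg_monotone_convergence => //.
    - by move=> n w _; rewrite lee_fin mulr_ge0 ?expR_ge0// ltW.
    - move=> w _ n k nk; rewrite lee_fin ler_pM2r// ler_expR lerD2l lerN2 ler_pM2r ?invr_gt0//.
      rewrite !exprMn ler_wpM2r ?sqr_ge0// lerXn2r ?nnegrE ?(ltW (e0 _))//.
      by rewrite lef_pV2 ?posrE// ler_nat ltnS.
  apply/funext => w; apply/esym/cvg_lim => //; apply: cvg_EFin; first exact: nearW.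
  apply: cvgMl; apply: continuous_cvg; first exact: continuous_expR.
  rewrite [X in _ --> X](_ : _ = a * X w - 0 * 0 / 2); last by ring.
  have ce : n.+1%:R^-1 * X w @[n --> \oo] --> (0 : R).
    by rewrite -[X in _ --> X](mul0r (X w)); apply: cvgMl; exact: cvg_harmonic.
  by apply: cvgB; [exact: cvg_cst|apply: cvgMl; exact: cvgM].
have c2 : (\int[P]_w g n w @[n --> \oo] --> (gauss_half * expR (a * ln a - a))%:E)%E.
  rewrite (_ : (fun n => _) = fun n => (\int[mu]_(y in H) stirling_cos a n.+1%:R^-1 a y)%:E); last first.
    apply/funext => n; rewrite gauss_char_fun//.
    by have [_ ->] := Rintegral_stirling_edge a0 (e0 n).
  by apply: cvg_EFin; [exact: nearW|exact: cvg_stirling_main].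
have := @cvg_unique _ (@ereal_hausdorff R) _ _ _ _ c1 c2;
move=> /(_ (fmap_proper_filter _ _)).
under eq_integral do rewrite EFinM.
rewrite ge0_integralZr//; last 2 first.
- by apply/measurable_EFinP; apply: measurableT_comp => //; exact: measurable_funM.
- by rewrite lee_fin ltW.
rewrite [in RHS]mulrC EFinM; case: (\int[P]_w _)%E => [r| |].
- by rewrite -!EFinM => -[] /(mulIf (lt0r_neq0 g0)) ->.
- by rewrite gt0_mulye ?lte_fin.
- by rewrite gt0_mulNye ?lte_fin.
Qed.

End with_variable.

End one_stable_mellin.

(** * Mixtures of exponential variables *)

Section laws.
Context {R : realType}.

Lemma pushforward_measure d d' (T : measurableType d) (T' : measurableType d')
    (m : {measure set T -> \bar R}) (X : T -> T') : measurable_fun setT X ->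
  exists mu : {measure set T' -> \bar R}, mu = pushforward m X :> (set T' -> \bar R).
Proof. by move=> mX; unshelve eexists (pushforward m X). Qed.

Lemma moment_unique_integral d1 d2 (T1 : measurableType d1) (T2 : measurableType d2)
    (m1 : {measure set T1 -> \bar R}) (m2 : {measure set T2 -> \bar R})
    (X1 : T1 -> R) (X2 : T2 -> R) (f : R -> \bar R) :
  measurable_fun setT X1 -> measurable_fun setT X2 ->
  (forall w, 0 <= X1 w) -> (forall w, 0 <= X2 w) ->
  m1 setT = 1%E -> m2 setT = 1%E ->
  (forall n, \int[m1]_w (X1 w ^+ n)%:E <= n`!%:R%:E)%E ->
  (forall n, \int[m1]_w (X1 w ^+ n)%:E = \int[m2]_w (X2 w ^+ n)%:E)%E ->
  measurable_fun setT f -> (forall x, 0 <= f x)%E ->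
  (\int[m1]_w f (X1 w) = \int[m2]_w f (X2 w))%E.
Proof.
move=> mX1 mX2 X1ge0 X2ge0 m1T m2T sm1 m12 mf f0.
have law d (T : measurableType d) (m : {measure set T -> \bar R}) (X : T -> R) :
    measurable_fun setT X -> (forall w, 0 <= X w) -> m setT = 1%E ->
    exists mu : {measure set (measurableTypeR R) -> \bar R},
    [/\ forall n, (\int[mu]_(x in `[0%R, +oo[) (x ^+ n)%:E = \int[m]_w (X w ^+ n)%:E)%E,
      mu setT = 1%E, mu `]-oo, 0%R[%classic = 0%R &
      (\int[m]_w f (X w) = \int[mu]_x f x)%E].
  move=> mX X0 mT; have [mu emu] := pushforward_measure m (mX : @measurable_fun _ _ _ (measurableTypeR R) _ X).
  exists mu; rewrite emu; split => [n| | |].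
  - rewrite ge0_integral_pushforward//.
    + by rewrite (_ : X @^-1` _ = setT)//; apply/seteqP; split => // w _ /=; rewrite in_itv/= X0.
    + apply/measurable_EFinP; apply: measurable_funTS; exact: exprn_measurable.
    + by move=> x; rewrite inE/= in_itv/= andbT => x0; rewrite lee_fin exprn_ge0.
  - by rewrite /pushforward preimage_setT.
  - rewrite /pushforward (_ : _ @^-1` _ = set0) ?measure0//.
    by apply/seteqP; split => // w /=; rewrite in_itv/= ltNge X0.
  - by rewrite ge0_integral_pushforward.
have [mu1 [mo1 T1' n1 ->]] := law _ _ m1 X1 mX1 X1ge0 m1T.
have [mu2 [mo2 T2' n2 ->]] := law _ _ m2 X2 mX2 X2ge0 m2T.
apply: eq_measure_integral => A mA _; apply: moment_unique => //.
- by move=> n; rewrite mo1.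
- by move=> n; rewrite mo2 -m12.
- by move=> n; rewrite mo1 mo2.
Qed.


Notation mu := (@lebesgue_measure R).

Section exponential_variable.
Context d (T : measurableType d) (P : probability T R) (L : {RV P >-> R}).
Hypothesis hL : unit_exponential L.

Lemma exponential_tail x : 0 <= x -> P [set w | x <= L w] = (expR (- x))%:E.
Proof.
move=> x0; have := hL (measurable_itv `[x, +oo[); rewrite /distribution /pushforward.
rewrite (_ : L @^-1` _ = [set w | x <= L w]); last first.
  by apply/seteqP; split => w /=; rewrite in_itv/= andbT.
move=> ->; have := @integral_expR_tail R 1 x ltr01; rewrite divr1 mul1r => <-.
apply: eq_integral => y; rewrite inE/= in_itv/= andbT => xy.
by rewrite exponential_pdfE ?(le_trans x0)//= mul1r mulN1r mul1r.
Qed.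

Lemma exponential_tail_lt x : 0 <= x -> P [set w | x < L w] = (expR (- x))%:E.
Proof.
move=> x0; rewrite -exponential_tail//.
have := hL (measurable_itv `[x, +oo[); have := hL (measurable_itv `]x, +oo[).
rewrite /distribution /pushforward.
rewrite (_ : L @^-1` _ = [set w | x < L w]); last first.
  by apply/seteqP; split => w /=; rewrite in_itv/= andbT.
rewrite (_ : L @^-1` _ = [set w | x <= L w]); last first.
  by apply/seteqP; split => w /=; rewrite in_itv/= andbT.
move=> -> ->; rewrite /exponential_prob integral_itv_obnd_cbnd//.
by apply/measurable_EFinP; apply: measurable_funTS; exact: measurable_exponential_pdf.
Qed.

Lemma exponential_lt0 : P [set w | L w < 0] = 0%E.
Proof.
have := @probability_setC _ _ _ P [set w | 0 <= L w].
rewrite exponential_tail// oppr0 expR0 subee// => <-//.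
  by congr (P _); apply/seteqP; split => w /=; rewrite ltNge => /negP.
rewrite -[X in measurable X]setTI; apply: measurable_fun_le => //.
Qed.

End exponential_variable.

(** Moments are expressed by tails, the data that [st_le] compares. *)
Lemma layer_cake d (T : measurableType d) (P : probability T R) (Y : T -> R) n :
  measurable_fun setT Y -> (forall w, 0 <= Y w) -> (0 < n)%N ->
  (\int[P]_w (Y w ^+ n)%:E =
   \int[mu]_(r in `]0%R, +oo[) P [set w | ((r : R) `^ n%:R^-1 < Y w)%R])%E.
Proof.
move=> mY Y0 n0.
have mYn : measurable_fun setT (fun w => Y w ^+ n).
  by apply: (measurableT_comp (exprn_measurable _)).
pose Yn : {RV P >-> R} := mfun_Sub (mem_set mYn).
have -> : (\int[P]_w (Y w ^+ n)%:E = 'E_P[Yn])%E by rewrite unlock.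
rewrite ge0_expectation_ccdf; last by move=> w; exact: exprn_ge0.
rewrite -integral_itv_obnd_cbnd; last by apply: measurable_funTS; exact: ccdf_measurable.
apply: eq_integral => r; rewrite inE/= in_itv/= andbT => r0.
have -> : ccdf Yn r = ccdf Yn ((r `^ n%:R^-1) ^+ n).
  by rewrite -powR_mulrn ?powR_ge0// -powRrM mulVf ?pnatr_eq0 ?lt0n_neq0// powRr1// ltW.
rewrite /ccdf /distribution /pushforward; congr (P _).
by apply/seteqP; split => w /=; rewrite in_itv/= andbT ltr_pXn2r// ?nnegrE ?powR_ge0.
Qed.

Lemma gamma1_stretched n : (0 < n)%N ->
  (\int[mu]_(r in `]0%R, +oo[) (expR (- ((r : R) `^ n%:R^-1)))%:E = n`!%:R%:E)%E.
Proof.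
move=> n0; have n0' : 0 < n%:R :> R by rewrite ltr0n.
have := @integral_stretched R n%:R 1 n0' ltr01.
by rewrite powR1 mul1r gamma1_nat => <-; apply: eq_integral => r _; rewrite mul1r.
Qed.

Lemma integrable_oo_measurable (a b C : R) (f : R -> R) :
  measurable_fun setT f -> (forall x, `|f x| <= C) ->
  mu.-integrable `]a, b[ (EFin \o f).
Proof.
move=> mf fC; apply: measurable_bounded_integrable => //.
- have : (@lebesgue_measure R `]a, b[%classic < +oo)%E; last by [].
  by rewrite lebesgue_measure_itv/=; case: ifP => // _; rewrite -EFinB ltry.
- exact: measurable_funTS.
- exists C; split; first exact: num_real.
  by move=> r Cr x _; exact: le_trans (fC _) (ltW Cr).
Qed.

Section mixture.
Context d (T : measurableType d) (P : probability T R) (L : {RV P >-> R}).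
Local Notation U := (uniform_prob (@pi_gt0 R)).
Local Notation Lp := (fun w => Num.max (L w) 0).

(* W has the law of k(U) L, where U is uniform on [0, pi] and independent of L; the
   maximum only changes L on a null set. *)
Definition is_mixture (k : R -> R) d' (T' : measurableType d') (Q : probability T' R)
    (W : T' -> R) := forall f : R -> \bar R,
  measurable_fun setT f -> (forall x, 0 <= f x)%E ->
  (\int[Q]_w f (W w) = \int[U]_u \int[P]_w f (k u * Lp w)%R)%E.

Lemma measurable_maxL : measurable_fun setT Lp.
Proof. exact: measurable_maxr. Qed.

Lemma maxL_ge0 w : 0 <= Lp w.
Proof. by rewrite le_max lexx orbT. Qed.

Lemma integral_uniform_pi (f : R -> \bar R) :
  measurable_fun setT f -> (forall x, 0 <= f x)%E ->
  (\int[U]_u f u = pi^-1%:E * \int[mu]_(u in `]0%R, pi[) f u)%E.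
Proof.
move=> mf f0; rewrite integral_uniform// subr0; congr (_ * _)%E.
by rewrite integral_itv_bndoo//; exact: measurable_funTS.
Qed.

Lemma measurable_mixture (k : R -> R) (f : R -> \bar R) :
  measurable_fun setT k -> measurable_fun setT f -> (forall x, 0 <= f x)%E ->
  measurable_fun setT (fun u => \int[P]_w f (k u * Lp w)%R)%E.
Proof.
move=> mk mf f0.
apply: (@measurable_fun_fubini_tonelli_F _ _ (measurableTypeR R) T _ P
  (fun p => f (k p.1 * Lp p.2)%R)) => //.
apply: (measurableT_comp mf); apply: measurable_funM; first exact: (measurableT_comp mk).
exact: (measurableT_comp measurable_maxL).
Qed.

Lemma is_mixtureE (k : R -> R) d' (T' : measurableType d') (Q : probability T' R)
    (W : T' -> R) (f : R -> \bar R) :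
  is_mixture k Q W -> measurable_fun setT k ->
  measurable_fun setT f -> (forall x, 0 <= f x)%E ->
  (\int[Q]_w f (W w) =
   pi^-1%:E * \int[mu]_(u in `]0%R, pi[) \int[P]_w f (k u * Lp w)%R)%E.
Proof.
move=> h mk mf f0; rewrite h// integral_uniform_pi//; first exact: measurable_mixture.
by move=> u; apply: integral_ge0 => w _; exact: f0.
Qed.

Lemma is_mixtureZ k c d' (T' : measurableType d') (Q : probability T' R) (W : T' -> R) :
  is_mixture k Q W -> is_mixture (fun u => c * k u) Q (fun w => c * W w).
Proof.
move=> kW f mf f0; apply: (etrans (kW (fun x => f (c * x)) _ (fun x => f0 (c * x)))).
  by apply: (measurableT_comp mf); exact: measurable_funM.
by apply: eq_integral => u _; apply: eq_integral => w _; rewrite mulrA.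
Qed.

Hypothesis hL : unit_exponential L.

Lemma exponential_moment n : (\int[P]_w (Lp w ^+ n)%:E = n`!%:R%:E)%E.
Proof.
case: n => [|n].
  by have e := @expectation_cst _ _ _ P 1; rewrite unlock in e; exact: e.
rewrite layer_cake//; [|exact: measurable_maxL|exact: maxL_ge0].
rewrite -gamma1_stretched//; apply: eq_integral => r _.
rewrite -(exponential_tail_lt hL)?powR_ge0//; congr (P _).
apply/seteqP; split => w /=; rewrite lt_max; first by case/orP => //; rewrite ltNge powR_ge0.
by move=> ->.
Qed.

(** On the product space k(U) L has these same moments, and k <= 1 keeps them below n!, within reach
    of the uniqueness theorem. *)
Lemma mixture_of_moments (k : R -> R) d' (T' : measurableType d') (Q : probability T' R) (W : T' -> R) :
  measurable_fun setT k -> (forall u, 0 <= k u <= 1) ->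
  measurable_fun setT W -> (forall w, 0 <= W w) ->
  (forall n, \int[Q]_w (W w ^+ n)%:E =
     (n`!%:R * (pi^-1 * \int[mu]_(u in `]0%R, pi[) (k u ^+ n))%R)%:E)%E ->
  is_mixture k Q W.
Proof.
move=> mk k01 mW W0 WE f mf f0.
pose V (p : measurableTypeR R * T) := k p.1 * Lp p.2.
have mV : measurable_fun setT V.
  apply: measurable_funM; first exact: (measurableT_comp mk).
  exact: (measurableT_comp measurable_maxL).
have V0 p : 0 <= V p by rewrite mulr_ge0 ?maxL_ge0//; have /andP[] := k01 p.1.
have mkn n : measurable_fun setT (fun u => k u ^+ n).
  exact: (measurableT_comp (exprn_measurable _)).
have ik n : mu.-integrable `]0, pi[ (EFin \o (fun u => k u ^+ n)).
  apply: (@integrable_oo_measurable _ _ 1) => // u; have /andP[k0 k1] := k01 u.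
  by rewrite ger0_norm ?exprn_ge0// exprn_ile1.
have VE n : (\int[U \x P]_p (V p ^+ n)%:E = \int[Q]_w (W w ^+ n)%:E)%E.
  rewrite fubini_tonelli1; last 2 first.
  - by apply/measurable_EFinP; exact: (measurableT_comp (exprn_measurable _)).
  - by move=> p; rewrite lee_fin exprn_ge0.
  rewrite /fubini_F /V WE.
  transitivity (\int[U]_u (k u ^+ n * n`!%:R)%:E)%E.
    apply: eq_integral => u _; under eq_integral do rewrite /= exprMn EFinM.
    rewrite ge0_integralZl//.
    - by rewrite exponential_moment.
    - by apply/measurable_EFinP; apply: (measurableT_comp (exprn_measurable _)); exact: measurable_maxL.
    - by move=> w _; rewrite lee_fin exprn_ge0// maxL_ge0.
    - by rewrite lee_fin exprn_ge0//; have /andP[] := k01 u.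
  rewrite integral_uniform_pi; last 2 first.
  - by apply/measurable_EFinP; exact: measurable_funM.
  - by move=> u; rewrite lee_fin mulr_ge0// exprn_ge0//; have /andP[] := k01 u.
  under eq_integral do rewrite EFinM.
  rewrite ge0_integralZr//; last 2 first.
  - by apply/measurable_EFinP; apply: measurable_funTS; exact: mkn.
  - by move=> u _; rewrite lee_fin exprn_ge0//; have /andP[] := k01 u.
  rewrite -(fineK (integrable_fin_num _ (ik n)))// -!EFinM; congr EFin; rewrite -/(Rintegral _ _ _); ring.
transitivity (\int[U \x P]_p f (V p))%E; last first.
  by rewrite fubini_tonelli1//; exact: (measurableT_comp mf mV).
apply: moment_unique_integral => //.
- exact: probability_setT.
- have := product_measure1E U P (@measurableT _ _) (@measurableT _ _).
  rewrite setXTT => UP; apply: etrans UP _.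
  by rewrite [X in (X * _)%E](_ : _ = 1%E) ?mul1e; exact: probability_setT.
- move=> n; rewrite WE lee_fin -[leRHS]mulr1 ler_wpM2l// ler_pdivrMl ?pi_gt0// mulr1.
  rewrite -[leRHS]mul1r -Rintegral_cst_0pi; apply: le_Rintegral => //.
  + by apply: (@integrable_oo_measurable _ _ 1) => // u; rewrite normr1.
  + by move=> u _; have /andP[k0 k1] := k01 u; rewrite exprn_ile1.
Qed.

Lemma exponential_is_mixture : is_mixture (fun=> 1) P L.
Proof.
move=> f mf f0.
have mfL : measurable_fun setT (fun w => f (Lp w)).
  exact: (measurableT_comp mf measurable_maxL).
transitivity (\int[P]_w f (Lp w))%E.
  apply: ae_eq_integral => //; first exact: (measurableT_comp mf).
  exists [set w | L w < 0]; split; [|exact: exponential_lt0|].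
    have := measurable_funPTI L (measurable_itv `]-oo, 0[).
    by rewrite (_ : _ @^-1` _ = [set w | L w < 0])//; apply/seteqP; split => w /=; rewrite in_itv.
  move=> w /=; apply: contra_notP => /negP; rewrite -leNgt => L0 _.
  by rewrite max_l.
under [in RHS]eq_integral do under eq_integral do rewrite mul1r.
have : (0 <= \int[P]_w f (Lp w))%E by apply: integral_ge0 => w _; exact: f0.
move: (\int[P]_w f (Lp w))%E => I I0.
rewrite integral_uniform_pi// integral_cst//.
have e : @lebesgue_measure R `]0%R, (pi:R)[%classic = (pi:R)%:E.
  by rewrite lebesgue_measure_itv/= lte_fin pi_gt0 -EFinB subr0.
rewrite [X in (_ * (_ * X))%E](_ : _ = (pi:R)%:E)//.
by rewrite [X in (_ * X)%E]muleC muleA -EFinM mulVf ?mul1e// gt_eqF ?pi_gt0.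
Qed.

(** A coupling: both laws are realised with the same U and L, where the order holds pointwise. *)
Lemma is_mixture_st_le (k k' : R -> R) d1 (T1 : measurableType d1) (P1 : probability T1 R)
    (W1 : T1 -> R) d2 (T2 : measurableType d2) (P2 : probability T2 R) (W2 : T2 -> R) :
  is_mixture k P1 W1 -> is_mixture k' P2 W2 ->
  measurable_fun setT W1 -> measurable_fun setT W2 ->
  measurable_fun setT k -> measurable_fun setT k' ->
  {in `]0, pi[, forall u, k u <= k' u} -> st_le P1 P2 W1 W2.
Proof.
move=> h1 h2 mW1 mW2 mk mk' kk' x.
pose f (y : R) : \bar R := (\1_(`[x, +oo[ : set R) y)%:E.
have mf : measurable_fun setT f by apply/measurable_EFinP; exact: measurable_indic.
have f0 y : (0 <= f y)%E by rewrite lee_fin.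
have Pf d0 (T0 : measurableType d0) (P0 : probability T0 R) (W : T0 -> R) :
    measurable_fun setT W -> P0 [set w | x <= W w] = (\int[P0]_w f (W w))%E.
  move=> mW; have mA : measurable [set w | x <= W w].
    have := measurable_funPTI (mfun_Sub (mem_set mW)) (measurable_itv `[x, +oo[).
    by rewrite (_ : _ @^-1` _ = [set w | x <= W w])//; apply/seteqP; split => w /=; rewrite in_itv/= andbT.
  rewrite -[X in P0 X]setIT -integral_indic//; apply: eq_integral => w _.
  by rewrite /f !indicE; congr ((nat_of_bool _)%:R)%:E; apply/idP/idP; rewrite !inE/= in_itv/= andbT.
rewrite (Pf _ _ _ _ mW1) (Pf _ _ _ _ mW2) (is_mixtureE h1 mk mf f0) (is_mixtureE h2 mk' mf f0).
apply: lee_wpmul2l.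
  by rewrite lee_fin invr_ge0 pi_ge0.
have mV k0 u : measurable_fun setT (fun w => f (k0 u * Lp w)).
  by apply: (measurableT_comp mf); apply: measurable_funM => //; exact: measurable_maxL.
apply: ge0_le_integral => //.
- by move=> u _; apply: integral_ge0.
- by apply: measurable_funTS; exact: measurable_mixture.
- by apply: measurable_funTS; exact: measurable_mixture.
move=> u u0; apply: ge0_le_integral => // w _.
rewrite lee_fin /f !indicE ler_nat.
have := ler_wpM2r (maxL_ge0 w) (kk' u u0).
case: (boolP (k u * Lp w \in _)) => //; rewrite inE/= in_itv/= andbT => /le_trans h /h {}h.
by rewrite mem_set//= in_itv/= andbT.
Qed.

End mixture.

(** A crude Stirling bound with a linear prefactor. The induction step is (x + 1) ln(x / (x + 1)) <=
    -1, from ln(1 + t) <= t at t = -1 / (x + 1). *)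
Lemma fact_le_stirling n : n.+1`!%:R <=
  expR 1 * n.+1%:R * expR (n.+1%:R * ln n.+1%:R - n.+1%:R) :> R.
Proof.
elim: n => [|n IHn].
  by rewrite factS fact0 ln1 mulr0 sub0r mulr1 -expRD subrr expR0.
rewrite factS natrM; apply: (le_trans (ler_wpM2l _ IHn)) => //.
rewrite [leRHS]mulrAC [leRHS]mulrC ler_wpM2l// -mulrA ler_wpM2l ?expR_ge0//.
have n1 : 0 < n.+1%:R :> R by [].
have n2 : n.+2%:R = n.+1%:R + 1 :> R by rewrite natr1.
rewrite n2; move: (n.+1%:R : R) n1 => x x0.
rewrite -{1}(lnK x0) -expRD ler_expR.
have x10 : 0 < x + 1 by lra.
have := @le_ln1Dx R (- (x + 1)^-1).
rewrite (_ : 1 - (x + 1)^-1 = x / (x + 1)); last by field; lra.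
rewrite ltrN2 invf_lt1//; have -> : 1 < x + 1 by lra.
move=> /(_ isT); rewrite ln_div ?posrE// => h.
have := ler_wpM2l (ltW x10) h; rewrite mulrN mulfV ?gt_eqF// mulrBr; lra.
Qed.

(** Bernoulli only gives linear growth of c^m; evaluating at the exponent 2 m squares it, and a
    quadratic beats 2 C m. *)
Lemma exprn_not_le_linear (c C : R) : 1 < c -> ~ (forall n, c ^+ n.+1 <= C * n.+1%:R).
Proof.
move=> c1 h.
have ber n : n%:R * (c - 1) <= c ^+ n.
  elim: n => [|n IHn]; first by rewrite mul0r.
  have : 1 <= c ^+ n by rewrite exprn_ege1// ltW.
  rewrite exprS -natr1 mulrDl mul1r; move: (c ^+ n) (n%:R * (c - 1)) IHn => y z; nra.
have [m hm] : exists m, 2 * C / (c - 1) ^+ 2 < m.+1%:R by exists (Num.truncn (2 * C / (c - 1) ^+ 2)); exact: truncnS_gt.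
have c10 : 0 < (c - 1) ^+ 2 by rewrite exprn_gt0// subr_gt0.
move: hm; rewrite ltr_pdivrMr// => hm.
have := h (m.+1 * 2).-1; rewrite prednK ?muln_gt0// exprM natrM.
have := ber m.+1; have : 0 < m.+1%:R :> R by [].
have c1' : 0 < c - 1 by rewrite subr_gt0.
move: hm c1'; move: (c ^+ m.+1) (m.+1%:R : R) (c - 1) => y z e hm e0 z0 ez hy.
have z2 : 2 * C * z < z * e ^+ 2 * z by rewrite ltr_pM2r.
have ze : 0 < z * e by rewrite mulr_gt0.
have : (z * e) ^+ 2 <= y ^+ 2 by rewrite lerXn2r ?nnegrE// ltW// (lt_le_trans ze).
rewrite exprMn; nra.
Qed.

Section optimality.
Context d (T : measurableType d) (P : probability T R) (L : {RV P >-> R}).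
Context d' (T' : measurableType d') (Q : probability T' R) (X : {RV Q >-> R}).
Hypothesis (hL : unit_exponential L) (hX : one_stable X).

Lemma one_stable_optimal c : 1 < c -> ~ st_le Q P (fun w => c * expR (X w)) L.
Proof.
move=> c1 cXL; apply: (@exprn_not_le_linear c (expR 1) c1) => n.
have c0 : 0 < c by lra.
have mY : measurable_fun setT (fun w => c * expR (X w)).
  by apply: measurable_funM => //; exact: measurableT_comp.
have Y0 w : 0 <= c * expR (X w) by rewrite mulr_ge0 ?expR_ge0// ltW.
have : (\int[Q]_w ((c * expR (X w)) ^+ n.+1)%:E <= n.+1`!%:R%:E)%E.
  rewrite (layer_cake Q mY Y0)// -gamma1_stretched//.
  pose Y : {RV Q >-> R} := mfun_Sub (mem_set mY).
  apply: ge0_le_integral => //.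
  - rewrite (_ : (fun _ => _) = ccdf Y \o (@powR R ^~ n.+1%:R^-1)).
      apply: measurable_funTS; apply: measurableT_comp (measurable_powR _).
      exact: ccdf_measurable.
    apply/funext => t; rewrite /= /ccdf /distribution /pushforward; congr (Q _).
    by apply/seteqP; split => w /=; rewrite in_itv/= andbT.
  - apply/measurable_EFinP; apply: measurable_funTS; apply: measurableT_comp => //.
    by apply: measurableT_comp => //; exact: measurable_powR.
  move=> r _; rewrite -(exponential_tail hL) ?powR_ge0//; apply: le_trans (cXL _).
  have mS (b : itv_bound R) : measurable [set w | c * expR (X w) \in Interval b +oo%O].
    exact: (measurable_funPTI Y (measurable_itv (Interval b +oo%O))).
  apply: le_measure; rewrite ?inE.
  - by have := mS (BRight (r `^ n.+1%:R^-1)); under eq_set do rewrite in_itv/= andbT.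
  - by have := mS (BLeft (r `^ n.+1%:R^-1)); under eq_set do rewrite in_itv/= andbT.
  by move=> w /= /ltW.
have -> : (\int[Q]_w ((c * expR (X w)) ^+ n.+1)%:E =
    (c ^+ n.+1 * expR (n.+1%:R * ln n.+1%:R - n.+1%:R))%:E)%E.
  have a0 : 0 < n.+1%:R :> R by [].
  rewrite EFinM -(one_stable_moment a0 hX) unlock -ge0_integralZl//.
  - by apply: eq_integral => w _; rewrite exprMn -expRM_natl.
  - by apply/measurable_EFinP; apply: measurableT_comp => //; exact: measurable_funM.
  - by rewrite lee_fin exprn_ge0// ltW.
rewrite lee_fin => h; have := le_trans h (fact_le_stirling n).
by rewrite ler_pM2r ?expR_gt0.
Qed.

End optimality.
End laws.

(** * Convex order between mixtures *)

Section convex.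
Context {R : realType} (phi : R -> R).
Hypothesis cphi : @convex_function R R^o setT phi.

Lemma convex_line (x y t : R) : 0 <= t <= 1 ->
  phi (t * x + (1 - t) * y) <= t * phi x + (1 - t) * phi y.
Proof.
move=> /andP[t0 t1]; have := cphi (Itv01 t0 t1) (x := x) (y := y).
by rewrite !inE => /(_ I I).
Qed.

Lemma convex_slope (a x b : R) : a < x -> x < b ->
  (phi x - phi a) / (x - a) <= (phi b - phi x) / (b - x).
Proof.
move=> ax xb; have ab : 0 < b - a by lra.
have := @convex_line a b ((b - x) / (b - a)).
rewrite (_ : _ * a + _ = x); last by field; lra.
rewrite divr_ge0 ?(ltW ab) ?subr_ge0 ?(ltW xb)// ler_pdivrMr// mul1r lerD2l lerN2 (ltW ax).
move=> /(_ isT) h.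
have := ler_wpM2l (ltW ab) h.
rewrite (_ : (b - a) * (_ + _) = (b - x) * phi a + (x - a) * phi b); last by field; lra.
move=> {}h; rewrite ler_pdivrMr ?subr_gt0// mulrAC ler_pdivlMr ?subr_gt0//; lra.
Qed.

(** The slope at x is the left derivative, the supremum of the chord slopes from the left; the chord
    to x + 1 bounds them. *)
Lemma convex_subgradient : exists g : R -> R, forall x y, phi x + g x * (y - x) <= phi y.
Proof.
suff /choice[g hg] : forall x, exists s, forall y, phi x + s * (y - x) <= phi y by exists g.
move=> x; pose S := [set s | exists2 a, a < x & s = (phi x - phi a) / (x - a)].
have hS : has_sup S.
  split; first by exists ((phi x - phi (x - 1)) / (x - (x - 1))), (x - 1) => //; lra.
  exists ((phi (x + 1) - phi x) / (x + 1 - x)) => _ [a ax ->]; apply: convex_slope => //; lra.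
exists (sup S) => y; have [xy|yx|<-] := ltgtP x y; last by rewrite subrr mulr0 addr0.
- rewrite -lerBrDl -ler_pdivlMr ?subr_gt0//; apply: ge_sup; first by case: hS.
  by move=> _ [a ax ->]; exact: convex_slope.
- have : (phi x - phi y) / (x - y) <= sup S by apply: ub_le_sup; [case: hS|exists y].
  rewrite ler_pdivrMr ?subr_gt0// => h; lra.
Qed.

End convex.

Section subgradient.
Context {R : realType} (phi g : R -> R).
Hypothesis hg : forall x y, phi x + g x * (y - x) <= phi y.
Notation mu := (@lebesgue_measure R).

Lemma subgradient_nondecreasing : {homo g : x y / x <= y}.
Proof.
move=> x y; rewrite le_eqVlt => /predU1P[->//|xy].
have h := hg x y; have h' := hg y x; rewrite -(@ler_pM2r _ (y - x)) ?subr_gt0//; lra.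
Qed.

Lemma subgradient_le_max (x y z : R) : x <= z <= y -> phi z <= Num.max (phi x) (phi y).
Proof.
move=> /andP[xz zy]; rewrite le_max; apply/orP.
have [gz|gz] := leP 0 (g z); [right|left].
  by apply: le_trans (hg z y); rewrite lerDl mulr_ge0// subr_ge0.
by apply: le_trans (hg z x); rewrite lerDl mulr_le0// ?subr_le0// ltW.
Qed.

(** By [subgradient_le_max] the sublevel sets are intervals. *)
Lemma measurable_subgradient : measurable_fun setT phi.
Proof.
move=> _; apply: (measurability _ (RGenOInfty.measurableE R)) => //.
move=> _ [_ [r ->] <-]; rewrite setTI -[X in measurable X]setCK; apply: measurableC.
apply: is_interval_measurable => x y /= hx hy z xzy.
rewrite in_itv/= andbT; apply/negP; rewrite -leNgt.
move: hx hy; rewrite !in_itv/= !andbT => /negP + /negP; rewrite -!leNgt => hx hy.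
by apply: le_trans (subgradient_le_max xzy) _; rewrite ge_max hx hy.
Qed.

Hypothesis phi0 : forall x, 0 <= phi x.

Lemma integrable_convex_kernel (h : R -> R) (C l : R) :
  measurable_fun setT h -> (forall u, 0 <= h u <= C) -> 0 <= l ->
  mu.-integrable `]0, pi[ (EFin \o (fun u => phi (h u * l))).
Proof.
move=> mh hC l0; apply: (@integrable_oo_measurable _ _ _ (Num.max (phi 0) (phi (C * l)))).
  by apply: (measurableT_comp measurable_subgradient); exact: measurable_funM.
move=> u; have /andP[h0 h1] := hC u; rewrite ger0_norm//; apply: subgradient_le_max.
by rewrite mulr_ge0//= ler_wpM2r.
Qed.

(* Where h1 < h2 the values of h1 are above a level kappa, and where h2 < h1 they are
   below.  With d a subgradient of phi at kappa l, the inequality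
   phi (h1 l) + d l (h2 - h1) <= phi (h2 l) holds pointwise. *)
Lemma convex_kernel_le (h1 h2 : R -> R) (C l : R) :
  measurable_fun setT h1 -> measurable_fun setT h2 ->
  (forall u, 0 <= h1 u <= C) -> (forall u, 0 <= h2 u <= C) ->
  \int[mu]_(u in `]0, pi[) h1 u = \int[mu]_(u in `]0, pi[) h2 u ->
  {in `]0, pi[ &, forall u v, h1 u < h2 u -> h2 v < h1 v -> h1 v <= h1 u} ->
  0 <= l ->
  \int[mu]_(u in `]0, pi[) phi (h1 u * l) <= \int[mu]_(u in `]0, pi[) phi (h2 u * l).
Proof.
move=> mh1 mh2 h1C h2C eh cross l0.
(* The element 0 keeps the set nonempty when h2 < h1 never occurs; being below all values of h1, it
   does not disturb the level. *)
pose S := [set x | x = 0 \/ exists2 v, v \in `]0, pi[ & h2 v < h1 v /\ x = h1 v].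
have C0 : 0 <= C by have /andP[] := h1C 0; exact: le_trans.
have hS : has_sup S.
  by split; [exists 0; left|exists C => _ [->//|[v _ [_ ->]]]; have /andP[] := h1C v].
pose kappa := sup S; pose d := g (kappa * l).
have supp u : u \in `]0, pi[ -> phi (h1 u * l) + (d * l) * (h2 u - h1 u) <= phi (h2 u * l).
  move=> u0; apply: le_trans (hg (h1 u * l) (h2 u * l)).
  rewrite lerD2l -mulrBl mulrAC mulrA ler_wpM2r//; have [h12|h21|->] := ltgtP (h1 u) (h2 u).
  - rewrite ler_pM2r ?subr_gt0//; apply: subgradient_nondecreasing.
    rewrite ler_wpM2r//; apply: ge_sup; first by case: hS.
    by move=> _ [->|[v v0 [hv ->]]]; [have /andP[] := h1C u|exact: cross].
  - rewrite ler_nM2r ?subr_lt0//; apply: subgradient_nondecreasing.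
    rewrite ler_wpM2r//; apply: ub_le_sup; first by case: hS.
    by right; exists u.
  - by rewrite subrr !mulr0.
have mI : measurable (`]0, pi[%classic : set (measurableTypeR R)) by [].
have i1 := integrable_convex_kernel mh1 h1C l0.
have i2 := integrable_convex_kernel mh2 h2C l0.
have ih (h : R -> R) : measurable_fun setT h -> (forall u, 0 <= h u <= C) ->
    mu.-integrable `]0, pi[ (EFin \o h).
  move=> mh hC; apply: (@integrable_oo_measurable _ _ _ C) => // u.
  by have /andP[h0 h1'] := hC u; rewrite ger0_norm.
have j1 := ih _ mh1 h1C; have j2 := ih _ mh2 h2C.
have jB := integrable_fB mI j2 j1.
have jZ := integrable_fZl mI (d * l) jB.
have -> : \int[mu]_(u in `]0, pi[) phi (h1 u * l) =
    \int[mu]_(u in `]0, pi[) (phi (h1 u * l) + (d * l) * (h2 u - h1 u)).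
  by rewrite RintegralD// RintegralZl// RintegralB// eh subrr mulr0 addr0.
apply: le_Rintegral => //; exact: integrable_fD.
Qed.

End subgradient.

(** The integral of f may be infinite. In that case f <= (f + A)^+ + |A| makes the positive part
    infinite, while (f + A)^- <= |A| keeps the negative part finite. *)
Lemma integral_ge0D_integrable d (T : measurableType d) (R : realType)
    (P : {measure set T -> \bar R}) (f A : T -> R) :
  measurable_fun setT f -> (forall w, 0 <= f w) -> P.-integrable setT (EFin \o A) ->
  (\int[P]_w (f w + A w)%:E = \int[P]_w (f w)%:E + \int[P]_w (A w)%:E)%E.
Proof.
move=> mf f0 iA.
have mA : measurable_fun setT A by apply/measurable_EFinP; case/integrableP: iA.
have [fy|] := ltP (\int[P]_w (f w)%:E)%E +oo%E.
  have iF : P.-integrable setT (EFin \o f).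
    apply/integrableP; split; first exact/measurable_EFinP.
    by under eq_integral do rewrite /= ger0_norm//.
  by under eq_integral do rewrite EFinD; rewrite integralD.
rewrite leye_eq => /eqP fy; rewrite fy.
have Afin : (\int[P]_w `|(A w)%:E| < +oo)%E by case/integrableP: iA.
have mF : measurable_fun setT (fun w => (f w + A w)%:E).
  by apply/measurable_EFinP; exact: measurable_funD.
have A0 : (\int[P]_w (A w)%:E)%E \is a fin_num by exact: integrable_fin_num iA.
rewrite addye; last by case/fin_numP: A0.
rewrite integralE.
have -> : (\int[P]_w ((fun w => (f w + A w)%:E)^\+ w) = +oo)%E.
  have : (\int[P]_w (f w)%:E <= \int[P]_w ((fun w => (f w + A w)%:E)^\+ w + `|(A w)%:E|))%E.
    apply: ge0_le_integral => //.
    - by move=> w _; rewrite lee_fin.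
    - exact/measurable_EFinP.
    - apply: emeasurable_funD; first exact: measurable_funepos.
      by apply: measurableT_comp => //; exact/measurable_EFinP.
    move=> w _; rewrite funeposE/= -EFin_max -EFinD lee_fin.
    have := ler_norm (- A w); rewrite normrN; have : f w + A w <= Num.max (f w + A w) 0 by rewrite le_max lexx.
    lra.
  rewrite ge0_integralD//; last 2 first.
  - exact: measurable_funepos.
  - by apply: measurableT_comp => //; exact/measurable_EFinP.
  rewrite fy; move: Afin; case: (\int[P]_w `|_|)%E => [r| |]//; last first.
    by rewrite addeNy.
  by case: (\int[P]_w _)%E => [s| |]//; rewrite leye_eq.
rewrite addye//; suff : (\int[P]_w ((fun w => (f w + A w)%:E)^\- w) < +oo)%E.
  by case: (\int[P]_w _)%E.
apply: le_lt_trans Afin; apply: ge0_le_integral => //.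
- exact: measurable_funeneg.
- by apply: measurableT_comp => //; exact/measurable_EFinP.
move=> w _; rewrite funenegE/= -EFin_max lee_fin ge_max normr_ge0 andbT.
have := ler_norm (- A w); rewrite normrN; have := f0 w; lra.
Qed.

Section convex_order.
Context {R : realType}.
Notation mu := (@lebesgue_measure R).
Context d (T : measurableType d) (P : probability T R) (L : {RV P >-> R}).
Hypothesis hL : unit_exponential L.

Lemma mixture_mean (h : R -> R) d' (T' : measurableType d') (Q : probability T' R) (W : T' -> R) :
  is_mixture L h Q W -> measurable_fun setT W -> measurable_fun setT h ->
  (forall u, 0 <= h u) ->
  mu.-integrable `]0, pi[ (EFin \o h) -> \int[mu]_(u in `]0, pi[) h u = pi ->
  Q.-integrable setT (EFin \o W) /\ (\int[Q]_w (W w)%:E = 1)%E.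
Proof.
move=> hW mW mh h0 ih eh.
(* Used for |x|, the positive part and the negative part, with c = 1, 1 and 0: only the law of W,
   not W itself, is known to be carried by the half-line. *)
have FE (F : R -> R) c : measurable_fun setT F -> (forall x, 0 <= F x) ->
    (forall x, 0 <= x -> F x = c * x) -> 0 <= c -> (\int[Q]_w (F (W w))%:E = c%:E)%E.
  move=> mF F0 Fc c0; rewrite (is_mixtureE hW (f := EFin \o F))//; last exact/measurable_EFinP.
  transitivity (pi^-1%:E * \int[mu]_(u in `]0%R, pi[) (c * h u)%:E)%E.
    congr (_ * _)%E; apply: eq_integral => u _.
    under eq_integral do rewrite /= Fc ?mulr_ge0 ?maxL_ge0// mulrA EFinM.
    rewrite ge0_integralZl//; last 3 first.
    - by apply/measurable_EFinP; exact: measurable_maxL.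
    - by move=> w _; rewrite lee_fin maxL_ge0.
    - by rewrite lee_fin mulr_ge0.
    by have := exponential_moment hL 1; rewrite /= => ->; rewrite mule1.
  have mI : measurable (`]0, pi[%classic : set (measurableTypeR R)) by [].
  have iZ := integrable_fZl mI c ih.
  rewrite -(fineK (integrable_fin_num _ iZ))// -EFinM; congr EFin.
  have := RintegralZl c mI ih; rewrite eh /Rintegral => ->.
  by rewrite mulrC -mulrA mulfV ?mulr1// gt_eqF ?pi_gt0.
have iW : Q.-integrable setT (EFin \o W).
  apply/integrableP; split; [exact/measurable_EFinP|].
  by rewrite (FE (fun x => `|x|) 1)//; [rewrite ltry|move=> x x0; rewrite ger0_norm// mul1r].
split=> //; rewrite integralE.
have -> : (\int[Q]_w (fun w => (W w)%:E)^\+ w = 1)%E.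
  rewrite -(FE (fun x => Num.max x 0) 1)//.
  - by apply: eq_integral => w _; rewrite funeposE/= -EFin_max.
  - exact: measurable_maxr.
  - by move=> x; rewrite le_max lexx orbT.
  - by move=> x x0; rewrite max_l// mul1r.
have -> : (\int[Q]_w (fun w => (W w)%:E)^\- w = 0%:E)%E.
  rewrite -(FE (fun x => Num.max (- x) 0) 0)//.
  - by apply: eq_integral => w _; rewrite funenegE/= -EFin_max.
  - by apply: measurable_maxr => //; exact: measurableT_comp.
  - by move=> x; rewrite le_max lexx orbT.
  - by move=> x x0; rewrite max_r ?mul0r// oppr_le0.
by rewrite -EFinB subr0.
Qed.

(** Tonelli puts the integral over L outside, so that [convex_kernel_le] applies at each fixed value
    l of L. *)
Lemma mixture_cx_ge0 (phi g h1 h2 : R -> R) (C : R)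
    d1 (T1 : measurableType d1) (Q1 : probability T1 R) (W1 : T1 -> R)
    d2 (T2 : measurableType d2) (Q2 : probability T2 R) (W2 : T2 -> R) :
  (forall x y, phi x + g x * (y - x) <= phi y) -> (forall x, 0 <= phi x) ->
  is_mixture L h1 Q1 W1 -> is_mixture L h2 Q2 W2 ->
  measurable_fun setT h1 -> measurable_fun setT h2 ->
  (forall u, 0 <= h1 u <= C) -> (forall u, 0 <= h2 u <= C) ->
  \int[mu]_(u in `]0, pi[) h1 u = \int[mu]_(u in `]0, pi[) h2 u ->
  {in `]0, pi[ &, forall u v, h1 u < h2 u -> h2 v < h1 v -> h1 v <= h1 u} ->
  (\int[Q1]_w (phi (W1 w))%:E <= \int[Q2]_w (phi (W2 w))%:E)%E.
Proof.
move=> hg phi0 H1 H2 mh1 mh2 h1C h2C eh cross.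
have mphi : measurable_fun setT (EFin \o phi).
  by apply/measurable_EFinP; exact: measurable_subgradient hg.
have ephi0 x : (0 <= (EFin \o phi) x)%E by rewrite lee_fin.
pose V (h : R -> R) (p : measurableTypeR R * T) := (phi (h p.1 * Num.max (L p.2) 0))%:E.
have mV (h : R -> R) : measurable_fun setT h -> measurable_fun setT (V h).
  move=> mh; apply: (measurableT_comp mphi); apply: measurable_funM.
    exact: (measurableT_comp mh).
  exact: (measurableT_comp (measurable_maxL L)).
have V0 (h : R -> R) p : (0 <= V h p)%E by rewrite lee_fin.
rewrite (H1 _ mphi ephi0) (H2 _ mphi ephi0).
have swap (h : R -> R) : measurable_fun setT h ->
    (\int[uniform_prob (@pi_gt0 R)]_u \int[P]_w (EFin \o phi) (h u * Num.max (L w) 0)%R =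
     \int[P]_w \int[uniform_prob (@pi_gt0 R)]_u (phi (h u * Num.max (L w) 0))%:E)%E.
  by move=> mh; exact: (@fubini_tonelli _ _ _ _ R _ P _ (mV _ mh) (V0 _)).
rewrite (swap _ mh1) (swap _ mh2).
apply: ge0_le_integral => //.
- by move=> w _; apply: integral_ge0 => u _; rewrite lee_fin.
- exact: (measurable_fun_fubini_tonelli_G (V h1) (mV _ mh1) (V0 _)).
- exact: (measurable_fun_fubini_tonelli_G (V h2) (mV _ mh2) (V0 _)).
move=> w _; have l0 := maxL_ge0 L w; move: (Num.max (L w) 0) l0 => l l0.
have mphil (h : R -> R) : measurable_fun setT h -> measurable_fun setT (fun u => (phi (h u * l))%:E).
  by move=> mh; apply: (measurableT_comp mphi); exact: measurable_funM.
have phil0 (h : R -> R) u : (0 <= (phi (h u * l))%:E)%E by rewrite lee_fin.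
rewrite (integral_uniform_pi (mphil _ mh1) (phil0 h1)).
rewrite (integral_uniform_pi (mphil _ mh2) (phil0 h2)).
apply: lee_wpmul2l; first by rewrite lee_fin invr_ge0 pi_ge0.
have i1 := integrable_convex_kernel hg phi0 mh1 h1C l0.
have i2 := integrable_convex_kernel hg phi0 mh2 h2C l0.
rewrite -(fineK (integrable_fin_num _ i1))// -(fineK (integrable_fin_num _ i2))// lee_fin.
exact: (convex_kernel_le hg phi0 mh1 mh2 h1C h2C eh cross l0).
Qed.

(** Subtracting the supporting line of phi at 1 leaves a nonnegative function with a subgradient. As
    both means are 1, the line contributes the same finite value [phi 1] on each side. *)
Lemma mixture_cx (h1 h2 : R -> R) (C : R)
    d1 (T1 : measurableType d1) (Q1 : probability T1 R) (W1 : T1 -> R)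
    d2 (T2 : measurableType d2) (Q2 : probability T2 R) (W2 : T2 -> R) :
  is_mixture L h1 Q1 W1 -> is_mixture L h2 Q2 W2 ->
  measurable_fun setT W1 -> measurable_fun setT W2 ->
  measurable_fun setT h1 -> measurable_fun setT h2 ->
  (forall u, 0 <= h1 u <= C) -> (forall u, 0 <= h2 u <= C) ->
  \int[mu]_(u in `]0, pi[) h1 u = pi -> \int[mu]_(u in `]0, pi[) h2 u = pi ->
  {in `]0, pi[ &, forall u v, h1 u < h2 u -> h2 v < h1 v -> h1 v <= h1 u} ->
  cx_prec Q1 Q2 W1 W2.
Proof.
move=> H1 H2 mW1 mW2 mh1 mh2 h1C h2C e1 e2 cross phi cphi _ _.
have [g hg] := convex_subgradient cphi.
pose psi x := phi x - (g 1 * (x - 1) + phi 1).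
have hpsi x y : psi x + (g x - g 1) * (y - x) <= psi y.
  rewrite /psi; have := hg x y; lra.
have psi0 x : 0 <= psi x by rewrite /psi; have := hg 1 x; lra.
have := mixture_cx_ge0 hpsi psi0 H1 H2 mh1 mh2 h1C h2C (etrans e1 (esym e2)) cross.
have ih (h : R -> R) : measurable_fun setT h -> (forall u, 0 <= h u <= C) ->
    mu.-integrable `]0, pi[ (EFin \o h).
  move=> mh hC; apply: (@integrable_oo_measurable _ _ _ C) => // u.
  by have /andP[h0 h1'] := hC u; rewrite ger0_norm.
have mpsi := measurable_subgradient hpsi.
have split d0 (T0 : measurableType d0) (Q0 : probability T0 R) (W : T0 -> R) :
    measurable_fun setT W ->
    Q0.-integrable setT (EFin \o W) /\ (\int[Q0]_w (W w)%:E = 1)%E ->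
    ('E_Q0[phi \o W] = \int[Q0]_w (psi (W w))%:E + (phi 1)%:E)%E.
  move=> mW [iW eW]; rewrite unlock.
  have mT : measurable (setT : set T0) by [].
  have ic (c : R) : Q0.-integrable setT (EFin \o (fun _ : T0 => c)).
    by apply: finite_measure_integrable_cst.
  have iB := integrable_fB mT iW (ic 1).
  have iA := integrable_fD mT (integrable_fZl mT (g 1) iB) (ic (phi 1)).
  transitivity (\int[Q0]_w (psi (W w) + (g 1 * (W w - 1) + phi 1))%:E)%E.
    by apply: eq_integral => w _; rewrite /psi subrK.
  rewrite integral_ge0D_integrable//; last exact: (measurableT_comp mpsi).
  congr (_ + _)%E; rewrite -(fineK (integrable_fin_num _ iA))//; congr EFin.
  have ecst (c : R) : \int[Q0]_w c = c.
    by have e := @expectation_cst _ _ _ Q0 c; rewrite unlock in e; rewrite /Rintegral e.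
  have eW' : \int[Q0]_w W w = 1 by rewrite /Rintegral eW.
  have iZ := integrable_fZl mT (g 1) iB.
  transitivity (\int[Q0]_w (g 1 * (W w - 1) + phi 1)) => //.
  by rewrite RintegralD// RintegralZl// RintegralB// eW' !ecst subrr mulr0 add0r.
have h10 u : 0 <= h1 u by have /andP[] := h1C u.
have h20 u : 0 <= h2 u by have /andP[] := h2C u.
rewrite (split _ _ _ _ mW1 (mixture_mean H1 mW1 mh1 h10 (ih _ mh1 h1C) e1)).
rewrite (split _ _ _ _ mW2 (mixture_mean H2 mW2 mh2 h20 (ih _ mh2 h2C) e2)).
by move=> h; rewrite leeD2r.
Qed.

End convex_order.

(** * The kernels of the stable variables *)

Section kernels.
Context {R : realType}.
Implicit Types a b u v : R.
Notation mu := (@lebesgue_measure R).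

(** Extension by 0 gives a measurable function on the whole line with values in [0, 1], as
    [mixture_of_moments] requires. *)
Definition kanter a : R -> R := (fun u => expR (ln_kanter a u)) \_ `]0, pi[.

Lemma kanterE a u : u \in `]0, pi[ -> kanter a u = expR (ln_kanter a u).
Proof. by move=> u0; rewrite /kanter patchE ifT//; rewrite inE. Qed.

Lemma kanter_itv01 a u : 0 < a < 1 -> 0 <= kanter a u <= 1.
Proof.
move=> a01; rewrite /kanter patchE; case: ifPn => [|_]; last by rewrite lexx ler01.
rewrite inE/= in_itv/= => u0; rewrite expR_ge0/= -expR0 ler_expR; exact: ln_kanter_le0.
Qed.

Lemma measurable_kanter a : 0 < a < 1 -> measurable_fun setT (kanter a).
Proof.
move=> a01; apply/(measurable_restrict _ _ _) => //; rewrite setTI.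
apply: measurableT_comp => //; apply: open_continuous_measurable_fun => // u.
rewrite inE/= in_itv/= => u0; exact: is_derive_continuous (is_derive_ln_kanter a01 u0).
Qed.

Lemma kanter_le a b u : 0 < b -> b < a -> a < 1 -> kanter a u <= kanter b u.
Proof.
move=> b0 ba a1; rewrite /kanter !patchE; case: ifPn => //.
by rewrite inE/= in_itv/= => u0; rewrite ler_expR; exact: ln_kanter_le.
Qed.

Lemma kanter_nonincreasing a : 0 < a < 1 ->
  {in `]0, pi[ &, {homo kanter a : u v / u <= v >-> v <= u}}.
Proof.
move=> a01 u v u0 v0 uv; rewrite !kanterE// ler_expR.
move: u0 v0; rewrite !in_itv/= => /andP[u0 _] /andP[_ vpi]; exact: ln_kanter_noninc.
Qed.

(** Monotonicity of the quotient in cross-multiplied form, which passes to the limit [kanter1]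
    without division. *)
Lemma kanter_ratio a b : 0 < b -> b < a -> a < 1 ->
  {in `]0, pi[ &, forall u v, u <= v -> kanter a v * kanter b u <= kanter a u * kanter b v}.
Proof.
move=> b0 ba a1 u v u0 v0 uv; rewrite !kanterE// -!expRD ler_expR.
move: u0 v0; rewrite !in_itv/= => /andP[u0 _] /andP[_ vpi].
have := ln_kanterB_nondec b0 ba a1 u0 uv vpi; lra.
Qed.

Lemma kanter_momentE a n : 0 < a < 1 ->
  n`!%:R * \int[mu]_(u in `]0, pi[) kanter a u ^+ n =
  pi * (((1 - a) * a `^ (a / (1 - a))) ^+ n * \prod_(i < n) (n%:R * (a / (1 - a)) + i.+1%:R)).
Proof.
move=> a01; rewrite -kanter_moment//; congr (_ * _); apply: eq_Rintegral => u.
by rewrite inE/= => u0; rewrite kanterE.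
Qed.

Lemma kanter_mean a : 0 < a < 1 ->
  \int[mu]_(u in `]0, pi[) kanter a u = pi * a `^ (a / (1 - a)).
Proof.
move=> a01; apply: (etrans (esym (mul1r _))); apply: (etrans (kanter_momentE 1 a01)).
rewrite big_ord_recl big_ord0 expr1 mulr1 mul1r.
have -> : (@ord0 0).+1%:R = 1 :> R by [].
by congr (_ * _); field; lra.
Qed.

(** For alpha = 1 - 1 / (j + 2) the exponent alpha / (1 - alpha) is the integer j + 1. *)
Definition sub1 (j : nat) : R := 1 - j.+2%:R^-1.

Lemma sub1_itv j : 0 < sub1 j < 1.
Proof.
rewrite /sub1 subr_gt0 invf_lt1 ?ltr0n// ltr1n/= -subr_gt0 opprB addrC subrK.
by rewrite invr_gt0.
Qed.

Lemma sub1_lt i j : (i < j)%N -> sub1 i < sub1 j.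
Proof. by move=> ij; rewrite /sub1 ltrD2l ltrN2 ltf_pV2 ?posrE ?ltr0n// ltr_nat !ltnS. Qed.

Lemma cvg_sub1 : sub1 j @[j --> \oo] --> (1 : R).
Proof.
rewrite [X in _ --> X](_ : _ = 1 - 0); last by rewrite subr0.
by apply: cvgB; [exact: cvg_cst|exact: cvg_invS].
Qed.

(** From 1 + t <= e^t at t = -1 / (j + 2); the lower bound below applies it at 1 / (j + 1) to the
    inverse of [sub1 j]. *)
Lemma sub1_exp_le j : sub1 j ^+ j.+1 <= expR (-1 + j.+2%:R^-1).
Proof.
have /andP[s0 s1] := sub1_itv j.
have -> : -1 + j.+2%:R^-1 = j.+1%:R * (- j.+2%:R^-1) :> R.
  rewrite -!natr1; have : 0 <= j%:R :> R by []. move: (j%:R : R) => x x0; field; lra.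
rewrite expRM_natl lerXn2r ?nnegrE ?expR_ge0 ?(ltW s0)//.
exact: expR_ge1Dx.
Qed.
Lemma sub1_exp_ge j : expR (-1) <= sub1 j ^+ j.+1.
Proof.
have /andP[s0 s1] := sub1_itv j.
have -> : -1 = j.+1%:R * (- j.+1%:R^-1) :> R by rewrite mulrN mulfV.
rewrite expRM_natl lerXn2r ?nnegrE ?expR_ge0 ?(ltW s0)//.
rewrite expRN -[leRHS]invrK lef_pV2 ?posrE ?expR_gt0 ?invr_gt0//.
apply: le_trans (expR_ge1Dx _); rewrite /sub1 -!natr1.
have : 0 <= j%:R :> R by []. move: (j%:R : R) => x x0.
by rewrite le_eqVlt; apply/orP; left; apply/eqP; field; lra.
Qed.
Lemma cvg_sub1_powR : sub1 j `^ (sub1 j / (1 - sub1 j)) @[j --> \oo] --> expR (-1 : R).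
Proof.
have e j : sub1 j `^ (sub1 j / (1 - sub1 j)) = sub1 j ^+ j.+1.
  have /andP[s0 s1] := sub1_itv j.
  rewrite -powR_mulrn ?(ltW s0)//; congr (_ `^ _); rewrite /sub1 -!natr1.
  have : 0 <= j%:R :> R by []. move: (j%:R : R) => x x0; field; lra.
under eq_fun do rewrite e.
apply: (@squeeze_cvgr _ _ _ _ (fun=> expR (-1)) (fun j => expR (-1 + j.+2%:R^-1))).
- by apply: nearW => j; rewrite sub1_exp_ge sub1_exp_le.
- exact: cvg_cst.
apply: continuous_cvg; first exact: continuous_expR.
rewrite [X in _ --> X](_ : _ = -1 + 0); last by rewrite addr0.
by apply: cvgD; [exact: cvg_cst|exact: cvg_invS].
Qed.

Lemma cvg_kanter_moment n : pi * (((1 - sub1 j) * sub1 j `^ (sub1 j / (1 - sub1 j))) ^+ n *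
    \prod_(i < n) (n%:R * (sub1 j / (1 - sub1 j)) + i.+1%:R)) @[j --> \oo] -->
  (pi * (expR (- n%:R) * n%:R ^+ n) : R).
Proof.
(* One factor 1 - alpha is given to each of the n terms of the product, which removes the
   divergence: n alpha + (i + 1) (1 - alpha) tends to n. *)
have e j : ((1 - sub1 j) * sub1 j `^ (sub1 j / (1 - sub1 j))) ^+ n *
      \prod_(i < n) (n%:R * (sub1 j / (1 - sub1 j)) + i.+1%:R) =
    (sub1 j `^ (sub1 j / (1 - sub1 j))) ^+ n *
      \prod_(i < n) (n%:R * sub1 j + i.+1%:R * (1 - sub1 j)).
  rewrite exprMn mulrAC mulrC; congr (_ * _).
  rewrite -{1}(card_ord n) -prodr_const -big_split/=; apply: eq_bigr => i _.
  by have /andP[_ s1] := sub1_itv j; field; lra.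
under eq_fun do rewrite e; apply: cvgMr; apply: cvgM.
  have -> : expR (- n%:R) = expR (-1) ^+ n :> R by rewrite -expRM_natl mulrN1.
  exact: (continuous_cvg _ (@exprn_continuous _ n _) cvg_sub1_powR).
suff H m : \prod_(i < m) (n%:R * sub1 j + i.+1%:R * (1 - sub1 j)) @[j --> \oo] -->
    (n%:R ^+ m : R) by exact: H.
elim: m => [|m IHm]; first by under eq_fun do rewrite big_ord0; exact: cvg_cst.
under eq_fun do rewrite big_ord_recr/=; rewrite exprSr; apply: cvgM => //.
rewrite [X in _ --> X](_ : _ = n%:R * 1 + m.+1%:R * (1 - 1)); last by rewrite subrr mulr0 addr0 mulr1.
apply: cvgD; apply: cvgMr; first exact: cvg_sub1.
by apply: cvgB; [exact: cvg_cst|exact: cvg_sub1].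
Qed.

(* Kernel of the 1-stable variable: Kanter's kernel decreases as alpha grows to 1. *)
Definition kanter1 u : R := limn (fun j => kanter (sub1 j) u).

Lemma kanter_sub1_noninc u : nonincreasing_seq (fun j => kanter (sub1 j) u).
Proof.
move=> i j; rewrite leq_eqVlt => /predU1P[->//|ij].
have /andP[s0 _] := sub1_itv i; have /andP[_ s1] := sub1_itv j.
by apply: kanter_le => //; exact: sub1_lt.
Qed.

Lemma cvg_kanter1 u : kanter (sub1 j) u @[j --> \oo] --> kanter1 u.
Proof.
apply: nonincreasing_is_cvgn; first exact: kanter_sub1_noninc.
by exists 0 => _ [j _ <-]; have /andP[] := kanter_itv01 u (sub1_itv j).
Qed.

Lemma kanter1_itv01 u : 0 <= kanter1 u <= 1.
Proof.
have c : cvgn (fun j => kanter (sub1 j) u) by apply: cvgP; exact: cvg_kanter1.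
by apply/andP; split; [apply: limr_ge => //|apply: limr_le => //];
  apply: nearW => j; have /andP[] := kanter_itv01 u (sub1_itv j).
Qed.

Lemma measurable_kanter1 : measurable_fun setT kanter1.
Proof.
apply: (measurable_fun_cvg (h := fun j => kanter (sub1 j))) => [j|u _].
  exact: measurable_kanter (sub1_itv j).
exact: cvg_kanter1.
Qed.

Lemma near_sub1_gt a : a < 1 -> \forall j \near \oo, a < sub1 j.
Proof. by move=> a1; apply: (cvgr_gt _ cvg_sub1). Qed.

Lemma kanter1_le a u : 0 < a < 1 -> kanter1 u <= kanter a u.
Proof.
move=> /andP[a0 a1]; apply: limr_le; first by apply: cvgP; exact: cvg_kanter1.
near=> j; apply: kanter_le => //; last by have /andP[] := sub1_itv j.
by near: j; exact: near_sub1_gt.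
Unshelve. all: by end_near.
Qed.

Lemma kanter1_ratio a : 0 < a < 1 ->
  {in `]0, pi[ &, forall u v, u <= v -> kanter1 v * kanter a u <= kanter1 u * kanter a v}.
Proof.
move=> /andP[a0 a1] u v u0 v0 uv.
have c x y : kanter (sub1 j) x * kanter a y @[j --> \oo] --> kanter1 x * kanter a y.
  by apply: cvgM; [exact: cvg_kanter1|exact: cvg_cst].
apply: (ler_cvg_to (c v u) (c u v)).
near=> j; apply: kanter_ratio => //; last by have /andP[] := sub1_itv j.
by near: j; exact: near_sub1_gt.
Unshelve. all: by end_near.
Qed.

Lemma kanter1_moment n :
  n`!%:R * \int[mu]_(u in `]0, pi[) kanter1 u ^+ n = pi * (expR (- n%:R) * n%:R ^+ n).
Proof.
have mI : measurable (`]0, pi[%classic : set (measurableTypeR R)) by [].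
have [_ h] : mu.-integrable `]0, pi[ (EFin \o (fun u => kanter1 u ^+ n)) /\
    \int[mu]_(u in `]0, pi[) kanter (sub1 j) u ^+ n @[j --> \oo] -->
    \int[mu]_(u in `]0, pi[) kanter1 u ^+ n.
  apply: (@cvg_dominated_Rintegral _ _ _ mu _ _ _ (fun=> 1)) => //.
  - move=> j; apply: measurable_funTS; apply: (measurableT_comp (exprn_measurable _)).
    exact: measurable_kanter (sub1_itv j).
  - by move=> u _; exact: (continuous_cvg _ (@exprn_continuous _ n _) (@cvg_kanter1 u)).
  - by apply: (@integrable_oo_measurable _ _ _ 1) => // u; rewrite normr1.
  - move=> j u _; have /andP[k0 k1] := kanter_itv01 u (sub1_itv j).
    by rewrite ger0_norm ?exprn_ge0// exprn_ile1.
have := @cvg_kanter_moment n; under eq_fun do rewrite -kanter_momentE ?sub1_itv//.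
move=> c2; have c1 : n`!%:R * \int[mu]_(u in `]0, pi[) kanter (sub1 j) u ^+ n @[j --> \oo] -->
    n`!%:R * \int[mu]_(u in `]0, pi[) kanter1 u ^+ n.
  by apply: cvgM => //; exact: cvg_cst.
exact: (cvg_unique _ c1 c2).
Qed.

Lemma kanter1_mean : \int[mu]_(u in `]0, pi[) kanter1 u = pi * expR (-1).
Proof.
apply: (etrans (esym (mul1r _))); apply: (etrans (kanter1_moment 1)).
by rewrite expr1 mulr1.
Qed.

(** The quotient h2 / h1 is nonincreasing, so a point where h2 > h1 cannot lie to the right of one
    where h2 < h1; then h1 nonincreasing concludes. *)
Lemma ratio_crossing (h1 h2 : R -> R) :
  (forall u, 0 <= h1 u) -> (forall u, 0 <= h2 u) ->
  {in `]0, pi[ &, {homo h1 : u v / u <= v >-> v <= u}} ->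
  {in `]0, pi[ &, forall u v, u <= v -> h2 v * h1 u <= h2 u * h1 v} ->
  {in `]0, pi[ &, forall u v, h1 u < h2 u -> h2 v < h1 v -> h1 v <= h1 u}.
Proof.
move=> h10 h20 h1n ratio u v u0 v0 hu hv; have [uv|vu] := leP u v; first exact: h1n.
have := ratio _ _ v0 u0 (ltW vu); have := h10 u; have := h20 v; nra.
Qed.

End kernels.

(** * The stable variables as mixtures, and the two chains of inequalities *)

Section mixtures.
Context {R : realType}.
Notation mu := (@lebesgue_measure R).
Context dL (TL : measurableType dL) (PL : probability TL R) (L : {RV PL >-> R}).
Hypothesis hL : unit_exponential L.

Lemma measurable_stable d (T : measurableType d) (P : probability T R) (Z : {RV P >-> R}) (k s : R) :
  measurable_fun setT (fun w => k * Z w `^ s).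
Proof.
by apply: measurable_funM => //; apply: (measurableT_comp (measurable_powR _)).
Qed.

Lemma stable_is_mixture d (T : measurableType d) (P : probability T R) (a : R) (Z : {RV P >-> R}) :
  0 < a < 1 -> positive_stable a Z ->
  is_mixture L (kanter a) P
    (fun w => (1 - a) * a `^ (a / (1 - a)) * Z w `^ (- (a / (1 - a)))).
Proof.
move=> a01 hZ; have /andP[a0 a1] := a01.
have k0 : 0 <= (1 - a) * a `^ (a / (1 - a)) by rewrite mulr_ge0 ?powR_ge0// subr_ge0 ltW.
apply: mixture_of_moments => //.
- exact: measurable_kanter.
- by move=> u; exact: kanter_itv01.
- exact: measurable_stable.
- by move=> w; rewrite mulr_ge0 ?powR_ge0.
move=> n; have := stable_moment n a01 k0 hZ; rewrite unlock => ->; congr EFin.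
by rewrite [RHS]mulrCA kanter_momentE// mulKf// gt_eqF ?pi_gt0.
Qed.

Lemma one_stable_is_mixture d (T : measurableType d) (P : probability T R) (X : {RV P >-> R}) :
  one_stable X -> is_mixture L kanter1 P (fun w => expR (X w)).
Proof.
move=> hX; apply: mixture_of_moments => //.
- exact: measurable_kanter1.
- by move=> u; exact: kanter1_itv01.
- exact: measurableT_comp.
move=> n; rewrite [X in X%:E]mulrCA kanter1_moment mulKf ?gt_eqF ?pi_gt0//.
under eq_integral do rewrite -expRM_natl.
(* At n = 0 the convention 0 ^+ 0 = 1 gives the right value; [one_stable_moment] covers positive
   exponents. *)
case: n => [|n].
  rewrite oppr0 expR0 mul1r expr0.
  have e := @expectation_cst _ _ _ P 1; rewrite unlock in e; rewrite -[RHS]e.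
  by apply: eq_integral => w _; rewrite mul0r expR0.
have n0 : 0 < n.+1%:R :> R by [].
have := one_stable_moment n0 hX; rewrite unlock => ->; congr EFin.
by rewrite addrC expRD expRM_natl lnK.
Qed.

End mixtures.

Theorem theoremA (R : realType) (alpha beta : R)
    (dX da db dL : measure_display)
    (TX : measurableType dX) (Ta : measurableType da)
    (Tb : measurableType db) (TL : measurableType dL)
    (PX : probability TX R) (Pa : probability Ta R)
    (Pb : probability Tb R) (PL : probability TL R)
    (X : {RV PX >-> R}) (Za : {RV Pa >-> R})
    (Zb : {RV Pb >-> R}) (L : {RV PL >-> R})
    (beta_gt0 : 0 < beta) (beta_lt_alpha : beta < alpha) (alpha_lt1 : alpha < 1)
    (hX : one_stable X) (hZa : positive_stable alpha Za)
    (hZb : positive_stable beta Zb) (hL : unit_exponential L) :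
  [/\ st_prec PX Pa
        (fun w => expR (X w))
        (fun w => (1 - alpha) * alpha `^ (alpha / (1 - alpha))
                  * Za w `^ (- (alpha / (1 - alpha)))),
      st_prec Pa Pb
        (fun w => (1 - alpha) * alpha `^ (alpha / (1 - alpha))
                  * Za w `^ (- (alpha / (1 - alpha))))
        (fun w => (1 - beta) * beta `^ (beta / (1 - beta))
                  * Zb w `^ (- (beta / (1 - beta))))
    & st_prec Pb PL
        (fun w => (1 - beta) * beta `^ (beta / (1 - beta))
                  * Zb w `^ (- (beta / (1 - beta))))
        L]
  /\
  [/\ cx_prec PL Pb
        L
        (fun w => (1 - beta) * Zb w `^ (- (beta / (1 - beta)))),
      cx_prec Pb Pa
        (fun w => (1 - beta) * Zb w `^ (- (beta / (1 - beta))))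
        (fun w => (1 - alpha) * Za w `^ (- (alpha / (1 - alpha))))
    & cx_prec Pa PX
        (fun w => (1 - alpha) * Za w `^ (- (alpha / (1 - alpha))))
        (fun w => expR 1 * expR (X w))].
Proof.
have alpha_gt0 : 0 < alpha := lt_trans beta_gt0 beta_lt_alpha.
have beta_lt1 : beta < 1 := lt_trans beta_lt_alpha alpha_lt1.
have alpha01 : 0 < alpha < 1 by rewrite alpha_gt0.
have beta01 : 0 < beta < 1 by rewrite beta_gt0.
have mixX := one_stable_is_mixture hL hX.
have mixa := stable_is_mixture hL alpha01 hZa.
have mixb := stable_is_mixture hL beta01 hZb.
have mixL := exponential_is_mixture hL.
have mX : measurable_fun setT (fun w => expR (X w)) by exact: measurableT_comp.
have mka := measurable_kanter alpha01; have mkb := measurable_kanter beta01.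
have mk1 := @measurable_kanter1 R.
have mc (c : R) : measurable_fun setT (fun _ : R => c) by [].
pose Wa w := (1 - alpha) * alpha `^ (alpha / (1 - alpha)) * Za w `^ (- (alpha / (1 - alpha))).
pose Wb w := (1 - beta) * beta `^ (beta / (1 - beta)) * Zb w `^ (- (beta / (1 - beta))).
have mWa : measurable_fun setT Wa by exact: measurable_stable.
have mWb : measurable_fun setT Wb by exact: measurable_stable.
split.
  have le_Xa : st_le PX Pa (fun w => expR (X w)) Wa.
    by apply: (is_mixture_st_le mixX mixa) => // u _; exact: kanter1_le.
  have le_ab : st_le Pa Pb Wa Wb.
    by apply: (is_mixture_st_le mixa mixb) => // u _; exact: kanter_le.
  have le_bL : st_le Pb PL Wb L.
    apply: (is_mixture_st_le mixb mixL) => // u _.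
    by have /andP[] := kanter_itv01 u beta01.
  have le_cXa c : 0 <= c -> st_le PX Pa (fun w => c * expR (X w)) (fun w => c * Wa w).
    move=> c0; apply: (is_mixture_st_le (is_mixtureZ c mixX) (is_mixtureZ c mixa)).
    - exact: measurable_funM.
    - exact: measurable_funM.
    - exact: measurable_funM.
    - exact: measurable_funM.
    by move=> u _; rewrite ler_wpM2l// kanter1_le.
  have le_cab c : 0 <= c -> st_le Pa Pb (fun w => c * Wa w) (fun w => c * Wb w).
    move=> c0; apply: (is_mixture_st_le (is_mixtureZ c mixa) (is_mixtureZ c mixb)).
    - exact: measurable_funM.
    - exact: measurable_funM.
    - exact: measurable_funM.
    - exact: measurable_funM.
    by move=> u _; rewrite ler_wpM2l// kanter_le.
  (* In each case the factor c is carried down to S by the scaled comparisons and the chain is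
     closed at L, which contradicts [one_stable_optimal]. *)
  split; split => // -[c [c1 le_c]]; have c0 : 0 <= c by lra.
  - apply: (one_stable_optimal hL hX c1) => x.
    exact: le_trans (le_c x) (le_trans (le_ab x) (le_bL x)).
  - apply: (one_stable_optimal hL hX c1) => x.
    exact: le_trans (le_cXa c c0 x) (le_trans (le_c x) (le_bL x)).
  - apply: (one_stable_optimal hL hX c1) => x.
    exact: le_trans (le_cXa c c0 x) (le_trans (le_cab c c0 x) (le_c x)).
(* By [kanter_mean] these are the means of the variables in the first chain; dividing by them gives
   the normalisation of the second. *)
pose pa := alpha `^ (alpha / (1 - alpha)); pose pb := beta `^ (beta / (1 - beta)).
have pa0 : 0 < pa by exact: powR_gt0.
have pb0 : 0 < pb by exact: powR_gt0.
have scale (p a z : R) : 0 < p -> p^-1 * ((1 - a) * p * z) = (1 - a) * z.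
  by move=> p0; field; rewrite gt_eqF.
have mixa' : is_mixture L (fun u => pa^-1 * kanter alpha u) Pa
    (fun w => (1 - alpha) * Za w `^ (- (alpha / (1 - alpha)))).
  have := is_mixtureZ pa^-1 mixa; congr is_mixture.
  by apply/funext => w; rewrite -/pa scale.
have mixb' : is_mixture L (fun u => pb^-1 * kanter beta u) Pb
    (fun w => (1 - beta) * Zb w `^ (- (beta / (1 - beta)))).
  have := is_mixtureZ pb^-1 mixb; congr is_mixture.
  by apply/funext => w; rewrite -/pb scale.
have mixX' := is_mixtureZ (expR 1) mixX.
have mka' : measurable_fun setT (fun u => pa^-1 * kanter alpha u) by exact: measurable_funM.
have mkb' : measurable_fun setT (fun u => pb^-1 * kanter beta u) by exact: measurable_funM.
have mk1' : measurable_fun setT (fun u : R => expR 1 * kanter1 u) by exact: measurable_funM.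
have mean (c m : R) (k : R -> R) : measurable_fun setT k -> (forall u, 0 <= k u <= 1) ->
    \int[@lebesgue_measure R]_(u in `]0, pi[) k u = pi * m -> c * m = 1 ->
    \int[@lebesgue_measure R]_(u in `]0, pi[) (c * k u) = pi.
  move=> mk k01 e cm; rewrite RintegralZl//.
    by rewrite e mulrCA cm mulr1.
  apply: (@integrable_oo_measurable _ _ _ 1) => // u.
  by have /andP[k0 k1] := k01 u; rewrite ger0_norm.
have meana := mean _ _ _ mka (fun u => kanter_itv01 u alpha01) (kanter_mean alpha01) (mulVf (lt0r_neq0 pa0)).
have meanb := mean _ _ _ mkb (fun u => kanter_itv01 u beta01) (kanter_mean beta01) (mulVf (lt0r_neq0 pb0)).
have e1 : expR 1 * expR (-1) = 1 :> R by rewrite -expRD subrr expR0.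
have mean1 := mean _ _ _ mk1 (@kanter1_itv01 R) (@kanter1_mean R) e1.
(* A common upper bound for the four normalised kernels. *)
pose C := Num.max (Num.max 1 pb^-1) (Num.max pa^-1 (expR 1)).
have bound (c : R) (k : R -> R) : 0 <= c -> c <= C -> (forall u, 0 <= k u <= 1) -> forall u, 0 <= c * k u <= C.
  move=> c0 cC k01 u; have /andP[k0 k1] := k01 u.
  by rewrite mulr_ge0//= (le_trans _ cC)// ler_piMr.
have CE : [/\ 1 <= C, pb^-1 <= C, pa^-1 <= C & expR 1 <= C].
  by rewrite /C !le_max !lexx !orbT.
case: CE => C1 Cb Ca Ce.
have boundL (u : R) : 0 <= (1 : R) <= C by rewrite ler01.
have pa'0 : 0 <= pa^-1 by rewrite invr_ge0 ltW.
have pb'0 : 0 <= pb^-1 by rewrite invr_ge0 ltW.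
have boundb := bound _ _ pb'0 Cb (fun u => kanter_itv01 u beta01).
have bounda := bound _ _ pa'0 Ca (fun u => kanter_itv01 u alpha01).
have bound1 := bound _ _ (expR_ge0 1) Ce (@kanter1_itv01 R).
have meanL : \int[@lebesgue_measure R]_(u in `]0, pi[) 1 = pi by rewrite Rintegral_cst_0pi mul1r.
have mWa' := measurable_stable Za (1 - alpha) (- (alpha / (1 - alpha))).
have mWb' := measurable_stable Zb (1 - beta) (- (beta / (1 - beta))).
have ge0 (c : R) (k : R -> R) (h : forall u, 0 <= c * k u <= C) u : 0 <= c * k u by have /andP[] := h u.
split.
(* The kernel of L is the constant 1, for which the crossing condition is immediate. *)
- by apply: (mixture_cx hL mixL mixb' _ _ _ _ boundL boundb meanL meanb).
- apply: (mixture_cx hL mixb' mixa' _ _ _ _ boundb bounda meanb meana) => //.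
  apply: (ratio_crossing (ge0 _ _ boundb) (ge0 _ _ bounda)) => u v u0 v0 uv.
    by rewrite ler_wpM2l// kanter_nonincreasing.
  rewrite [leLHS]mulrACA [leRHS]mulrACA ler_wpM2l ?mulr_ge0//; exact: kanter_ratio.
apply: (mixture_cx hL mixa' mixX' _ _ _ _ bounda bound1 meana mean1) => //.
  exact: measurable_funM.
apply: (ratio_crossing (ge0 _ _ bounda) (ge0 _ _ bound1)) => u v u0 v0 uv.
  by rewrite ler_wpM2l// kanter_nonincreasing.
by rewrite [leLHS]mulrACA [leRHS]mulrACA ler_wpM2l ?mulr_ge0 ?expR_ge0// kanter1_ratio.
Qed.
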